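(* Let $t\in\mathbb{R}$. The algebra $M(t)$ obeys Norton's inequality, i.e. $\langle u\cdot u,v\cdot v\rangle\ge\langle u\cdot v,u\cdot v\rangle$ for all $u,v\in M(t)$, if and only if $t\in[0,\frac16]$.
   Context: Algebras are commutative but not necessarily associative, over a commutative ring $R$ with $1$ containing $\mathbb{R}$ as a subfield. For an idempotent $a\in V$ and $\lambda\in R$ put $V_\lambda^{(a)}=\{v\in V: a\cdot v=\lambda v\}$, and for $\Lambda\subseteq R$ put $V_\Lambda^{(a)}=\bigoplus_{\lambda\in\Lambda}V_\lambda^{(a)}$ ($V_\emptyset^{(a)}=0$). The Monster fusion rule $(\mathcal{M},* )$ has $\mathcal{M}=\{1,0,\frac14,\frac1{32}\}$ and symmetric $*$ with $1*1=\{1\}$, $1*0=\emptyset$, $0*0=\{0\}$, $1*\frac14=0*\frac14=\{\frac14\}$, $\frac14*\frac14=\{1,0\}$, $\lambda*\frac1{32}=\{\frac1{32}\}$ for $\lambda\in\{1,0,\frac14\}$, $\frac1{32}*\frac1{32}=\{1,0,\frac14\}$. An idempotent $a$ is an $(\mathcal{M},* )$-axis if $V=\bigoplus_{\lambda\in\mathcal{M}}V_\lambda^{(a)}$ and $V_\lambda^{(a)}\cdot V_\mu^{(a)}\subseteq V_{\lambda*\mu}^{(a)}$ for all $\lambda,\mu\in\mathcal{M}$; it is primitive if $V_1^{(a)}=Ra$. A primitive Frobenius $(\mathcal{M},* )$-axial algebra is an algebra generated by a set $A$ of primitive $(\mathcal{M},* )$-axes with a Frobenius form, i.e. a nonzero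 $R$-bilinear form $\langle\,,\rangle$ with $\langle u,v\cdot w\rangle=\langle u\cdot v,w\rangle$, normalised by $\langle a,a\rangle=1$ for axes $a\in A$. The Miyamoto involution $\tau(a)$ acts as $1$ on $V_1^{(a)}\oplus V_0^{(a)}\oplus V_{1/4}^{(a)}$ and as $-1$ on $V_{1/32}^{(a)}$. Property $\mathcal{P}$: $A=\{a_1,a_{-1},a_2,a_{-2},a_3,a_{-3}\}$ and on $A$, $\tau(a_1)=\tau(a_{-1})=(a_2,a_{-2})(a_3,a_{-3})$, $\tau(a_2)=\tau(a_{-2})=(a_1,a_{-1})(a_3,a_{-3})$, $\tau(a_3)=\tau(a_{-3})=(a_1,a_{-1})(a_2,a_{-2})$. Shape $4A$: for all distinct $i,j\in\{1,2,3\}$ the subalgebra $\langle\langle a_i,a_j\rangle\rangle$ generated by $a_i,a_j$ is of type $4A$, i.e. it is spanned by $a_{\pm i},a_{\pm j}$ and an idempotent $v=v_{(i,j)}=v_{(j,i)}$ such that, for all signs $\epsilon,\delta$: $a_{\epsilon i}\cdot a_{\delta j}=\frac1{64}(3a_{\epsilon i}+3a_{\delta j}+a_{-\epsilon i}+a_{-\delta j}-3v)$, $a_{\epsilon i}\cdot v=\frac1{16}(5a_{\epsilon i}-a_{-\epsilon i}-2a_j-2a_{-j}+3v)$, $a_{\delta j}\cdot v=\frac1{16}(5a_{\delta j}-a_{-\delta j}-2a_i-2a_{-i}+3v)$, $a_i\cdot a_{-i}=a_j\cdot a_{-j}=0$, $\langle a_{\epsilon i},a_{\delta j}\rangle=\frac1{32}$,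 $\langle a_i,a_{-i}\rangle=\langle a_j,a_{-j}\rangle=0$, $\langle a_{\epsilon i},v\rangle=\langle a_{\delta j},v\rangle=\frac38$, $\langle v,v\rangle=2$. Universal algebra: let $\hat X$ be the free commutative non-associative magma on $\hat a_{\pm1},\hat a_{\pm2},\hat a_{\pm3}$; let $\sim$ be the equivalence relation on $\hat X\times\hat X$ generated by $(\hat x\cdot\hat y,\hat z)\sim(\hat x,\hat y\cdot\hat z)$; let $\hat R=\mathbb{R}[\lambda_{[\hat x,\hat y]}]$ be the polynomial ring with one indeterminate for each $\sim$-class; let $\hat M=\hat R\hat X$ be the algebra of formal $\hat R$-linear combinations of elements of $\hat X$, with $\hat R$-bilinear form $\langle\hat x,\hat y\rangle=\lambda_{[\hat x,\hat y]}$. For ideals $I$ of $\hat M$ and $J\ne\hat R$ of $\hat R$ with $J\hat M\subseteq I$ and $\langle I,\hat M\rangle\subseteq J$, the quotient $\hat M/I$ is an algebra with form over its coefficient ring $\hat R/J$, with marked generators $a_{\pm i}$ the images of $\hat a_{\pm i}$. Let $\mathcal{C}_{4A}$ be the class of such quotients which are primitive Frobenius $(\mathcal{M},* )$-axial algebras (with axes the marked generators) satisfying property $\mathcal{P}$ and having shape $4A$. $M_{4A}$ denotes the universal member of $\mathcal{C}_{4A}$ (given by the smallest pair $(I,J)$; all members of $\mathcal{C}_{4A}$ are quotients of it), and $R_{4A}=\hat R/J$ its coefficient ring. Specialisation: $R_{4A}$ is the polynomial ring $\mathbb{R}[t]$ in $t=\langle a_1,v_{(2,3)}\rangle$. For a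 real number $t_0$, $M(t_0)$ denotes the real algebra $M_{4A}/(t-t_0)M_{4A}$ obtained by letting $t$ take the value $t_0$ (a $12$-dimensional axial algebra of Monster type), with axes the images of $a_{\pm1},a_{\pm2},a_{\pm3}$ and with the induced Frobenius form. *)

(* Defs.v *)
From HB Require Import structures.
From mathcomp Require Import all_boot all_order all_algebra ring_quotient.
From mathcomp Require Import finmap.
From mathcomp Require Import boolp classical_sets reals.
From mathcomp Require Import monalg.

Set Implicit Arguments.
Unset Strict Implicit.
Unset Printing Implicit Defensive.

Import Order.TTheory GRing.Theory Num.Theory.
Local Open Scope classical_set_scope.
Local Open Scope quotient_scope.
Local Open Scope ring_scope.

(* [iota] is the inclusion of the reals in the coefficient ring. That ring may
   be zero, so that quotients can be formed without a properness proof;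
   properness is part of [C4A] below. *)
Record formAlg (R : realType) := FormAlg {
  coef : comPzRingType;
  iota : {rmorphism R -> coef};
  car : lmodType coef;
  amul : car -> car -> car;
  form : car -> car -> coef;
  amulC : forall u v, amul u v = amul v u;
  amul_linear : forall s u v w,
    amul (s *: u + v) w = s *: amul u w + amul v w;
  form_linearl : forall s u v w,
    form (s *: u + v) w = s * form u w + form v w;
  form_linearr : forall s u v w,
    form w (s *: u + v) = s * form w u + form w v
}.

Definition rscale (R : realType) (A : formAlg R) (r : R) (v : car A) : car A :=
  iota A r *: v.

Reserved Notation "r %*: v" (at level 40, v at next level, no associativity).
Notation "r %*: v" := (rscale r v) : ring_scope.
Reserved Notation "u ∙ v" (at level 40, left associativity).
Notation "u ∙ v" := (amul u v) : ring_scope.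
Reserved Notation "⟨ u , v ⟩" (at level 0, format "⟨ u ,  v ⟩").
Notation "⟨ u , v ⟩" := (form u v) : ring_scope.

Inductive monster := E1 | E0 | E4 | E32.

Definition evalue (R : realType) (l : monster) : R :=
  match l with E1 => 1 | E0 => 0 | E4 => 4^-1 | E32 => 32^-1 end.

Definition allM := [:: E1; E0; E4; E32].

Definition fusion (l m : monster) : seq monster :=
  match l, m with
  | E1, E1 => [:: E1]
  | E0, E0 => [:: E0]
  | E1, E0 | E0, E1 => [::]
  | E4, E4 => [:: E1; E0]
  | E32, E32 => [:: E1; E0; E4]
  | E32, _ | _, E32 => [:: E32]
  | E4, _ | _, E4 => [:: E4]
  end.

Section Axes.
Variables (R : realType) (A : formAlg R).
Local Notation V := (car A).
Implicit Types (a u v w : V) (l m : monster).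

Definition eigenspace a l : set V := [set v | a ∙ v = evalue R l %*: v].

Definition eigenfamily a (f : monster -> V) := forall l, eigenspace a l (f l).

Definition eigensum a (L : seq monster) : set V :=
  [set v | exists2 f, eigenfamily a f & v = \sum_(l <- L) f l].

Definition eigen_direct a :=
  eigensum a allM = setT /\
  forall f, eigenfamily a f -> \sum_(l <- allM) f l = 0 -> forall l, f l = 0.

Definition axis a := [/\ a ∙ a = a, eigen_direct a
  & forall l m u v, eigenspace a l u -> eigenspace a m v ->
      eigensum a (fusion l m) (u ∙ v)].

Definition primitive a := eigenspace a E1 = [set r *: a | r in setT].

Definition submod (B : set V) :=
  B 0 /\ forall s u v, B u -> B v -> B (s *: u + v).

Definition subalg (B : set V) :=
  submod B /\ forall u v, B u -> B v -> B (u ∙ v).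

Definition frobenius_form (X : set V) :=
  [/\ exists u v, ⟨u, v⟩ <> 0,
      forall u v w, ⟨u, v ∙ w⟩ = ⟨u ∙ v, w⟩
    & forall a, X a -> ⟨a, a⟩ = 1].

Definition primitive_frobenius_axial (X : set V) :=
  [/\ smallest subalg X = setT,
      forall a, X a -> axis a /\ primitive a
    & frobenius_form X].

(* The graph of the Miyamoto involution of [a]: [w] is the image of [v]. *)
Definition miyamoto a v w := exists2 f, eigenfamily a f &
  v = \sum_(l <- allM) f l /\ w = f E1 + f E0 + f E4 - f E32.

(* A marking [x]: [x i true] is a_(i+1) and [x i false] is a_-(i+1). *)
Implicit Types (x : 'I_3 -> bool -> V) (i j : 'I_3).

Definition axes x : set V := [set x i e | i in setT & e in setT].

(* τ(x i e) fixes a_i and a_-i, and swaps a_j with a_-j for each j <> i. *)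
Definition propertyP x := forall i e j d,
  miyamoto (x i e) (x j d) (x j (if i == j then d else ~~ d)).

Definition type4A x i j v :=
  [/\ smallest subalg [set x i true; x j true] =
        smallest submod
          [set x i true; x i false; x j true; x j false; v],
      v ∙ v = v /\ ⟨v, v⟩ = iota A 2,
      forall e d : bool,
        [/\ x i e ∙ x j d = 64^-1 %*:
              (3 %*: x i e + 3 %*: x j d + x i (~~ e) + x j (~~ d) - 3 %*: v),
            x i e ∙ v = 16^-1 %*: (5 %*: x i e - x i (~~ e)
              - 2 %*: x j true - 2 %*: x j false + 3 %*: v),
            x j d ∙ v = 16^-1 %*: (5 %*: x j d - x j (~~ d)
              - 2 %*: x i true - 2 %*: x i false + 3 %*: v)
          & [/\ ⟨x i e, x j d⟩ = iota A 32^-1,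
                ⟨x i e, v⟩ = iota A (3 / 8)
              & ⟨x j d, v⟩ = iota A (3 / 8)]]
    & [/\ x i true ∙ x i false = 0, x j true ∙ x j false = 0,
          ⟨x i true, x i false⟩ = 0 & ⟨x j true, x j false⟩ = 0]].

Definition shape4A x := exists v : 'I_3 -> 'I_3 -> V,
  forall i j, i != j -> v i j = v j i /\ type4A x i j (v i j).

(* The formula for a_i ∙ a_j in a 4A subalgebra, solved for v_(i,j);
   see [type4A_v4A]. *)
Definition v4A x i j : V :=
  3^-1 %*: (3 %*: x i true + 3 %*: x j true + x i false + x j false
            - 64 %*: (x i true ∙ x j true)).

Lemma rscaleK (r s : R) v : r * s = 1 -> r %*: (s %*: v) = v.
Proof. by move=> rs1; rewrite /rscale scalerA -rmorphM rs1 rmorph1 scale1r. Qed.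

Lemma type4A_v4A x i j v : type4A x i j v -> v = v4A x i j.
Proof.
case=> _ _ /(_ true true)[E _ _ _] _; rewrite /v4A E /=.
rewrite (rscaleK _ (r := 64)) ?divff ?pnatr_eq0 // subKr.
by rewrite rscaleK // mulVf ?pnatr_eq0.
Qed.

End Axes.

(* [idJ_forml] alone would not make the induced form well defined: on the
   universal algebra <x, y> and <y, x> may differ when x and y are generators.
   Given [idJ_forml], [idJ_formr] holds whenever the generators become
   idempotent in the quotient. *)
Record idealPair (R : realType) (A : formAlg R) := IdealPair {
  idI : set (car A);
  idJ : set (coef A);
  idI_submod : submod idI;
  idI_mul : forall u v, idI u -> idI (u ∙ v);
  idJ_0 : idJ 0;
  idJ_lin : forall s r r', idJ r -> idJ r' -> idJ (s * r + r');
  idJ_scale : forall s v, idJ s -> idI (s *: v);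
  idJ_forml : forall u v, idI u -> idJ ⟨u, v⟩;
  idJ_formr : forall u v, idI v -> idJ ⟨u, v⟩
}.

Section Quotient.
Variables (R : realType) (A : formAlg R) (p : idealPair A).
Local Notation S := (coef A).
Local Notation V := (car A).

Definition idJ_pred : {pred S} := fun s => `[< idJ p s >].
Definition idI_pred : {pred V} := fun v => `[< idI p v >].

Lemma idJ_predE s : (s \in idJ_pred) = `[< idJ p s >]. Proof. by []. Qed.
Lemma idI_predE v : (v \in idI_pred) = `[< idI p v >]. Proof. by []. Qed.

Lemma idJ_zmod_closed : zmod_closed idJ_pred.
Proof.
split=> [|r s /asboolP Jr /asboolP Js]; apply/asboolP; first exact: idJ_0.
by rewrite addrC -mulN1r; apply: idJ_lin.
Qed.

Lemma idI_zmod_closed : zmod_closed idI_pred.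
Proof.
have [I0 IL] := idI_submod p.
split=> [|r s /asboolP Ir /asboolP Is]; apply/asboolP => //.
by rewrite addrC -scaleN1r; apply: IL.
Qed.

HB.instance Definition _ := GRing.isZmodClosed.Build S idJ_pred idJ_zmod_closed.
HB.instance Definition _ := GRing.isZmodClosed.Build V idI_pred idI_zmod_closed.

Definition qcoef := Quotient.quot idJ_pred.
Definition qcar := Quotient.quot idI_pred.
HB.instance Definition _ := GRing.Zmodule.on qcoef.
HB.instance Definition _ := GRing.Zmodule.on qcar.

Definition qJ (s : S) : qcoef := \pi s.
Definition qI (v : V) : qcar := \pi v.

Lemma qJ_eq r s : qJ r = qJ s <-> idJ p (r - s).
Proof.
split=> [/eqP|h]; last apply/eqP; rewrite /qJ piE /Quotient.equiv idJ_predE.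
  by move/asboolP.
exact/asboolP.
Qed.

Lemma qI_eq u v : qI u = qI v <-> idI p (u - v).
Proof.
split=> [/eqP|h]; last apply/eqP; rewrite /qI piE /Quotient.equiv idI_predE.
  by move/asboolP.
exact/asboolP.
Qed.

Lemma qJ_repr x : qJ (repr x) = x. Proof. exact: reprK. Qed.
Lemma qI_repr x : qI (repr x) = x. Proof. exact: reprK. Qed.

Fact qJD r s : qJ (r + s) = qJ r + qJ s. Proof. by rewrite /qJ raddfD. Qed.
Fact qID u v : qI (u + v) = qI u + qI v. Proof. by rewrite /qI raddfD. Qed.

Definition qone : qcoef := qJ 1.
Definition qprod (x y : qcoef) : qcoef := qJ (repr x * repr y).
Definition qscale (x : qcoef) (u : qcar) : qcar := qI (repr x *: repr u).
Definition qamul (u v : qcar) : qcar := qI (repr u ∙ repr v).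
Definition qform (u v : qcar) : qcoef := qJ ⟨repr u, repr v⟩.

Lemma qJ_reprB r : idJ p (repr (qJ r) - r).
Proof. by apply/qJ_eq; rewrite qJ_repr. Qed.

Lemma qI_reprB u : idI p (repr (qI u) - u).
Proof. by apply/qI_eq; rewrite qI_repr. Qed.

Lemma idJ_add r s : idJ p r -> idJ p s -> idJ p (r + s).
Proof. by move=> Jr Js; rewrite -[r]mul1r; apply: idJ_lin. Qed.

Lemma idJ_mul r s : idJ p s -> idJ p (r * s).
Proof. by move=> Js; rewrite -[_ * _]addr0; apply: idJ_lin => //; apply: idJ_0. Qed.

Lemma idI_add u v : idI p u -> idI p v -> idI p (u + v).
Proof. by case: (idI_submod p) => _ L Iu Iv; rewrite -[u]scale1r; apply: L. Qed.

Lemma idI_mulr s v : idI p v -> idI p (s *: v).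
Proof. by case: (idI_submod p) => I0 L Iv; rewrite -[_ *: _]addr0; apply: L. Qed.

Lemma amulBl u v w : (u - v) ∙ w = u ∙ w - v ∙ w :> V.
Proof. by rewrite addrC -scaleN1r amul_linear scaleN1r addrC. Qed.

Lemma formBl u v w : ⟨u - v, w⟩ = ⟨u, w⟩ - ⟨v, w⟩ :> S.
Proof. by rewrite addrC -scaleN1r form_linearl mulN1r addrC. Qed.

Lemma formBr u v w : ⟨w, u - v⟩ = ⟨w, u⟩ - ⟨w, v⟩ :> S.
Proof. by rewrite addrC -scaleN1r form_linearr mulN1r addrC. Qed.

Lemma qJM r s : qJ (r * s) = qprod (qJ r) (qJ s).
Proof.
apply/esym/qJ_eq; set r' := repr _; set s' := repr _.
have -> : r' * s' - r * s = s' * (r' - r) + r * (s' - s).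
  by rewrite !mulrBr [s' * r']mulrC [s' * r]mulrC addrA subrK.
by apply: idJ_add; apply: idJ_mul; apply: qJ_reprB.
Qed.

Lemma qIZ s v : qI (s *: v) = qscale (qJ s) (qI v).
Proof.
apply/esym/qI_eq; set s' := repr _; set v' := repr _.
have -> : s' *: v' - s *: v = (s' - s) *: v' + s *: (v' - v).
  by rewrite scalerBl scalerBr addrA subrK.
apply: idI_add; first by apply: idJ_scale; apply: qJ_reprB.
by apply: idI_mulr; apply: qI_reprB.
Qed.

Lemma qIM u v : qI (u ∙ v) = qamul (qI u) (qI v).
Proof.
apply/esym/qI_eq; set u' := repr _; set v' := repr _.
have -> : u' ∙ v' - u ∙ v = (u' - u) ∙ v' + (v' - v) ∙ u.
  by rewrite !amulBl [v' ∙ u]amulC [v ∙ u]amulC addrA subrK.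
by apply: idI_add; apply: idI_mul; apply: qI_reprB.
Qed.

Lemma qJ_form u v : qJ ⟨u, v⟩ = qform (qI u) (qI v).
Proof.
apply/esym/qJ_eq; set u' := repr _; set v' := repr _.
have -> : ⟨u', v'⟩ - ⟨u, v⟩ = ⟨u' - u, v'⟩ + ⟨u, v' - v⟩.
  by rewrite formBl formBr addrA subrK.
apply: idJ_add; first by apply: idJ_forml; apply: qI_reprB.
by apply: idJ_formr; apply: qI_reprB.
Qed.

Fact qprodA : associative qprod.
Proof.
move=> x y z; rewrite -[x]qJ_repr -[y]qJ_repr -[z]qJ_repr.
by rewrite -!qJM mulrA.
Qed.

Fact qprodC : commutative qprod.
Proof. by move=> x y; rewrite /qprod mulrC. Qed.

Fact qprod1 : left_id qone qprod.
Proof. by move=> x; rewrite -[x]qJ_repr -qJM mul1r. Qed.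

Fact qprodDl : left_distributive qprod +%R.
Proof.
move=> x y z; rewrite -[x]qJ_repr -[y]qJ_repr -[z]qJ_repr.
by rewrite -qJD -!qJM mulrDl qJD.
Qed.

HB.instance Definition _ :=
  GRing.Zmodule_isComPzRing.Build qcoef qprodA qprodC qprod1 qprodDl.

Fact qJ_monoid_morphism : monoid_morphism qJ.
Proof. by split=> // r s; apply: qJM. Qed.

Fact qscaleA x y u : qscale x (qscale y u) = qscale (x * y) u.
Proof.
rewrite -[x]qJ_repr -[y]qJ_repr -[u]qI_repr -qJ_monoid_morphism.2.
by rewrite -!qIZ scalerA.
Qed.

Fact qscale1 : left_id 1 qscale.
Proof. by move=> u; rewrite -[u]qI_repr -qIZ scale1r. Qed.

Fact qscaleDr : right_distributive qscale +%R.
Proof.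
move=> x u v; rewrite -[x]qJ_repr -[u]qI_repr -[v]qI_repr.
by rewrite -qID -!qIZ scalerDr qID.
Qed.

Fact qscaleDl v : {morph qscale^~ v : x y / x + y}.
Proof.
move=> x y; rewrite -[x]qJ_repr -[y]qJ_repr -[v]qI_repr.
by rewrite -qJD -!qIZ scalerDl qID.
Qed.

HB.instance Definition _ := GRing.Zmodule_isLmodule.Build qcoef qcar
  qscaleA qscale1 qscaleDr qscaleDl.

Fact qJ_zmod_morphism : zmod_morphism qJ.
Proof. by move=> r s; rewrite /qJ raddfB. Qed.

HB.instance Definition _ := GRing.isZmodMorphism.Build S qcoef qJ
  qJ_zmod_morphism.
HB.instance Definition _ := GRing.isMonoidMorphism.Build S qcoef qJ
  qJ_monoid_morphism.

Definition qiota : {rmorphism R -> qcoef} := qJ \o iota A.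

Fact qamulC u v : qamul u v = qamul v u.
Proof. by rewrite /qamul amulC. Qed.

Fact qI_linear s u v : qI (s *: u + v) = qJ s *: qI u + qI v.
Proof. by rewrite qID qIZ. Qed.

Fact qamul_linear (s : qcoef) (u v w : qcar) :
  qamul (s *: u + v) w = s *: qamul u w + qamul v w.
Proof.
rewrite -[s]qJ_repr -[u]qI_repr -[v]qI_repr -[w]qI_repr.
by rewrite -qI_linear -!qIM amul_linear qI_linear.
Qed.

Fact qform_linearl (s : qcoef) (u v w : qcar) :
  qform (s *: u + v) w = s * qform u w + qform v w.
Proof.
rewrite -[s]qJ_repr -[u]qI_repr -[v]qI_repr -[w]qI_repr.
by rewrite -qI_linear -!qJ_form form_linearl rmorphD rmorphM.
Qed.

Fact qform_linearr (s : qcoef) (u v w : qcar) :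
  qform w (s *: u + v) = s * qform w u + qform w v.
Proof.
rewrite -[s]qJ_repr -[u]qI_repr -[v]qI_repr -[w]qI_repr.
by rewrite -qI_linear -!qJ_form form_linearr rmorphD rmorphM.
Qed.

Definition quotAlg : formAlg R :=
  FormAlg qiota qamulC qamul_linear qform_linearl qform_linearr.

End Quotient.

Definition gen : Type := 'I_3 * bool.

Inductive tree := Leaf of gen | Node of tree & tree.
HB.instance Definition _ := gen_eqMixin tree.
HB.instance Definition _ := gen_choiceMixin tree.

Inductive tree_comm : tree -> tree -> Prop :=
| tc_refl s : tree_comm s s
| tc_sym s t : tree_comm s t -> tree_comm t s
| tc_trans s t u : tree_comm s t -> tree_comm t u -> tree_comm s u
| tc_node s s' t t' : tree_comm s s' -> tree_comm t t' ->
    tree_comm (Node s t) (Node s' t')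
| tc_comm s t : tree_comm (Node s t) (Node t s).

Definition tree_rel (s t : tree) := `[< tree_comm s t >].

Fact tree_rel_equiv : equiv_class_of tree_rel.
Proof.
split=> [s|s t|t s u]; first by apply/asboolP; apply: tc_refl.
  by apply/asboolP/asboolP; apply: tc_sym.
by move=> /asboolP st /asboolP tu; apply/asboolP; apply: tc_trans st tu.
Qed.
Canonical tree_rel_equiv_rel := EquivRelPack tree_rel_equiv.

(* Binary trees up to commutativity: the free commutative magma on [gen]. *)
Definition magma := {eq_quot tree_rel}.
HB.instance Definition _ := Choice.on magma.
HB.instance Definition _ := EqQuotient.on magma.

Definition mgen (g : gen) : magma := \pi_magma (Leaf g).
Definition mprod (x y : magma) : magma := \pi_magma (Node (repr x) (repr y)).

Lemma mprodC : commutative mprod.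
Proof. by move=> x y; apply/eqP; rewrite piE; apply/asboolP; apply: tc_comm. Qed.

Lemma mprodE s t : mprod (\pi_magma s) (\pi_magma t) = \pi_magma (Node s t).
Proof.
have reprP r : tree_comm (repr (\pi_magma r)) r.
  by apply/asboolP; rewrite -/(tree_rel _ _) -eqmodE reprK.
by apply/eqP; rewrite piE; apply/asboolP; apply: tc_node.
Qed.

Inductive pair_sim : magma * magma -> magma * magma -> Prop :=
| ps_base x y z : pair_sim (mprod x y, z) (x, mprod y z)
| ps_refl p : pair_sim p p
| ps_sym p q : pair_sim p q -> pair_sim q p
| ps_trans p q r : pair_sim p q -> pair_sim q r -> pair_sim p r.

Definition pair_rel (p q : magma * magma) := `[< pair_sim p q >].

Fact pair_rel_equiv : equiv_class_of pair_rel.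
Proof.
split=> [s|s t|t s u]; first by apply/asboolP; apply: ps_refl.
  by apply/asboolP/asboolP; apply: ps_sym.
by move=> /asboolP st /asboolP tu; apply/asboolP; apply: ps_trans st tu.
Qed.
Canonical pair_rel_equiv_rel := EquivRelPack pair_rel_equiv.

Definition pair_class := {eq_quot pair_rel}.
HB.instance Definition _ := Choice.on pair_class.
HB.instance Definition _ := EqQuotient.on pair_class.

Section Universal.
Variable R : realType.

(* Polynomials over R in indeterminates indexed by [pair_class]. *)
Definition hatR : comAlgType R := {malg R[{cmonom pair_class}]}.

Definition lam (x y : magma) : hatR := << ucm (\pi_pair_class (x, y)) >>.

Definition hatM : lmodType hatR := {malg hatR[magma]}.

Definition hmul (u v : hatM) : hatM :=
  \sum_(x <- msupp u) \sum_(y <- msupp v) (u@_x * v@_y) *: << mprod x y >>.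

Definition hform (u v : hatM) : hatR :=
  \sum_(x <- msupp u) \sum_(y <- msupp v) u@_x * v@_y * lam x y.

Lemma hmulC u v : hmul u v = hmul v u.
Proof.
rewrite /hmul exchange_big; apply: eq_bigr => y _; apply: eq_bigr => x _.
by rewrite mulrC mprodC.
Qed.

Definition mext (W : lmodType (hatR)) (h : magma -> W) (g : hatM) : W :=
  \sum_(k <- msupp g) g@_k *: h k.

Lemma mextE (W : lmodType hatR) (h : magma -> W) (g : hatM) (d : {fset magma}) :
  (msupp g `<=` d)%fset -> mext h g = \sum_(k <- d) g@_k *: h k.
Proof.
move=> gd; rewrite /mext (big_fset_incl _ gd) //= => k _ /mcoeff_outdom ->.
by rewrite scale0r.
Qed.

Lemma mext_linear (W : lmodType hatR) (h : magma -> W) (s : hatR) (f g : hatM) :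
  mext h (s *: f + g) = s *: mext h f + mext h g.
Proof.
pose d := (msupp (s *: f + g) `|` (msupp f `|` msupp g))%fset.
have df : (msupp f `<=` d)%fset by rewrite /d fsetUCA fsubsetUl.
have dg : (msupp g `<=` d)%fset by rewrite /d fsetUA fsubsetUr.
rewrite (mextE h (fsubsetUl _ _ : (_ `<=` d)%fset)) (mextE h df) (mextE h dg).
rewrite scaler_sumr -big_split; apply: eq_bigr => k _ /=.
by rewrite mcoeffD mcoeffZ scalerDl scalerA.
Qed.

Lemma hmulE u v :
  hmul u v = mext (fun x => mext (fun y => << mprod x y >> : hatM) v) u.
Proof.
apply: eq_bigr => x _; rewrite scaler_sumr.
by apply: eq_bigr => y _; rewrite scalerA.
Qed.

Lemma hformE u v :
  hform u v = mext (fun x => mext (fun y => lam x y : hatR^o) v : hatR^o) u.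
Proof.
apply: eq_bigr => x _; rewrite scaler_sumr.
by apply: eq_bigr => y _; rewrite scalerA.
Qed.

Lemma hformEr u v :
  hform u v = mext (fun y => mext (fun x => lam x y : hatR^o) u : hatR^o) v.
Proof.
rewrite /hform exchange_big; apply: eq_bigr => y _; rewrite scaler_sumr.
by apply: eq_bigr => x _; rewrite scalerA [v@__ * _]mulrC.
Qed.

Fact hmul_linear (s : hatR) (u v w : hatM) :
  hmul (s *: u + v) w = s *: hmul u w + hmul v w.
Proof. by rewrite !hmulE mext_linear. Qed.

Fact hform_linearl (s : hatR) (u v w : hatM) :
  hform (s *: u + v) w = s * hform u w + hform v w.
Proof. by rewrite !hformE mext_linear. Qed.

Fact hform_linearr (s : hatR) (u v w : hatM) :
  hform w (s *: u + v) = s * hform w u + hform w v.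
Proof. by rewrite !hformEr mext_linear. Qed.

Definition hiota : {rmorphism R -> hatR} := in_alg hatR.

Definition hatA : formAlg R :=
  FormAlg hiota hmulC hmul_linear hform_linearl hform_linearr.

Definition hgen (i : 'I_3) (e : bool) : car hatA := << mgen (i, e) >> : hatM.

Definition qgen (p : idealPair hatA) (i : 'I_3) (e : bool) : car (quotAlg p) :=
  qI p (hgen i e).

Definition C4A : set (idealPair hatA) := [set p |
  [/\ idJ p <> setT, primitive_frobenius_axial (axes (qgen p)),
      propertyP (qgen p) & shape4A (qgen p)]].

(* The smallest pair is the intersection of all pairs in [C4A]; see
   [smallest_pair_cap]. *)

Definition capI : set (car hatA) := \bigcap_(p in C4A) idI p.
Definition capJ : set (coef hatA) := \bigcap_(p in C4A) idJ p.

Fact capI_submod : submod capI.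
Proof.
split=> [p _|s u v Iu Iv p Cp]; first by case: (idI_submod p).
by have [_] := idI_submod p; apply; [apply: Iu | apply: Iv].
Qed.

Fact capI_mul u v : capI u -> capI (u ∙ v).
Proof. by move=> Iu p Cp; apply: idI_mul; apply: Iu. Qed.

Fact capJ_0 : capJ 0. Proof. by move=> p _; apply: idJ_0. Qed.

Fact capJ_lin s r r' : capJ r -> capJ r' -> capJ (s * r + r').
Proof. by move=> Jr Jr' p Cp; apply: idJ_lin; [apply: Jr | apply: Jr']. Qed.

Fact capJ_scale s v : capJ s -> capI (s *: v).
Proof. by move=> Js p Cp; apply: idJ_scale; apply: Js. Qed.

Fact capJ_forml u v : capI u -> capJ ⟨u, v⟩.
Proof. by move=> Iu p Cp; apply: idJ_forml; apply: Iu. Qed.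

Fact capJ_formr u v : capI v -> capJ ⟨u, v⟩.
Proof. by move=> Iv p Cp; apply: idJ_formr; apply: Iv. Qed.

Definition cap4A : idealPair hatA := IdealPair capI_submod capI_mul
  capJ_0 capJ_lin capJ_scale capJ_forml capJ_formr.

Definition smallest_pair (p : idealPair hatA) := C4A p /\
  forall q, C4A q -> idI p `<=` idI q /\ idJ p `<=` idJ q.

Lemma smallest_pair_cap p :
  smallest_pair p -> idI p = idI cap4A /\ idJ p = idJ cap4A.
Proof.
case=> Cp min_p; split; apply/seteqP; split=> z.
- by move=> pz q Cq; apply: (min_p q Cq).1.
- by apply.
- by move=> pz q Cq; apply: (min_p q Cq).2.
- by apply.
Qed.

Definition M4A : formAlg R := quotAlg cap4A.
Definition R4A : comPzRingType := coef M4A.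

Definition t4A : R4A :=
  let a := qgen cap4A in
  let i1 : 'I_3 := inord 0 in let i2 : 'I_3 := inord 1 in
  let i3 : 'I_3 := inord 2 in
  ⟨a i1 true, v4A a i2 i3⟩.

End Universal.

Section Principal.
Variables (R : realType) (A : formAlg R) (r : coef A).

Definition prinI : set (car A) := [set r *: v | v in setT].
Definition prinJ : set (coef A) := [set r * s | s in setT].

Fact prinI_submod : submod prinI.
Proof.
split; first by exists 0; rewrite ?scaler0.
move=> s _ _ [u _ <-] [v _ <-]; exists (s *: u + v) => //.
by rewrite scalerDr !scalerA mulrC.
Qed.

Fact prinI_mul u v : prinI u -> prinI (u ∙ v).
Proof.
move=> [w _ <-]; exists (w ∙ v) => //.
have amul0 : 0 ∙ v = 0 by rewrite -(subrr v) amulBl !subrr.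
by rewrite -[r *: w]addr0 amul_linear amul0 addr0.
Qed.

Fact prinJ_0 : prinJ 0. Proof. by exists 0; rewrite ?mulr0. Qed.

Fact prinJ_lin s x y : prinJ x -> prinJ y -> prinJ (s * x + y).
Proof.
by move=> [x' _ <-] [y' _ <-]; exists (s * x' + y'); rewrite // mulrDr mulrCA.
Qed.

Fact prinJ_scale s v : prinJ s -> prinI (s *: v).
Proof. by move=> [s' _ <-]; exists (s' *: v); rewrite // scalerA. Qed.

Fact prinJ_forml u v : prinI u -> prinJ ⟨u, v⟩.
Proof.
move=> [w _ <-]; exists ⟨w, v⟩ => //.
have form0 : ⟨0, v⟩ = 0 by rewrite -(subrr v) formBl subrr.
by rewrite -[r *: w]addr0 form_linearl form0 addr0.
Qed.

Fact prinJ_formr u v : prinI v -> prinJ ⟨u, v⟩.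
Proof.
move=> [w _ <-]; exists ⟨u, w⟩ => //.
have form0 : ⟨u, 0⟩ = 0 by rewrite -(subrr u) formBr subrr.
by rewrite -[r *: w]addr0 form_linearr form0 addr0.
Qed.

Definition principalPair : idealPair A := IdealPair prinI_submod prinI_mul
  prinJ_0 prinJ_lin prinJ_scale prinJ_forml prinJ_formr.

End Principal.

Definition Mt (R : realType) (t : R) : formAlg R :=
  quotAlg (principalPair (t4A R - iota (M4A R) t)).

(* The coefficient ring of [Mt t] is R_4A / (t4A - t), which [iota] identifies
   with R; its order is the one transported from R. *)
Definition real_nonneg (R : realType) (A : formAlg R) (x : coef A) :=
  exists2 r : R, 0 <= r & x = iota A r.

Definition norton (R : realType) (A : formAlg R) :=
  forall u v : car A, real_nonneg (⟨u ∙ u, v ∙ v⟩ - ⟨u ∙ v, u ∙ v⟩).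

(* Main.v *)
(* Put P_i = a_i + a_-i and e_i = a_i - a_-i. On the subalgebra generated by
   P_1, P_2, P_3 each P_i behaves like an axis of Jordan type 1/2, and
   x e_i = <x, P_i>/2 e_i there. Together with the value
   q = <P_1, P_2 P_3>/2 = 1/64 - 3t/16, the identities expressing this determine
   all products and form values in M(t).

   They also hold in M_3(S) x S^3 with P_i = (p_i, 0), for rank one idempotent
   matrices p_i with tr(p_i p_j) = 1/16 and tr(p_1 p_2 p_3 + p_3 p_2 p_1) = 2q.
   For u = (X, x) and v = (Y, y), Norton's difference is there
   -1/2 tr([X, Y]^2) + 2 sum_i (tr(W_i^2 p_i) - tr(W_i p_i)^2)
   + 1/16 sum_(i, j) (x_i y_j - x_j y_i)^2, with W_i = y_i X - x_i Y.
   If |q| <= 1/64, that is, 0 <= t <= 1/6, the p_i can be taken Hermitian over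
   the complex numbers, and every term is nonnegative on Hermitian elements.
   Otherwise there are such p_i over the reals, not symmetric. The resulting
   real model gives a quotient of the universal algebra in C_4A, and in it
   -1/2 tr([X, Y]^2) < 0 for X, Y proportional to x_1 y_2 and x_2 y_1, where
   p_i = x_i y_i. *)

(* An intersection of ideal pairs need not inherit the decompositions into eigenvectors that define
   an axis, but an equation holds in the quotient by the intersection as soon as it holds in every
   member. Therefore all that is extracted from the members of C_4A is the list of equations
   [half_axial]. They reduce every product and every form value to real combinations of the e_i and
   of words of length at most three in the P_i, so M(t) can be compared with a model by a relation
   under which form values are equal real numbers.

   The two directions ask different things of the model. For the inequality it enters only as a
   half-axial algebra with the same q, which permits complex scalars; for the failure it has to
   yield a member of C_4A, so the fusion rule is checked in it. In both cases the Gram matrix is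
   built from the roots w, w' of X^2 - 2 c X + 1 with c = 64 q = 1 - 12 t: they are conjugate on the
   unit circle for |c| <= 1, and real and distinct for |c| > 1. *)
From HB Require Import structures.
From mathcomp Require Import all_boot all_order all_algebra.
From mathcomp Require Import ring lra ring_quotient finmap complex.
From mathcomp Require Import boolp classical_sets reals.
From mathcomp Require Import monalg.
Require Import Defs.

Set Implicit Arguments.
Unset Strict Implicit.
Unset Printing Implicit Defensive.

Import Order.TTheory GRing.Theory Num.Theory.
Local Open Scope classical_set_scope.
Local Open Scope quotient_scope.
Local Open Scope ring_scope.

(** * Linear identities by reflection *)

Inductive lexp (T : Type) :=
| LAtom of nat | LZero | LAdd of lexp T & lexp T | LOpp of lexp T
| LScale of T & lexp T.
Arguments LAtom {T} n.
Arguments LZero {T}.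

Section LinearReflection.
Variables (R : pzRingType) (V : zmodType) (act : R -> V -> V).
Hypotheses (actDr : forall r u v, act r (u + v) = act r u + act r v)
  (actDl : forall r s v, act (r + s) v = act r v + act s v)
  (actA : forall r s v, act r (act s v) = act (r * s) v)
  (act1 : forall v, act 1 v = v).

(** The action is a parameter because three are used: [rscale] on an algebra, [cscale] on its
    coefficient ring, and scaling of matrices. *)
Fixpoint leval (vs : seq V) (e : lexp R) : V :=
  match e with
  | LAtom n => vs`_n
  | LZero => 0
  | LAdd e1 e2 => leval vs e1 + leval vs e2
  | LOpp e1 => - leval vs e1
  | LScale r e1 => act r (leval vs e1)
  end.

Fixpoint lcoef (n : nat) (e : lexp R) : R :=
  match e with
  | LAtom m => if eqn m n then 1 else 0
  | LZero => 0
  | LAdd e1 e2 => lcoef n e1 + lcoef n e2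
  | LOpp e1 => - lcoef n e1
  | LScale r e1 => r * lcoef n e1
  end.

Fixpoint latoms_lt (n : nat) (e : lexp R) : bool :=
  match e with
  | LAtom m => (m < n)%N
  | LZero => true
  | LAdd e1 e2 => latoms_lt n e1 && latoms_lt n e2
  | LOpp e1 => latoms_lt n e1
  | LScale r e1 => latoms_lt n e1
  end.

(** A conjunction over the atoms, so that [cbn] leaves one scalar equation per atom for [field] or
    [lra]. *)
Fixpoint lagree (n : nat) (e1 e2 : lexp R) : Prop :=
  if n is m.+1 then lcoef m e1 = lcoef m e2 /\ lagree m e1 e2 else True.

Lemma act0r r : act r 0 = 0.
Proof. by apply: (addrI (act r 0)); rewrite -actDr !addr0. Qed.

Lemma act0l v : act 0 v = 0.
Proof. by apply: (addrI (act 0 v)); rewrite -actDl !addr0. Qed.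

Lemma actNl r v : act (- r) v = - act r v.
Proof. by apply/eqP; rewrite -addr_eq0 -actDl addNr act0l. Qed.

Lemma leval_sum vs e : latoms_lt (size vs) e ->
  leval vs e = \sum_(i < size vs) act (lcoef i e) vs`_i.
Proof.
elim: e => [n|//|e1 IH1 e2 IH2|e IH|r e IH] /=.
- move=> lt_n; rewrite (bigD1 (Ordinal lt_n)) //=; case: eqnP => // _.
  rewrite act1 big1 ?addr0 // => i ne_i; case: eqnP => [ni|_]; last exact: act0l.
  by rewrite -val_eqE /= ni eqxx in ne_i.
- by rewrite big1 // => i _; rewrite act0l.
- case/andP=> /IH1-> /IH2->; rewrite -big_split.
  by apply: eq_bigr => i _; rewrite actDl.
- by move/IH->; rewrite -sumrN; apply: eq_bigr => i _; rewrite actNl.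
move/IH->; rewrite (big_morph (act r) (actDr r) (act0r r)).
by apply: eq_bigr => i _; rewrite actA.
Qed.

Lemma leval_eq vs e1 e2 :
  latoms_lt (size vs) e1 && latoms_lt (size vs) e2 ->
  lagree (size vs) e1 e2 -> leval vs e1 = leval vs e2.
Proof.
case/andP=> /leval_sum-> /leval_sum-> agr; apply: eq_bigr => -[i lt_i] _ /=.
congr (act _ _); elim: (size vs) lt_i agr => //= n IH; rewrite ltnS leq_eqVlt.
by case/orP=> [/eqP->|/IH{}IH] [] // _ /IH.
Qed.

End LinearReflection.

Section FormAlgTheory.
Variables (R : realType) (A : formAlg R).
Local Notation V := (car A).
Implicit Types (u v w : V) (r : R) (s : coef A).

Lemma rscaleDr r u v : r %*: (u + v) = r %*: u + r %*: v.
Proof. exact: scalerDr. Qed.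
Lemma rscaleDl (r r' : R) v : (r + r') %*: v = r %*: v + r' %*: v.
Proof. by rewrite /rscale rmorphD scalerDl. Qed.
Lemma rscaleA (r r' : R) v : r %*: (r' %*: v) = (r * r') %*: v.
Proof. by rewrite /rscale scalerA rmorphM. Qed.
Lemma rscale1 v : 1 %*: v = v.
Proof. by rewrite /rscale rmorph1 scale1r. Qed.
Lemma rscale0 v : 0 %*: v = 0.
Proof. by rewrite /rscale rmorph0 scale0r. Qed.
Lemma rscaler0 r : r %*: (0 : V) = 0.
Proof. exact: scaler0. Qed.
Lemma rscaleZ r s v : r %*: (s *: v) = s *: (r %*: v).
Proof. by rewrite /rscale !scalerA mulrC. Qed.

(* These restate module laws because [lin] compares atoms syntactically. *)
Lemma carZDr s u v : s *: (u + v) = s *: u + s *: v.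
Proof. exact: scalerDr. Qed.
Lemma carZNr s u : s *: (- u) = - (s *: u).
Proof. exact: scalerN. Qed.
Lemma carZDl s s' u : (s + s') *: u = s *: u + s' *: u.
Proof. exact: scalerDl. Qed.
Lemma carZA s s' u : s *: (s' *: u) = (s * s') *: u.
Proof. exact: scalerA. Qed.
Lemma carZNl s u : (- s) *: u = - (s *: u).
Proof. exact: scaleNr. Qed.
Lemma carZ0 s : s *: (0 : V) = 0.
Proof. exact: scaler0. Qed.

(** For solving a linear equation u = v for one of its terms: up to sign, [r] is the inverse of that
    term's coefficient. [mx_use] and [sc_use] do the same for matrices and scalars. *)
Lemma lin_use r u v w z : u = v -> w - z = r %*: (u - v) -> w = z.
Proof. by move=> ->; rewrite subrr rscaler0 => /subr0_eq. Qed.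

(** Keeps real factors apart from elements of the coefficient ring, so that [lin] treats identities
    there like vector identities. *)
Definition cscale (r : R) (s : coef A) := iota A r * s.
Lemma cscaleDr r s s' : cscale r (s + s') = cscale r s + cscale r s'.
Proof. exact: mulrDr. Qed.
Lemma cscaleDl (r r' : R) s : cscale (r + r') s = cscale r s + cscale r' s.
Proof. by rewrite /cscale rmorphD mulrDl. Qed.
Lemma cscaleA (r r' : R) s : cscale r (cscale r' s) = cscale (r * r') s.
Proof. by rewrite /cscale rmorphM mulrA. Qed.
Lemma cscale1 s : cscale 1 s = s.
Proof. by rewrite /cscale rmorph1 mul1r. Qed.

Lemma amulDl u v w : (u + v) ∙ w = u ∙ w + v ∙ w.
Proof. by rewrite -[u]scale1r amul_linear !scale1r. Qed.
Lemma amul0l v : 0 ∙ v = 0.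
Proof. by apply: (addrI (0 ∙ v)); rewrite -amulDl !addr0. Qed.
Lemma amulZl s v w : (s *: v) ∙ w = s *: (v ∙ w).
Proof. by rewrite -[s *: v]addr0 amul_linear amul0l addr0. Qed.
Lemma amulNl v w : (- v) ∙ w = - (v ∙ w).
Proof. by rewrite -scaleN1r amulZl scaleN1r. Qed.
Lemma amulDr u v w : w ∙ (u + v) = w ∙ u + w ∙ v.
Proof. by rewrite amulC amulDl !(amulC w). Qed.
Lemma amul0r v : v ∙ 0 = 0.
Proof. by rewrite amulC amul0l. Qed.
Lemma amulZr s v w : w ∙ (s *: v) = s *: (w ∙ v).
Proof. by rewrite amulC amulZl (amulC w). Qed.
Lemma amulNr v w : w ∙ (- v) = - (w ∙ v).
Proof. by rewrite amulC amulNl (amulC w). Qed.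
Lemma amulRl r v w : (r %*: v) ∙ w = r %*: (v ∙ w).
Proof. exact: amulZl. Qed.
Lemma amulRr r v w : w ∙ (r %*: v) = r %*: (w ∙ v).
Proof. exact: amulZr. Qed.

Definition amulE := (amulDl, amulDr, amulNl, amulNr, amulRl, amulRr, amulZl,
  amulZr, amul0l, amul0r).

Lemma formDl u v w : ⟨u + v, w⟩ = ⟨u, w⟩ + ⟨v, w⟩.
Proof. by rewrite -[u]scale1r form_linearl !scale1r mul1r. Qed.
Lemma formDr u v w : ⟨w, u + v⟩ = ⟨w, u⟩ + ⟨w, v⟩.
Proof. by rewrite -[u]scale1r form_linearr !scale1r mul1r. Qed.
Lemma form0l v : ⟨0, v⟩ = 0.
Proof. by apply: (addrI ⟨0, v⟩); rewrite -formDl !addr0. Qed.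
Lemma form0r v : ⟨v, 0⟩ = 0.
Proof. by apply: (addrI ⟨v, 0⟩); rewrite -formDr !addr0. Qed.
Lemma formZl s v w : ⟨s *: v, w⟩ = s * ⟨v, w⟩.
Proof. by rewrite -[s *: v]addr0 form_linearl form0l addr0. Qed.
Lemma formZr s v w : ⟨w, s *: v⟩ = s * ⟨w, v⟩.
Proof. by rewrite -[s *: v]addr0 form_linearr form0r addr0. Qed.
Lemma formNl v w : ⟨- v, w⟩ = - ⟨v, w⟩.
Proof. by rewrite -scaleN1r formZl mulN1r. Qed.
Lemma formNr v w : ⟨w, - v⟩ = - ⟨w, v⟩.
Proof. by rewrite -scaleN1r formZr mulN1r. Qed.
Lemma formRl r v w : ⟨r %*: v, w⟩ = cscale r ⟨v, w⟩.
Proof. exact: formZl. Qed.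
Lemma formRr r v w : ⟨w, r %*: v⟩ = cscale r ⟨w, v⟩.
Proof. exact: formZr. Qed.

Definition formE := (formDl, formDr, formNl, formNr, formRl, formRr, formZl,
  formZr, form0l, form0r).

End FormAlgTheory.

Ltac atom_index x vs :=
  lazymatch vs with
  | cons ?y ?tl =>
    lazymatch constr:((x, y)) with
    | (?z, ?z) => constr:(0%N)
    | _ => let n := atom_index x tl in constr:(S n)
    end
  end.

Ltac atom_add x vs :=
  let rec mem l := lazymatch l with
    | nil => constr:(false)
    | cons x _ => constr:(true)
    | cons _ ?tl => mem tl
    end in
  lazymatch mem vs with true => vs | false => constr:(cons x vs) end.

Ltac lin_atoms t vs :=
  lazymatch t with
  | @GRing.add _ ?a ?b => let vs1 := lin_atoms a vs in lin_atoms b vs1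
  | @GRing.opp _ ?a => lin_atoms a vs
  | @GRing.zero _ => vs
  | @rscale _ _ _ ?a => lin_atoms a vs
  | @cscale _ _ _ ?a => lin_atoms a vs
  | _ => atom_add t vs
  end.

Ltac lin_reify T t vs :=
  lazymatch t with
  | @GRing.add _ ?a ?b =>
    let ea := lin_reify T a vs in let eb := lin_reify T b vs in
    constr:(@LAdd T ea eb)
  | @GRing.opp _ ?a => let ea := lin_reify T a vs in constr:(@LOpp T ea)
  | @GRing.zero _ => constr:(@LZero T)
  | @rscale _ _ ?r ?a => let ea := lin_reify T a vs in constr:(@LScale T r ea)
  | @cscale _ _ ?r ?a => let ea := lin_reify T a vs in constr:(@LScale T r ea)
  | _ => let n := atom_index t vs in constr:(@LAtom T n)
  end.

Ltac lin_close := cbn [lagree size lcoef eqn];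
  repeat (apply: conj; first by [|field|lra]); exact I.

Ltac lin :=
  lazymatch goal with
  | |- @eq ?T ?x ?y =>
    lazymatch T with
    | context [@car ?R ?A] =>
      let V := constr:(GRing.Zmodule.sort (car A)) in
      let vs0 := lin_atoms x (@nil V) in
      let vs := lin_atoms y vs0 in
      let ex := lin_reify R x vs in
      let ey := lin_reify R y vs in
      refine (@leval_eq R (car A) (@rscale R A) (@rscaleDr R A)
         (@rscaleDl R A) (@rscaleA R A) (@rscale1 R A) vs ex ey _ _);
      [reflexivity | lin_close]
    | context [@coef ?R ?A] =>
      let V := constr:(GRing.Zmodule.sort (coef A)) in
      let vs0 := lin_atoms x (@nil V) in
      let vs := lin_atoms y vs0 in
      let ex := lin_reify R x vs in
      let ey := lin_reify R y vs in
      refine (@leval_eq R (coef A) (@cscale R A) (@cscaleDr R A)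
         (@cscaleDl R A) (@cscaleA R A) (@cscale1 R A) vs ex ey _ _);
      [reflexivity | lin_close]
    end
  end.

(** * Half-axial algebras *)

Section Peirce.
Variables (R : realType) (A : formAlg R).
Local Notation V := (car A).

Local Notation smallest_subalg := (smallest (@subalg R A)).

Lemma sub_smallest_subalg (X : set V) : X `<=` smallest_subalg X.
Proof. exact: sub_gen_smallest. Qed.

Lemma smallest_subalgP (X : set V) : subalg (smallest_subalg X).
Proof.
split; first split.
- by move=> B [[[]]].
- move=> s u v Xu Xv B CB; have [[[B0 BL] BM] XB] := CB.
  by apply: BL; [apply: Xu | apply: Xv].
by move=> u v Xu Xv B CB; have [[BL BM] XB] := CB; apply: BM; [apply: Xu | apply: Xv].
Qed.

Variables P e : 'I_3 -> V.

(** In the matrix model this is tr(X p_i); in a member of C_4A, for x in [algP], it is the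
    coefficient of P_i in the Peirce decomposition of x. *)
Definition trP i (x : V) : coef A := cscale 2^-1 ⟨x, P i⟩.
(** The involution that is 1 on the 1- and 0-eigenvectors of P_i and -1 on the 1/2-eigenvectors; in
    the matrix model, conjugation by 1 - 2 p_i. *)
Definition reflP i (x : V) : V := x - 4 %*: (P i ∙ x) + 4 %*: (trP i x *: P i).
Definition algP : set V := smallest (@subalg R A) (range P).

(* Satisfied by P_i = a_i + a_-i and e_i = a_i - a_-i in every member of C_4A
   (see [half_axial_4A]). Being identities, these conditions pass to M(t),
   unlike the existence of eigenspace decompositions. *)
Record half_axial : Prop := HalfAxial {
  ha_formC : forall u v : V, ⟨u, v⟩ = ⟨v, u⟩;
  ha_formA : forall u v w : V, ⟨u, v ∙ w⟩ = ⟨u ∙ v, w⟩;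
  ha_PP : forall i, P i ∙ P i = P i;
  ha_ee : forall i, e i ∙ e i = P i;
  ha_ee0 : forall i j, i != j -> e i ∙ e j = 0;
  ha_formP : forall i, ⟨P i, P i⟩ = iota A 2;
  ha_formPP : forall i j, i != j -> ⟨P i, P j⟩ = iota A 8^-1;
  ha_mule : forall i x, algP x -> x ∙ e i = trP i x *: e i;
  ha_forme : forall i x, algP x -> ⟨x, e i⟩ = 0;
  ha_peirce : forall i x, algP x ->
    P i ∙ (P i ∙ x) = 2^-1 %*: (P i ∙ x + trP i x *: P i);
  ha_refl : forall i x y, algP x -> algP y ->
    reflP i (x ∙ y) = reflP i x ∙ reflP i y
}.

Lemma trPD i x y : trP i (x + y) = trP i x + trP i y.
Proof. by rewrite /trP formDl cscaleDr. Qed.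
Lemma trPZ i s x : trP i (s *: x) = s * trP i x.
Proof. by rewrite /trP formZl /cscale mulrCA. Qed.
Lemma trPR i r x : trP i (r %*: x) = cscale r (trP i x).
Proof. exact: trPZ. Qed.
Lemma trPN i x : trP i (- x) = - trP i x.
Proof. by rewrite -scaleN1r trPZ mulN1r. Qed.
Definition trPE := (trPD, trPN, trPR, trPZ).

Hypothesis hA : half_axial.
Local Notation J := algP.

Lemma algP_P i : J (P i).
Proof. by apply: sub_smallest_subalg; exists i. Qed.
Lemma algP_M x y : J x -> J y -> J (x ∙ y).
Proof. by case: (smallest_subalgP (range P)) => _; apply. Qed.
Lemma algP_L s x y : J x -> J y -> J (s *: x + y).
Proof. by case: (smallest_subalgP (range P)) => -[_ L] _; apply: L. Qed.
Lemma algP_0 : J 0.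
Proof. by case: (smallest_subalgP (range P)) => -[]. Qed.
Lemma algP_Z s x : J x -> J (s *: x).
Proof. by move=> Jx; rewrite -[_ *: _]addr0; apply: algP_L => //; apply: algP_0. Qed.
Lemma algP_D x y : J x -> J y -> J (x + y).
Proof. by move=> Jx Jy; rewrite -[x]scale1r; apply: algP_L. Qed.
Lemma algP_refl i x : J x -> J (reflP i x).
Proof.
move=> Jx; rewrite /reflP -scaleN1r; do !apply: algP_D => //; do ?apply: algP_Z.
  by apply: algP_M => //; apply: algP_P.
exact: algP_P.
Qed.

Lemma iota_cscale r : iota A r = cscale r 1.
Proof. by rewrite /cscale mulr1. Qed.

Lemma trP_P i : trP i (P i) = 1.
Proof. by rewrite /trP ha_formP // iota_cscale; lin. Qed.

Lemma trP_PP i j : i != j -> trP i (P j) = cscale 16^-1 1.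
Proof.
by move=> ne; rewrite /trP ha_formPP 1?eq_sym // iota_cscale; lin.
Qed.

Lemma trP_mulP i x : trP i (P i ∙ x) = trP i x.
Proof. by rewrite /trP amulC -ha_formA ?ha_PP. Qed.

Lemma reflPK i x : J x -> reflP i (reflP i x) = x.
Proof.
move=> Jx; rewrite {1}/reflP; have -> : trP i (reflP i x) = trP i x.
  rewrite /reflP !trPE trP_mulP trP_P mulr1; lin.
have -> : P i ∙ reflP i x = 2 %*: (trP i x *: P i) - P i ∙ x.
  rewrite /reflP !amulE ha_peirce // ha_PP //; lin.
rewrite /reflP; lin.
Qed.

Lemma refl_mul i x y : J x -> J y -> reflP i x ∙ y = reflP i (x ∙ reflP i y).
Proof. by move=> Jx Jy; rewrite ha_refl ?reflPK //; apply: algP_refl. Qed.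

Lemma iotaZ r (x : V) : cscale r 1 *: x = r %*: x.
Proof. by rewrite /cscale mulr1. Qed.

(** P_i ∙ P_j is a combination of P_i, P_j and the reflection of P_j, and [refl_mul] shifts that
    reflection to y. So products with words of length two reduce to products with generators;
    [mulPPP_mul] treats length three in the same way. *)
Lemma mulPP_mul i j y : i != j -> J y ->
  (P i ∙ P j) ∙ y =
  4^-1 %*: (P j ∙ y + 4^-1 %*: (P i ∙ y) - reflP i (P j ∙ reflP i y)).
Proof.
move=> ne Jy; rewrite -refl_mul //; last exact: algP_P.
by rewrite /reflP trP_PP // iotaZ !amulE; lin.
Qed.

Lemma mul_PPP i j : i != j ->
  P i ∙ (P i ∙ P j) = 2^-1 %*: (P i ∙ P j) + 32^-1 %*: P i.
Proof.
move=> ne; rewrite ha_peirce // ?trP_PP // ?iotaZ; last exact: algP_P.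
lin.
Qed.

Variable q : R.
Hypothesis trq : forall i j k, i != j -> i != k -> j != k ->
  trP i (P j ∙ P k) = cscale q 1.

Lemma mulPPP_mul i j k y : i != j -> i != k -> j != k -> J y ->
  (P i ∙ (P j ∙ P k)) ∙ y =
  4^-1 %*: ((P j ∙ P k) ∙ y + (4 * q) %*: (P i ∙ y)
            - reflP i ((P j ∙ P k) ∙ reflP i y)).
Proof.
move=> ij ik jk Jy; rewrite -refl_mul //; last by apply: algP_M; apply: algP_P.
by rewrite [reflP i _]/reflP trq // iotaZ !amulE; lin.
Qed.

Lemma reflP_P i j : i != j ->
  reflP i (P j) = P j - 4 %*: (P i ∙ P j) + 4^-1 %*: P i.
Proof. by move=> ij; rewrite /reflP trP_PP // iotaZ; lin. Qed.

Lemma reflP_PP i j : i != j ->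
  reflP i (P i ∙ P j) = 8^-1 %*: P i - P i ∙ P j.
Proof. by move=> ij; rewrite /reflP mul_PPP // trP_mulP trP_PP // iotaZ; lin. Qed.

Lemma mul_PP_PP i j k : i != j -> i != k -> j != k ->
  (P i ∙ P j) ∙ (P i ∙ P k) =
  4^-1 %*: (P j ∙ (P i ∙ P k) + P k ∙ (P i ∙ P j) - P i ∙ (P j ∙ P k))
  + 64^-1 %*: (P i ∙ P j + P i ∙ P k) + (q / 4) %*: P i.
Proof.
move=> ij ik jk; have := ha_refl hA i (algP_P j) (algP_P k).
rewrite {1}/reflP !reflP_P // trq // iotaZ !amulE ha_PP //.
rewrite -[(P i ∙ P j) ∙ P i]amulC -[(P i ∙ P j) ∙ P k]amulC -[P j ∙ P i]amulC !mul_PPP //.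
move=> H; apply: (lin_use (r := - 16^-1) H); lin.
Qed.

Lemma trP_P_PP i j k : i != j -> i != k -> j != k ->
  trP i (P j ∙ (P i ∙ P k)) = cscale (q / 2 + 512^-1) 1.
Proof.
move=> ij ik jk; rewrite /trP ha_formC // !ha_formA // [_ ∙ P i]amulC.
rewrite mul_PPP // !formE.
have := trq (i := k) (j := i) (k := j); rewrite /trP => /(_ _ _ _)/(congr1 (cscale 2)).
rewrite !cscaleA mulfV ?pnatr_eq0 // cscale1 => -> //; try by rewrite eq_sym.
rewrite ha_formPP // iota_cscale; lin.
Qed.

(** The same expansion for P_j and P_i ∙ P_k; the wanted word comes from the term -4 P_i ∙ x of the
    reflection. *)
Lemma mul_P_P_PP i j k : i != j -> i != k -> j != k ->
  P i ∙ (P j ∙ (P i ∙ P k)) =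
  2^-1 %*: (P j ∙ (P i ∙ P k)) - (P i ∙ P j) ∙ (P i ∙ P k)
  + 32^-1 %*: (P i ∙ P j + P i ∙ P k) + (q / 2) %*: P i.
Proof.
move=> ij ik jk; have JP := algP_P.
have := ha_refl hA i (JP j) (algP_M (JP i) (JP k)).
rewrite reflP_P // reflP_PP // /reflP trP_P_PP // iotaZ !amulE ha_PP //.
rewrite -[(P i ∙ P j) ∙ P i]amulC -[P j ∙ P i]amulC !mul_PPP // => H.
apply: (lin_use (r := - 4^-1) H); lin.
Qed.

Lemma mulP_e i : P i ∙ e i = e i.
Proof. by rewrite ha_mule ?trP_P ?scale1r //; apply: algP_P. Qed.

Lemma form_ee i : ⟨e i, e i⟩ = iota A 2.
Proof. by rewrite -{1}[e i]mulP_e -ha_formA // ha_ee // ha_formP. Qed.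

Lemma form_ee0 i j : i != j -> ⟨e i, e j⟩ = 0.
Proof.
by move=> ij; rewrite -{1}[e i]mulP_e -ha_formA // ha_ee0 // form0r.
Qed.
End Peirce.

Lemma ord3_cases (i j k l : 'I_3) : j != k -> j != l -> k != l ->
  [|| i == j, i == k | i == l].
Proof.
by case: i j k l => [[|[|[|//]]] ?] [[|[|[|//]]] ?] [[|[|[|//]]] ?]
  [[|[|[|//]]] ?].
Qed.

(** Commutativity swaps the last two indices, and the Frobenius property rotates all three. *)
Lemma trP_perm (R : realType) (A : formAlg R) (P e : 'I_3 -> car A)
    (c : coef A) (i1 i2 i3 : 'I_3) : half_axial P e ->
  i1 != i2 -> i1 != i3 -> i2 != i3 -> trP P i1 (P i2 ∙ P i3) = c ->
  forall i j k, i != j -> i != k -> j != k -> trP P i (P j ∙ P k) = c.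
Proof.
move=> hA i12 i13 i23 <- i j k ij ik jk.
have sw a b d : trP P a (P b ∙ P d) = trP P a (P d ∙ P b) by rewrite amulC.
have rot a b d : trP P a (P b ∙ P d) = trP P b (P d ∙ P a).
  by rewrite /trP -(ha_formA hA) (ha_formC hA).
case/or3P: (ord3_cases i i12 i13 i23) (ord3_cases j i12 i13 i23)
    (ord3_cases k i12 i13 i23) => /eqP ei /or3P[]/eqP ej /or3P[]/eqP ek;
  move: ij ik jk; rewrite ei ej ek ?eqxx // => _ _ _.
- by rewrite sw -rot.
by rewrite sw rot.
Qed.

(** * Comparison of two half-axial algebras *)

Section Correspondence.
Variables (R : realType) (A B : formAlg R) (q : R).
Variables (P e : 'I_3 -> car A) (P' e' : 'I_3 -> car B).
Hypotheses (hA : half_axial P e) (hB : half_axial P' e').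
Hypothesis trqA : forall i j k, i != j -> i != k -> j != k ->
  trP P i (P j ∙ P k) = cscale q 1.
Hypothesis trqB : forall i j k, i != j -> i != k -> j != k ->
  trP P' i (P' j ∙ P' k) = cscale q 1.

(* [corrP] and [corr] stand for the linear isomorphism matching the displayed
   spanning sets. They are relations because linear independence is unknown. *)
Inductive corrP : car A -> car B -> Prop :=
| corrP_P i : corrP (P i) (P' i)
| corrP_PP i j : i != j -> corrP (P i ∙ P j) (P' i ∙ P' j)
| corrP_PPP i j k : i != j -> i != k -> j != k ->
    corrP (P i ∙ (P j ∙ P k)) (P' i ∙ (P' j ∙ P' k))
| corrP_L r x x' y y' : corrP x x' -> corrP y y' ->
    corrP (r %*: x + y) (r %*: x' + y').

Lemma corrP_Z r x x' : corrP x x' -> corrP (r %*: x) (r %*: x').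
Proof.
move=> xx; have -> : r %*: x = (r - 1) %*: x + x by lin.
have -> : r %*: x' = (r - 1) %*: x' + x' by lin.
exact: corrP_L.
Qed.

Lemma corrP_D x x' y y' : corrP x x' -> corrP y y' -> corrP (x + y) (x' + y').
Proof.
move=> xx yy; rewrite -[x]rscale1 -[x']rscale1; exact: corrP_L.
Qed.

Lemma corrP_N x x' : corrP x x' -> corrP (- x) (- x').
Proof.
move=> xx; have -> : - x = (- 1) %*: x by lin.
have -> : - x' = (- 1) %*: x' by lin.
exact: corrP_Z.
Qed.

Lemma corrP_algP x x' : corrP x x' -> algP P x /\ algP P' x'.
Proof.
elim=> [i|i j _|i j k _ _ _|r y y' z z' _ [Jy Jy'] _ [Jz Jz']].
- by split; apply: algP_P.
- by split; apply: algP_M; apply: algP_P.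
- by split; do !apply: algP_M; apply: algP_P.
by split; apply: algP_L.
Qed.

(** On each kind of word the trace is a real number depending on q alone. *)
Lemma corrP_tr i x x' : corrP x x' ->
  exists r, trP P i x = cscale r 1 /\ trP P' i x' = cscale r 1.
Proof.
elim=> [j|j k jk|j k l jk jl kl|r y y' z z' _ [a [ya y'a]] _ [b [zb z'b]]].
- have [<-|ij] := eqVneq i j; first by exists 1; rewrite (trP_P hA) (trP_P hB) !cscale1.
  by exists 16^-1; rewrite (trP_PP hA) ?(trP_PP hB).
- have [->|ij] := eqVneq i j.
    by exists 16^-1; rewrite (trP_mulP hA) (trP_mulP hB) (trP_PP hA) ?(trP_PP hB).
  have [->|ik] := eqVneq i k; last by exists q; rewrite trqA ?trqB.
  exists 16^-1; rewrite [P j ∙ P k]amulC [P' j ∙ P' k]amulC (trP_mulP hA) (trP_mulP hB).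
  by rewrite (trP_PP hA) ?(trP_PP hB) // eq_sym.
- case/or3P: (ord3_cases i jk jl kl) => /eqP->.
  + by exists q; rewrite (trP_mulP hA) (trP_mulP hB) trqA ?trqB.
  + exists (q / 2 + 512^-1).
    by rewrite (trP_P_PP hA trqA) ?(trP_P_PP hB trqB) // eq_sym.
  exists (q / 2 + 512^-1); rewrite [P k ∙ P l]amulC [P' k ∙ P' l]amulC.
  by rewrite (trP_P_PP hA trqA) ?(trP_P_PP hB trqB) // eq_sym.
exists (r * a + b).
by rewrite !trPE ya y'a zb z'b !cscaleA -!cscaleDl.
Qed.

(** Multiplication by P_i can produce words of length four. With three indices one of them is
    repeated, so the word reduces by [ha_peirce] or [mul_P_P_PP]. *)
Lemma corrP_mulP i x x' : corrP x x' -> corrP (P i ∙ x) (P' i ∙ x').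
Proof.
have cP := corrP_P; have cPP := corrP_PP; have cPPP := corrP_PPP.
have cM_PP j k : i != j -> i != k -> j != k ->
    corrP ((P i ∙ P j) ∙ (P i ∙ P k)) ((P' i ∙ P' j) ∙ (P' i ∙ P' k)).
  move=> ij ik jk; rewrite (mul_PP_PP hA trqA) ?(mul_PP_PP hB trqB) //.
  have [ji ki kj] : [/\ j != i, k != i & k != j] by split; rewrite eq_sym.
  do ![apply: corrP_D | apply: corrP_Z | apply: corrP_N];
    by [apply: cPPP | apply: cPP | apply: cP].
have cP_PPP j k : i != j -> i != k -> j != k ->
    corrP (P i ∙ (P j ∙ (P i ∙ P k))) (P' i ∙ (P' j ∙ (P' i ∙ P' k))).
  move=> ij ik jk; rewrite (mul_P_P_PP hA trqA) ?(mul_P_P_PP hB trqB) //.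
  have [ji ki kj] : [/\ j != i, k != i & k != j] by split; rewrite eq_sym.
  do ![apply: corrP_D | apply: corrP_Z | apply: corrP_N];
    by [apply: cM_PP | apply: cPPP | apply: cPP | apply: cP].
elim=> [j|j k jk|j k l jk jl kl|r y y' z z' _ IHy _ IHz].
- have [<-|ij] := eqVneq i j; last exact: cPP.
  by rewrite (ha_PP hA) (ha_PP hB).
- have [->|ij] := eqVneq i j.
    rewrite (mul_PPP hA) ?(mul_PPP hB) //.
    by apply: corrP_D; apply: corrP_Z; [apply: cPP | apply: cP].
  have [->|ik] := eqVneq i k; last exact: cPPP.
  rewrite [P j ∙ P k]amulC [P' j ∙ P' k]amulC.
  rewrite eq_sym in jk; rewrite (mul_PPP hA) ?(mul_PPP hB) //.
  by apply: corrP_D; apply: corrP_Z; [apply: cPP | apply: cP].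
- case/or3P: (ord3_cases i jk jl kl) => /eqP ii.
  + have JPP : algP P (P k ∙ P l) by apply: algP_M; apply: algP_P.
    have JPP' : algP P' (P' k ∙ P' l) by apply: algP_M; apply: algP_P.
    rewrite ii (ha_peirce hA) ?(ha_peirce hB) // trqA ?trqB // !iotaZ.
    by apply: corrP_Z; apply: corrP_D; [apply: cPPP | apply: corrP_Z; apply: cP].
  + by rewrite -ii in jk kl *; apply: cP_PPP => //; rewrite eq_sym.
  rewrite -ii in jl kl *; rewrite [P k ∙ P i]amulC [P' k ∙ P' i]amulC.
  by apply: cP_PPP; rewrite // eq_sym.
by rewrite !amulE; apply: corrP_L.
Qed.

Lemma corrP_refl i x x' : corrP x x' -> corrP (reflP P i x) (reflP P' i x').
Proof.
move=> xx; have [r [xr x'r]] := corrP_tr i xx.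
rewrite /reflP xr x'r !iotaZ; apply: corrP_D; last first.
  by do !apply: corrP_Z; apply: corrP_P.
by apply: corrP_D => //; apply: corrP_N; apply: corrP_Z; apply: corrP_mulP.
Qed.

(** Induction on the left factor alone: [mulPP_mul] and [mulPPP_mul] turn a longer left factor into
    multiplications by P_i and reflections, under which [corrP] is closed. *)
Lemma corrP_mul x x' y y' : corrP x x' -> corrP y y' -> corrP (x ∙ y) (x' ∙ y').
Proof.
move=> xx yy; have [Jy Jy'] := corrP_algP yy.
have cPP i j z z' : i != j -> corrP z z' ->
    corrP ((P i ∙ P j) ∙ z) ((P' i ∙ P' j) ∙ z').
  move=> ij zz; have [Jz Jz'] := corrP_algP zz.
  rewrite (mulPP_mul hA) ?(mulPP_mul hB) //.
  apply: corrP_Z; apply: corrP_D; last first.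
    by apply: corrP_N; apply: corrP_refl; apply: corrP_mulP; apply: corrP_refl.
  by apply: corrP_D; [|apply: corrP_Z]; apply: corrP_mulP.
elim: xx => [i|i j ij|i j k ij ik jk|r u u' v v' _ IHu _ IHv].
- exact: corrP_mulP.
- exact: cPP.
- rewrite (mulPPP_mul hA trqA) ?(mulPPP_mul hB trqB) //.
  apply: corrP_Z; apply: corrP_D; last first.
    by apply: corrP_N; apply: corrP_refl; apply: cPP => //; apply: corrP_refl.
  by apply: corrP_D; [apply: cPP | apply: corrP_Z; apply: corrP_mulP].
by rewrite !amulE; apply: corrP_L.
Qed.

(** The Frobenius property shortens the left argument to a single P_i, where the form is twice a
    trace. *)
Lemma corrP_form x x' y y' : corrP x x' -> corrP y y' ->
  exists r, ⟨x, y⟩ = iota A r /\ ⟨x', y'⟩ = iota B r.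
Proof.
have fP i z z' : corrP z z' ->
    exists r, ⟨P i, z⟩ = iota A r /\ ⟨P' i, z'⟩ = iota B r.
  move=> zz; have [r [zr z'r]] := corrP_tr i zz; exists (2 * r).
  rewrite (ha_formC hA) (ha_formC hB) !iota_cscale -!cscaleA -zr -z'r /trP.
  by rewrite !cscaleA mulfV ?pnatr_eq0 // !cscale1.
move=> xx; elim: xx y y' => [i|i j ij|i j k ij ik jk|r u u' v v' _ IHu _ IHv] y y' yy.
- exact: fP.
- by rewrite -(ha_formA hA) -(ha_formA hB); apply: fP; apply: corrP_mulP.
- rewrite -(ha_formA hA) -(ha_formA hB) [_ ∙ y]amulC [_ ∙ y']amulC.
  apply: fP; apply: corrP_mul => //.
  exact: corrP_PP.
have [a [ua u'a]] := IHu _ _ yy; have [b [vb v'b]] := IHv _ _ yy.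
exists (r * a + b).
by rewrite !formE ua vb u'a v'b /cscale !rmorphD !rmorphM.
Qed.

Inductive corr : car A -> car B -> Prop :=
| corr_P x x' : corrP x x' -> corr x x'
| corr_e i : corr (e i) (e' i)
| corr_L r x x' y y' : corr x x' -> corr y y' ->
    corr (r %*: x + y) (r %*: x' + y').

Lemma corr_0 : corr 0 0.
Proof.
have -> : 0 = (- 1) %*: P ord0 + P ord0 by lin.
have -> : 0 = (- 1) %*: P' ord0 + P' ord0 by lin.
by apply: corr_P; apply: corrP_L; apply: corrP_P.
Qed.

Lemma corr_Z r x x' : corr x x' -> corr (r %*: x) (r %*: x').
Proof.
by move=> xx; rewrite -[_ %*: x]addr0 -[_ %*: x']addr0; apply: corr_L => //; apply: corr_0.
Qed.

Lemma corr_D x x' y y' : corr x x' -> corr y y' -> corr (x + y) (x' + y').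
Proof.
move=> xx yy; rewrite -[x]rscale1 -[x']rscale1; exact: corr_L.
Qed.

Lemma corr_mul x x' y y' : corr x x' -> corr y y' -> corr (x ∙ y) (x' ∙ y').
Proof.
have ce i z z' : corr z z' -> corr (e i ∙ z) (e' i ∙ z').
  elim=> [u u' uu|j|r u u' v v' _ IHu _ IHv].
  - have [Ju Ju'] := corrP_algP uu; have [r [ur u'r]] := corrP_tr i uu.
    rewrite ![e _ ∙ _]amulC ![e' _ ∙ _]amulC (ha_mule hA) ?(ha_mule hB) //.
    by rewrite ur u'r !iotaZ; apply: corr_Z; apply: corr_e.
  - have [<-|ij] := eqVneq i j.
      by rewrite (ha_ee hA) (ha_ee hB); apply: corr_P; apply: corrP_P.
    by rewrite (ha_ee0 hA) ?(ha_ee0 hB) //; apply: corr_0.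
  by rewrite !amulE; apply: corr_L.
move=> xx; elim: xx y y' => [u u' uu|i|r u u' v v' _ IHu _ IHv] y y' yy.
- elim: yy => [v v' vv|i|r v v' w w' _ IHv _ IHw].
  + by apply: corr_P; apply: corrP_mul.
  + by rewrite [u ∙ _]amulC [u' ∙ _]amulC; apply: ce; apply: corr_P.
  by rewrite !amulE; apply: corr_L.
- exact: ce.
by rewrite !amulE; apply: corr_L; [apply: IHu | apply: IHv].
Qed.

Lemma corr_form x x' y y' : corr x x' -> corr y y' ->
  exists r, ⟨x, y⟩ = iota A r /\ ⟨x', y'⟩ = iota B r.
Proof.
have ce i z z' : corr z z' ->
    exists r, ⟨e i, z⟩ = iota A r /\ ⟨e' i, z'⟩ = iota B r.
  elim=> [u u' uu|j|r u u' v v' _ [a [ua u'a]] _ [b [vb v'b]]].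
  - have [Ju Ju'] := corrP_algP uu; exists 0.
    by rewrite (ha_formC hA) (ha_formC hB) (ha_forme hA) ?(ha_forme hB) ?rmorph0.
  - have [<-|ij] := eqVneq i j.
      by exists 2; rewrite (form_ee hA) (form_ee hB).
    by exists 0; rewrite (form_ee0 hA) ?(form_ee0 hB) ?rmorph0.
  exists (r * a + b).
  by rewrite !formE ua vb u'a v'b /cscale !rmorphD !rmorphM.
move=> xx; elim: xx y y' => [u u' uu|i|r u u' v v' _ IHu _ IHv] y y' yy.
- elim: yy => [v v' vv|i|r v v' w w' _ [a [ua u'a]] _ [b [vb v'b]]].
  + exact: corrP_form.
  + rewrite (ha_formC hA) (ha_formC hB); apply: ce; exact: corr_P.
  exists (r * a + b).
  by rewrite !formE ua vb u'a v'b /cscale !rmorphD !rmorphM.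
- exact: ce.
have [a [ua u'a]] := IHu _ _ yy; have [b [vb v'b]] := IHv _ _ yy.
exists (r * a + b).
by rewrite !formE ua vb u'a v'b /cscale !rmorphD !rmorphM.
Qed.

End Correspondence.

(** * Morphisms *)

Record formMor (R : realType) (A B : formAlg R) := FormMor {
  morJ : {rmorphism coef A -> coef B};
  morI : car A -> car B;
  morJ_iota : forall r, morJ (iota A r) = iota B r;
  morI_linear : forall s u v, morI (s *: u + v) = morJ s *: morI u + morI v;
  morI_mul : forall u v, morI (u ∙ v) = morI u ∙ morI v;
  morJ_form : forall u v, morJ ⟨u, v⟩ = ⟨morI u, morI v⟩
}.

Section MorphismTheory.
Variables (R : realType) (A B : formAlg R) (f : formMor A B).
Implicit Types (u v : car A) (r : R) (s : coef A).

Lemma morID u v : morI f (u + v) = morI f u + morI f v.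
Proof. by rewrite -[u]scale1r morI_linear rmorph1 !scale1r. Qed.
Lemma morI0 : morI f 0 = 0.
Proof. by apply: (addrI (morI f 0)); rewrite -morID !addr0. Qed.
Lemma morIZ s u : morI f (s *: u) = morJ f s *: morI f u.
Proof. by rewrite -[s *: u]addr0 morI_linear morI0 addr0. Qed.
Lemma morIN u : morI f (- u) = - morI f u.
Proof. by rewrite -!scaleN1r morIZ rmorphN1. Qed.
Lemma morIR r u : morI f (r %*: u) = r %*: morI f u.
Proof. by rewrite /rscale morIZ morJ_iota. Qed.
Lemma morJ_cscale r s : morJ f (cscale r s) = cscale r (morJ f s).
Proof. by rewrite /cscale rmorphM /= morJ_iota. Qed.

Lemma morJB (s1 s2 : coef A) : morJ f (s1 - s2) = morJ f s1 - morJ f s2.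
Proof. exact: rmorphB. Qed.
Lemma morJD (s1 s2 : coef A) : morJ f (s1 + s2) = morJ f s1 + morJ f s2.
Proof. exact: rmorphD. Qed.
Lemma morJM (s1 s2 : coef A) : morJ f (s1 * s2) = morJ f s1 * morJ f s2.
Proof. exact: rmorphM. Qed.
Lemma morJ1 : morJ f 1 = 1.
Proof. exact: rmorph1. Qed.

Definition morE := (morID, morIN, morIR, morIZ, morI0, morI_mul f, morJ_form f,
  morJ_cscale, morJ_iota f).

Lemma mor_subalg (X : set (car A)) u :
  smallest (@subalg R A) X u ->
  smallest (@subalg R B) (morI f @` X) (morI f u).
Proof.
have [[B0 BL] BM] := smallest_subalgP (morI f @` X).
move=> /(_ (morI f @^-1` smallest (@subalg R B) (morI f @` X))); apply; split.
  split; first split; rewrite /preimage /=.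
  - by rewrite morI0.
  - by move=> s v w Xv Xw; rewrite morI_linear; apply: BL.
  by move=> v w Xv Xw; rewrite morI_mul; apply: BM.
by move=> v Xv; apply: sub_smallest_subalg; exists v.
Qed.

Lemma subalg_mor (X : set (car A)) (v : car B) : (forall s : coef B, exists s', morJ f s' = s) ->
  smallest (@subalg R B) (morI f @` X) v ->
  exists2 u, smallest (@subalg R A) X u & morI f u = v.
Proof.
move=> surjJ /(_ (morI f @` smallest (@subalg R A) X)).
have [[A0 AL] AM] := smallest_subalgP X.
case=> [|u Xu <-]; last by exists u.
split; first split; first split.
- by exists 0; rewrite ?morI0.
- move=> s _ _ [u Xu <-] [w Xw <-]; have [s' <-] := surjJ s.
  by exists (s' *: u + w); [apply: AL | rewrite morI_linear].
- move=> _ _ [u Xu <-] [w Xw <-].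
  by exists (u ∙ w); [apply: AM | rewrite morI_mul].
by move=> _ [u Xu <-]; exists u => //; apply: sub_smallest_subalg.
Qed.

Variable P : 'I_3 -> car A.

Lemma range_mor : range (morI f \o P) = morI f @` range P.
Proof.
apply/seteqP; split=> [_ [i _ <-]|_ [_ [i _ <-] <-]]; last by exists i.
by exists (P i) => //; exists i.
Qed.

Lemma mor_algP u : algP P u -> algP (morI f \o P) (morI f u).
Proof. by rewrite /algP range_mor; apply: mor_subalg. Qed.

Lemma algP_mor (v : car B) : (forall s : coef B, exists s', morJ f s' = s) ->
  algP (morI f \o P) v -> exists2 u, algP P u & morI f u = v.
Proof. by rewrite /algP range_mor; apply: subalg_mor. Qed.

Lemma morJ_trP i u : morJ f (trP P i u) = trP (morI f \o P) i (morI f u).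
Proof. by rewrite /trP !morE. Qed.

Lemma mor_reflP i u : morI f (reflP P i u) = reflP (morI f \o P) i (morI f u).
Proof. by rewrite /reflP !morE. Qed.

End MorphismTheory.

Section ComposeMor.
Variables (R : realType) (A B C : formAlg R).
Variables (g : formMor B C) (f : formMor A B).

Definition compMor : formMor A C.
Proof.
apply: (@FormMor R A C (morJ g \o morJ f : {rmorphism _ -> _})
  (morI g \o morI f)) => /= [r|s u v|u v|u v].
- by rewrite !morJ_iota.
- by rewrite !morI_linear.
- by rewrite !morI_mul.
- by rewrite !morJ_form.
Defined.

Lemma compMorJ s : morJ compMor s = morJ g (morJ f s).
Proof. by []. Qed.
End ComposeMor.

Definition quotMor (R : realType) (A : formAlg R) (p : idealPair A) :
  formMor A (quotAlg p) :=
  @FormMor R A (quotAlg p) (qJ p : {rmorphism _ -> _}) (qI p)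
    (fun=> erefl) (@qI_linear R A p) (@qIM R A p) (@qJ_form R A p).

Section Transfer.
Variables (R : realType) (A B : formAlg R) (f : formMor A B).
Hypotheses (surjJ : forall s, exists s', morJ f s' = s)
  (surjI : forall v : car B, exists u, morI f u = v).
Variables (K : Type) (C : K -> formAlg R) (g : forall k, formMor A (C k)).
Hypotheses
  (sepJ : forall r s, (forall k, morJ (g k) r = morJ (g k) s) ->
    morJ f r = morJ f s)
  (sepI : forall u v, (forall k, morI (g k) u = morI (g k) v) ->
    morI f u = morI f v).
Variables P e : 'I_3 -> car A.

(** All clauses are equations between images of elements of A, so they hold under [f] once they hold
    under every [g k]. Used for M(t) with the members of C_4A as the family, and for an injective
    morphism. *)
Lemma half_axial_transfer :
  (forall k, half_axial (morI (g k) \o P) (morI (g k) \o e)) ->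
  half_axial (morI f \o P) (morI f \o e).
Proof.
move=> hg; split=> /=.
- move=> u v; have [[{}u <-] [{}v <-]] := (surjI u, surjI v).
  rewrite -!morJ_form; apply: sepJ => k; rewrite !morE.
  exact: (ha_formC (hg k)).
- move=> u v w.
  have [[{}u <-] [[{}v <-] [{}w <-]]] := (surjI u, (surjI v, surjI w)).
  suff: morJ f ⟨u, v ∙ w⟩ = morJ f ⟨u ∙ v, w⟩ by rewrite !morE.
  by apply: sepJ => k; rewrite !morE; exact: (ha_formA (hg k)).
- move=> i; suff: morI f (P i ∙ P i) = morI f (P i) by rewrite !morE.
  by apply: sepI => k; rewrite !morE; exact: (ha_PP (hg k)).
- move=> i; suff: morI f (e i ∙ e i) = morI f (P i) by rewrite !morE.
  by apply: sepI => k; rewrite !morE; exact: (ha_ee (hg k)).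
- move=> i j ij; suff: morI f (e i ∙ e j) = morI f 0 by rewrite !morE.
  by apply: sepI => k; rewrite !morE; exact: (ha_ee0 (hg k)).
- move=> i; suff: morJ f ⟨P i, P i⟩ = morJ f (iota A 2) by rewrite !morE.
  by apply: sepJ => k; rewrite !morE; exact: (ha_formP (hg k)).
- move=> i j ij.
  suff: morJ f ⟨P i, P j⟩ = morJ f (iota A 8^-1) by rewrite !morE.
  by apply: sepJ => k; rewrite !morE; exact: (ha_formPP (hg k)).
- move=> i v /(algP_mor surjJ)[u Ju <-].
  suff: morI f (u ∙ e i) = morI f (trP P i u *: e i) by rewrite !morE.
  apply: sepI => k; rewrite !morE.
  by apply: (ha_mule (hg k)); apply: mor_algP.
- move=> i v /(algP_mor surjJ)[u Ju <-].
  suff: morJ f ⟨u, e i⟩ = morJ f 0 by rewrite !morE rmorph0.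
  apply: sepJ => k; rewrite !morE rmorph0.
  by apply: (ha_forme (hg k)); apply: mor_algP.
- move=> i v /(algP_mor surjJ)[u Ju <-].
  suff: morI f (P i ∙ (P i ∙ u)) =
      morI f (2^-1 %*: (P i ∙ u + trP P i u *: P i)) by rewrite !morE.
  apply: sepI => k; rewrite !morE.
  by apply: (ha_peirce (hg k)); apply: mor_algP.
move=> i v w /(algP_mor surjJ)[x Jx <-] /(algP_mor surjJ)[y Jy <-].
rewrite -morI_mul -!mor_reflP -morI_mul; apply: sepI => k.
rewrite morI_mul !mor_reflP morI_mul.
by apply: (ha_refl (hg k)); apply: mor_algP.
Qed.

End Transfer.

(** * Members of C_4A and the specialisation M(t) *)

(* Locked, since rewriting with [morID] or [amulDl] would see through them. *)
Definition axisP (R : realType) (A : formAlg R) (x : 'I_3 -> bool -> car A) i :=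
  locked (x i true + x i false).
Definition axisE (R : realType) (A : formAlg R) (x : 'I_3 -> bool -> car A) i :=
  locked (x i true - x i false).

Lemma axisPE (R : realType) (A : formAlg R) (x : 'I_3 -> bool -> car A) i :
  axisP x i = x i true + x i false.
Proof. by rewrite /axisP -lock. Qed.
Lemma axisEE (R : realType) (A : formAlg R) (x : 'I_3 -> bool -> car A) i :
  axisE x i = x i true - x i false.
Proof. by rewrite /axisE -lock. Qed.

Section FourA.
Variables (R : realType) (A : formAlg R) (x : 'I_3 -> bool -> car A).
Hypotheses (hprim : primitive_frobenius_axial (axes x)) (hshape : shape4A x).
Local Notation V := (car A).
Local Notation P := (axisP x).
Local Notation e := (axisE x).
Implicit Types (u w y z : V) (s r : coef A).

Lemma axes_x i b : axes x (x i b).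
Proof. by exists i => //; exists b. Qed.

Lemma x_idem i b : x i b ∙ x i b = x i b.
Proof. by case: hprim => _ /(_ _ (axes_x i b))[[]]. Qed.

Lemma x_form i b : ⟨x i b, x i b⟩ = 1.
Proof. by case: hprim => _ _ [_ _]; apply; apply: axes_x. Qed.

Lemma frob_assoc u w y : ⟨u, w ∙ y⟩ = ⟨u ∙ w, y⟩.
Proof. by case: hprim => _ _ []. Qed.

(** A Frobenius form is not assumed symmetric. Associativity and commutativity give symmetry when
    one argument is a product, and the generators are idempotent, hence products. *)
Lemma frob_sym u w : ⟨u, w⟩ = ⟨w, u⟩.
Proof.
have symM y z1 z2 : ⟨y, z1 ∙ z2⟩ = ⟨z1 ∙ z2, y⟩.
  by rewrite frob_assoc amulC -frob_assoc amulC frob_assoc amulC.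
have [gen _ _] := hprim; have : [set: V] w by []; rewrite -gen.
move=> /(_ [set w | forall u, ⟨u, w⟩ = ⟨w, u⟩]) /(_ _ u); apply; split.
  split; first split=> [y|s y z hy hz y'] /=.
  - by rewrite form0l form0r.
  - by rewrite !formE hy hz.
  by move=> y z _ _ y' /=; rewrite symM.
by move=> _ [i _ [b _ <-]] y /=; rewrite -{1}x_idem symM x_idem.
Qed.

Lemma x_opp i b : x i b ∙ x i (~~ b) = 0.
Proof.
have [j ij] : exists j : 'I_3, i != j.
  have [->|ni] := eqVneq i ord0; last by exists ord0.
  by exists (@Ordinal 3 1 isT).
have [v /(_ i j ij)[_ [_ _ _ [h _ _ _]]]] := hshape.
by case: b => //=; rewrite amulC.
Qed.

Lemma x_opp_form i b : ⟨x i b, x i (~~ b)⟩ = 0.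
Proof. by rewrite -{1}(x_idem i b) -frob_assoc x_opp form0r. Qed.

(* [y0] and [yh] are common eigenvectors of a_i and a_-i. The fusion rules make
   the elements with such a decomposition a subalgebra. *)
Record peirce i y s y0 yh : Prop := Peirce {
  peirce_sum : y = s *: P i + y0 + yh;
  peirce0 : forall b, x i b ∙ y0 = 0;
  peirceh : forall b, x i b ∙ yh = 4^-1 %*: yh
}.

Lemma x_P i b : x i b ∙ P i = x i b.
Proof.
rewrite !axisPE amulDr; have := x_opp i b.
by case: b => /= ->; rewrite ?(addr0, add0r) x_idem.
Qed.

Lemma P_mul i y : P i ∙ y = x i true ∙ y + x i false ∙ y.
Proof. by rewrite !axisPE amulDl. Qed.

Section Parts.
Variables (i : 'I_3) (y : V) (s : coef A) (y0 yh : V).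
Hypothesis hy : peirce i y s y0 yh.

Lemma peirce0_form b : ⟨y0, x i b⟩ = 0.
Proof.
by rewrite -(x_idem i b) frob_assoc [y0 ∙ _]amulC (peirce0 hy) form0l.
Qed.

Lemma peirceh_form b : ⟨yh, x i b⟩ = 0.
Proof.
have H : ⟨yh, x i b⟩ = cscale 4^-1 ⟨yh, x i b⟩.
  by rewrite -{1}(x_idem i b) frob_assoc [yh ∙ _]amulC (peirceh hy) formRl.
have -> : ⟨yh, x i b⟩ =
    cscale (4 / 3) (⟨yh, x i b⟩ - cscale 4^-1 ⟨yh, x i b⟩) by lin.
by rewrite -H subrr /cscale mulr0.
Qed.

Lemma peirce_form b : ⟨y, x i b⟩ = s.
Proof.
rewrite (peirce_sum hy) !formDl peirce0_form peirceh_form !addr0 formZl.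
rewrite frob_sym -{1}(x_idem i b) -frob_assoc x_P x_form mulr1 //.
Qed.

Lemma peirce_tr : trP P i y = s.
Proof. by rewrite /trP !axisPE formDr !peirce_form; lin. Qed.

Lemma peirce_P : P i ∙ y = s *: P i + 2^-1 %*: yh.
Proof.
rewrite (peirce_sum hy) P_mul !amulE !(peirce0 hy) !(peirceh hy) !x_P.
rewrite !axisPE carZDr; lin.
Qed.

Lemma peirce_refl : reflP P i y = s *: P i + y0 - yh.
Proof. rewrite /reflP peirce_P peirce_tr {1}(peirce_sum hy); lin. Qed.

Lemma peirce_PP : P i ∙ (P i ∙ y) = 2^-1 %*: (P i ∙ y + trP P i y *: P i).
Proof.
rewrite peirce_tr peirce_P [in LHS]P_mul !amulE !x_P !(peirceh hy).
rewrite !axisPE carZDr; lin.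
Qed.

(** The two axes act on y0 and yh by the same scalars, so their difference e_i annihilates both, and
    only the multiple of P_i contributes. *)
Lemma peirce_e : y ∙ e i = s *: e i.
Proof.
rewrite amulC (peirce_sum hy) !axisEE !amulE !x_P !(peirce0 hy) !(peirceh hy).
rewrite carZDr carZNr; lin.
Qed.

Lemma peirce_e_form : ⟨y, e i⟩ = 0.
Proof. by rewrite !axisEE formDr formNr !peirce_form subrr. Qed.

End Parts.

Lemma peirce_L i r y s y0 yh z s' z0 zh :
  peirce i y s y0 yh -> peirce i z s' z0 zh ->
  peirce i (r *: y + z) (r * s + s') (r *: y0 + z0) (r *: yh + zh).
Proof.
move=> hy hz; split=> [|b|b].
- rewrite (peirce_sum hy) (peirce_sum hz) !carZDr carZDl carZA; lin.
- by rewrite !amulE (peirce0 hy) (peirce0 hz) scaler0 addr0.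
by rewrite !amulE (peirceh hy) (peirceh hz) rscaleDr rscaleZ.
Qed.

Lemma fusion00 i b y z : x i b ∙ y = 0 -> x i b ∙ z = 0 -> x i b ∙ (y ∙ z) = 0.
Proof.
have [_ /(_ _ (axes_x i b))[[_ _ fus] _] _] := hprim => hy hz.
case: (fus E0 E0 y z); rewrite /eigenspace /= ?rscale0 // => f hf.
by rewrite big_seq1 => ->; have := hf E0; rewrite /eigenspace /= rscale0.
Qed.

Lemma fusion0h i b y z : x i b ∙ y = 0 -> x i b ∙ z = 4^-1 %*: z ->
  x i b ∙ (y ∙ z) = 4^-1 %*: (y ∙ z).
Proof.
have [_ /(_ _ (axes_x i b))[[_ _ fus] _] _] := hprim => hy hz.
case: (fus E0 E4 y z); rewrite /eigenspace /= ?rscale0 // => f hf.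
by rewrite big_seq1 => ->; have := hf E4.
Qed.

(** The fusion rule puts y ∙ z into the sum of the 1- and 0-eigenspaces. Primitivity makes the
    1-part a multiple of the axis a, and pairing with a finds the multiple: <y ∙ z, a> = <y, z ∙ a>
    = <y, z> / 4. *)
Lemma fusionhh i b y z : x i b ∙ y = 4^-1 %*: y -> x i b ∙ z = 4^-1 %*: z ->
  x i b ∙ (y ∙ z - cscale 4^-1 ⟨y, z⟩ *: x i b) = 0.
Proof.
have [_ /(_ _ (axes_x i b))[[_ _ fus] prim] _] := hprim => hy hz.
case: (fus E4 E4 y z); rewrite /eigenspace //= => f hf.
rewrite big_cons big_seq1 => yz.
have : eigenspace (x i b) E1 (f E1) by apply: hf.
rewrite prim => -[r _ f1].
have h0 : x i b ∙ f E0 = 0 by have := hf E0; rewrite /eigenspace /= rscale0.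
have rE : r = cscale 4^-1 ⟨y, z⟩.
  have : ⟨y ∙ z, x i b⟩ = r.
    rewrite yz -f1 formDl formZl x_form mulr1 -{1}(x_idem i b) frob_assoc.
    by rewrite [f E0 ∙ _]amulC h0 form0l addr0.
  by rewrite -frob_assoc [z ∙ _]amulC hz formRr.
by rewrite yz -f1 rE [_ + f E0]addrC addrK.
Qed.

(** The multiple c found in [fusionhh] is the same for a_i and a_-i, so yh ∙ zh - c P_i is
    annihilated by both axes. *)
Lemma peirce_M i y s y0 yh z s' z0 zh :
  peirce i y s y0 yh -> peirce i z s' z0 zh ->
  let c := cscale 4^-1 ⟨yh, zh⟩ in
  peirce i (y ∙ z) (s * s' + c) (y0 ∙ z0 + (yh ∙ zh - c *: P i))
    (2^-1 %*: (s *: zh + s' *: yh) + (y0 ∙ zh + z0 ∙ yh)).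
Proof.
move=> hy hz c; split=> [|b|b].
- have Pz0 : P i ∙ z0 = 0 by rewrite P_mul !(peirce0 hz) addr0.
  have Py0 : P i ∙ y0 = 0 by rewrite P_mul !(peirce0 hy) addr0.
  have Pzh : P i ∙ zh = 2^-1 %*: zh by rewrite P_mul !(peirceh hz); lin.
  have Pyh : P i ∙ yh = 2^-1 %*: yh by rewrite P_mul !(peirceh hy); lin.
  have PP : P i ∙ P i = P i by rewrite P_mul !x_P !axisPE.
  rewrite {1}(peirce_sum hy) {1}(peirce_sum hz) !amulE PP.
  rewrite [y0 ∙ P i]amulC [yh ∙ P i]amulC Pz0 Py0 Pzh Pyh [yh ∙ z0]amulC.
  rewrite !carZDr -!rscaleZ !carZDl !carZA !carZ0; lin.
- have := fusionhh (peirceh hy b) (peirceh hz b); rewrite -/c !amulE x_idem.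
  by move=> hh; rewrite fusion00 ?(peirce0 hy) ?(peirce0 hz) // x_P add0r.
rewrite !amulE (fusion0h (peirce0 hy b) (peirceh hz b)).
rewrite (fusion0h (peirce0 hz b) (peirceh hy b)) (peirceh hy) (peirceh hz).
rewrite -!rscaleZ; lin.
Qed.

Lemma peirce_self i : peirce i (P i) 1 0 0.
Proof.
split=> [|b|b]; first by rewrite scale1r !addr0.
  by rewrite amul0r.
by rewrite amul0r rscaler0.
Qed.

Lemma mulP_other i j v : i != j -> type4A x i j v ->
  P i ∙ P j = 8^-1 %*: (P i + P j) - (3 / 16) %*: v.
Proof.
move=> ij [_ _ h _].
have hp b d : x i b ∙ x j d = 64^-1 %*: (3 %*: x i b + 3 %*: x j d +
  x i (~~ b) + x j (~~ d) - 3 %*: v) by case: (h b d).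
by rewrite !axisPE !amulE !hp /=; lin.
Qed.

(** By [peirce_P] the 1/4-part of P_j has to be 2 (P_i ∙ P_j - P_i / 16), which the 4A product
    formula turns into [yh]. *)
Lemma peirce_other i j v : i != j -> type4A x i j v ->
  let yh := 8^-1 %*: (2 %*: P j + P i - 3 %*: v) in
  peirce i (P j) (cscale 16^-1 1) (P j - 16^-1 %*: P i - yh) yh.
Proof.
move=> ij [_ _ h _] yh.
have hp b d : x i b ∙ x j d = 64^-1 %*: (3 %*: x i b + 3 %*: x j d +
  x i (~~ b) + x j (~~ d) - 3 %*: v) by case: (h b d).
have hv b : x i b ∙ v = 16^-1 %*: (5 %*: x i b - x i (~~ b)
  - 2 %*: x j true - 2 %*: x j false + 3 %*: v) by case: (h b b).
split=> [|b|b]; first by rewrite iotaZ; lin.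
- rewrite /yh !amulE x_P [P j]axisPE amulDr !hp hv /=.
  by case: b => /=; rewrite ?axisPE; lin.
rewrite /yh !amulE x_P [P j]axisPE amulDr !hp hv /=.
by case: b => /=; rewrite ?axisPE; lin.
Qed.

Lemma algP_peirce i y : algP P y -> exists s y0 yh, peirce i y s y0 yh.
Proof.
move=> /(_ [set y | exists s y0 yh, peirce i y s y0 yh]); apply; split.
  split; first split=> /=.
  - exists 0, 0, 0; split=> [|b|b]; first by rewrite scale0r !addr0.
      by rewrite amul0r.
    by rewrite amul0r rscaler0.
  - move=> r u w [s [u0 [uh hu]]] [s' [w0 [wh hw]]].
    by do 3!eexists; apply: peirce_L hu hw.
  move=> u w [s [u0 [uh hu]]] [s' [w0 [wh hw]]].
  by do 3!eexists; apply: peirce_M hu hw.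
move=> _ [j _ <-] /=; have [<-|ij] := eqVneq i j.
  by exists 1, 0, 0; apply: peirce_self.
have [v /(_ i j ij)[_ hv]] := hshape.
by do 3!eexists; apply: peirce_other hv.
Qed.

Lemma half_axial_4A : half_axial P e.
Proof.
have [v hv] := hshape.
have PP i : P i ∙ P i = P i by rewrite P_mul !x_P !axisPE.
split=> //; [exact: frob_sym|exact: frob_assoc|move=> i|move=> i j ij|move=> i..].
- have := (x_opp i true, x_opp i false) => -[/= h1 h2].
  by rewrite !axisEE !amulE h1 h2 !x_idem !axisPE; lin.
- have [_ [_ _ h _]] := hv i j ij.
  have hp b d : x i b ∙ x j d = 64^-1 %*: (3 %*: x i b + 3 %*: x j d +
    x i (~~ b) + x j (~~ d) - 3 %*: v i j) by case: (h b d).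
  by rewrite !axisEE !amulE !hp /=; lin.
- have := (x_opp_form i true, x_opp_form i false) => -[/= h1 h2].
  by rewrite !axisPE !formE h1 h2 !x_form iota_cscale; lin.
- move=> j ij; have [_ [_ _ h _]] := hv i j ij.
  have hp b d : ⟨x i b, x j d⟩ = iota A 32^-1 by case: (h b d) => _ _ _ [].
  by rewrite !axisPE !formE !hp !iota_cscale; lin.
- move=> y /(algP_peirce i)[s [y0 [yh hy]]].
  by rewrite (peirce_e hy) (peirce_tr hy).
- by move=> y /(algP_peirce i)[s [y0 [yh hy]]]; apply: (peirce_e_form hy).
- by move=> y /(algP_peirce i)[s [y0 [yh hy]]]; apply: (peirce_PP hy).
(* The reflection is multiplicative because the decomposition of a product in [peirce_M] is graded
   by the sign attached to the 1/4-parts. *)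
move=> y z /(algP_peirce i)[s [y0 [yh hy]]] /(algP_peirce i)[u [z0 [zh hz]]].
rewrite (peirce_refl (peirce_M hy hz)) (peirce_refl hy) (peirce_refl hz) !amulE.
have Pz0 : P i ∙ z0 = 0 by rewrite P_mul !(peirce0 hz) addr0.
have Py0 : P i ∙ y0 = 0 by rewrite P_mul !(peirce0 hy) addr0.
have Pzh : P i ∙ zh = 2^-1 %*: zh by rewrite P_mul !(peirceh hz); lin.
have Pyh : P i ∙ yh = 2^-1 %*: yh by rewrite P_mul !(peirceh hy); lin.
rewrite PP [y0 ∙ P i]amulC [yh ∙ P i]amulC Pz0 Py0 Pzh Pyh [yh ∙ z0]amulC.
by rewrite !carZDr ?carZNr -!rscaleZ !carZDl !carZA ?carZ0; lin.
Qed.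

(** Origin of t = 1/12 - 16 q / 3: v_(j,k) is a combination of P_j, P_k and P_j ∙ P_k, and pairing
    with an axis a_i reads off Peirce coefficients, which are 1/16 for P_j and P_k. *)
Lemma form_x_v4A i j k b : i != j -> i != k -> j != k ->
  ⟨x i b, v4A x j k⟩ = cscale 12^-1 1 - cscale (16 / 3) (trP P i (P j ∙ P k)).
Proof.
move=> ij ik jk; have [v hv] := hshape.
have [_ hjk] := hv j k jk.
rewrite -(type4A_v4A hjk).
have -> : v j k = (2 / 3) %*: (P j + P k) - (16 / 3) %*: (P j ∙ P k).
  by rewrite (mulP_other jk hjk); lin.
have [s [y0 [yh hy]]] : exists s y0 yh, peirce i (P j ∙ P k) s y0 yh.
  by apply: algP_peirce; apply: algP_M; apply: algP_P.
have hj := peirce_other ij (hv i j ij).2; have hk := peirce_other ik (hv i k ik).2.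
rewrite frob_sym !formE (peirce_form hy) (peirce_tr hy).
by rewrite (peirce_form hj) (peirce_form hk); lin.
Qed.

End FourA.

(** * Induction principles for the universal algebra *)

Lemma magma_ind (S : magma -> Prop) :
  (forall g, S (mgen g)) -> (forall x y, S x -> S y -> S (mprod x y)) ->
  forall x, S x.
Proof.
move=> Sg SM x; rewrite -[x]reprK; elim: (repr x) => [g|s IHs t IHt].
  exact: Sg.
by rewrite -mprodE; apply: SM.
Qed.

(** A monomial of positive degree is an indeterminate times a monomial of smaller degree. *)
Lemma malg_cmonom_ind (R : comNzRingType) (I : choiceType)
    (S : {malg R[{cmonom I}]} -> Prop) :
  (forall r, S << r *g mone >>) -> (forall i, S << ucm i >>) ->
  (forall r s, S r -> S s -> S (r + s)) ->
  (forall r s, S r -> S s -> S (r * s)) -> forall r, S r.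
Proof.
move=> Sr Sl SD SM r; rewrite [r]monalgE.
elim: (finmap.enum_fset _) => [|k l IH].
  by rewrite big_nil; have := Sr 0; rewrite monalgU0.
rewrite big_cons; apply: (SD) => //.
have -> : << r@_k *g k >> =
    << r@_k *g mone >> * << k >> :> {malg R[{cmonom I}]}.
  by rewrite malgM_def fgmulUU mulr1 mul1m.
apply: (SM) => //; elim: {l r IH} (mdeg k) {-2}k (erefl (mdeg k)) => [|n IH] {}k.
  by move/mdeg_eq0I=> ->.
move=> degk; have [i ki] : exists i, k i != 0%N.
  apply: contrapT => no_i; move: degk; rewrite mdegE big1 // => i _.
  by apply/eqP; apply: contrapT => /negP ki; apply: no_i; exists i.
have kE : k = mmul (ucm i) (divcm k (ucm i)).
  apply/eqP/cmP => j; rewrite mulcmE divcmE subnKC // ucmE.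
  by case: eqVneq => //= <-; rewrite lt0n.
have degk' : mdeg (divcm k (ucm i)) = n.
  by apply/eq_add_S; rewrite -degk [in RHS]kE mdegM mdegU.
rewrite kE; have -> : << mmul (ucm i) (divcm k (ucm i)) >> =
    << ucm i >> * << divcm k (ucm i) >> :> {malg R[{cmonom I}]}.
  by rewrite malgM_def fgmulUU mulr1.
by apply: SM; [apply: Sl | apply: IH].
Qed.

Section HatInduction.
Variable R : realType.

Lemma mextU (W : lmodType (hatR R)) (h : magma -> W) x :
  mext h (<< x >> : hatM R) = h x.
Proof.
by rewrite /mext msuppU oner_eq0 big_seq_fset1 mcoeffUU scale1r.
Qed.

Lemma hmulUU x y : hmul << x >> << y >> = << mprod x y >> :> hatM R.
Proof. by rewrite hmulE !mextU. Qed.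

Lemma hformUU x y : hform << x >> << y >> = lam R x y.
Proof. by rewrite hformE !mextU. Qed.

Lemma hatM_ind (S : hatM R -> Prop) : S 0 ->
  (forall s x u, S u -> S (s *: << x >> + u)) -> forall u, S u.
Proof.
move=> S0 SL u; rewrite [u]monalgE; elim: (finmap.enum_fset _) => [|k l IH].
  by rewrite big_nil.
rewrite big_cons; have -> : << u@_k *g k >> = u@_k *: (<< k >> : hatM R).
  by apply/malgP => k'; rewrite mcoeffZ !mcoeffU mulrnAr mulr1.
exact: SL.
Qed.

Lemma hiotaE (r : R) : hiota R r = << r *g mone >>.
Proof.
rewrite /hiota /= -[RHS]mulr1.
exact/esym/(@mul_malgC {cmonom pair_class} R r 1).
Qed.

Lemma hatR_ind (S : hatR R -> Prop) : (forall r, S (hiota R r)) ->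
  (forall x y, S (lam R x y)) -> (forall r s, S r -> S s -> S (r + s)) ->
  (forall r s, S r -> S s -> S (r * s)) -> forall r, S r.
Proof.
move=> Sr Sl SD SM; apply: malg_cmonom_ind => // [r|c].
  by rewrite -hiotaE.
by rewrite -[c]reprK; case: (repr c) => x y; apply: Sl.
Qed.

End HatInduction.

(** * The half-axial identities in M(t) *)

Section Specialisation.
Variables (R : realType) (t : R).

Definition toMt : formMor (hatA R) (Mt t) :=
  compMor (quotMor (principalPair (t4A R - iota (M4A R) t))) (quotMor (cap4A R)).

Lemma toMt_surjJ (s : coef (Mt t)) : exists s', morJ toMt s' = s.
Proof. by exists (repr (repr s : R4A R)) => /=; rewrite !qJ_repr. Qed.

Lemma toMt_surjI (v : car (Mt t)) : exists u, morI toMt u = v.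
Proof. by exists (repr (repr v : car (M4A R))) => /=; rewrite !qI_repr. Qed.

Definition C4A_pair := {p : idealPair (hatA R) | C4A p}.

(** Congruence modulo an intersection is congruence modulo each member; this is how identities of
    the members reach the universal algebra. *)
Lemma M4A_sepJ (r s : coef (hatA R)) :
  (forall p : C4A_pair, qJ (sval p) r = qJ (sval p) s) ->
  qJ (cap4A R) r = qJ (cap4A R) s.
Proof.
move=> rs; apply/qJ_eq => p Cp; apply/qJ_eq.
exact: rs (exist _ p Cp).
Qed.

Lemma M4A_sepI (u v : car (hatA R)) :
  (forall p : C4A_pair, qI (sval p) u = qI (sval p) v) ->
  qI (cap4A R) u = qI (cap4A R) v.
Proof.
move=> uv; apply/qI_eq => p Cp; apply/qI_eq.
exact: uv (exist _ p Cp).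
Qed.

Lemma mor_axisP (A B : formAlg R) (f : formMor A B) x :
  morI f \o axisP x = axisP (fun i b => morI f (x i b)).
Proof. by apply: funext => i /=; rewrite !axisPE morID. Qed.

Lemma mor_axisE (A B : formAlg R) (f : formMor A B) x :
  morI f \o axisE x = axisE (fun i b => morI f (x i b)).
Proof. by apply: funext => i /=; rewrite !axisEE morID morIN. Qed.

Lemma mor_tr_axisP (A B : formAlg R) (f : formMor A B) x r r' i j k :
  morJ f (cscale r 1 - cscale r' (trP (axisP x) i (axisP x j ∙ axisP x k))) =
  let P := axisP (fun i b => morI f (x i b)) in
  cscale r 1 - cscale r' (trP P i (P j ∙ P k)).
Proof.
rewrite morJB 2!morJ_cscale morJ1 morJ_trP morI_mul mor_axisP /=.
by congr (_ - cscale _ (trP _ _ (_ ∙ _))); rewrite !axisPE morID.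
Qed.

Local Notation hgen := (@hgen R).
Definition genMt i b : car (Mt t) := morI toMt (hgen i b).

Lemma half_axial_Mt : half_axial (axisP genMt) (axisE genMt).
Proof.
rewrite -(mor_axisP toMt hgen) -(mor_axisE toMt hgen).
apply: (half_axial_transfer toMt_surjJ toMt_surjI
  (g := fun p : C4A_pair => quotMor (sval p))).
- by move=> r s rs /=; congr (qJ _ _); apply: M4A_sepJ.
- by move=> r s rs /=; congr (qI _ _); apply: M4A_sepI.
move=> [p [_ prim _ shape]] /=.
rewrite (mor_axisP (quotMor p) hgen) (mor_axisE (quotMor p) hgen).
exact: half_axial_4A.
Qed.

Lemma mor_v4A (A B : formAlg R) (f : formMor A B) x i j :
  morI f (v4A x i j) = v4A (fun i b => morI f (x i b)) i j.
Proof. by rewrite /v4A !morE. Qed.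

Let i1 : 'I_3 := inord 0.
Let i2 : 'I_3 := inord 1.
Let i3 : 'I_3 := inord 2.
Let i12 : i1 != i2. Proof. by rewrite -val_eqE /= !inordK. Qed.
Let i13 : i1 != i3. Proof. by rewrite -val_eqE /= !inordK. Qed.
Let i23 : i2 != i3. Proof. by rewrite -val_eqE /= !inordK. Qed.

(** The relation between t and the trace is lifted to the universal ring, where its two sides can be
    compared member by member. *)
Lemma t4A_tr : t4A R =
  morJ (quotMor (cap4A R)) (cscale 12^-1 1 - cscale (16 / 3)
    (trP (axisP hgen) i1 (axisP hgen i2 ∙ axisP hgen i3))).
Proof.
transitivity (morJ (quotMor (cap4A R)) ⟨hgen i1 true, v4A hgen i2 i3⟩).
  by rewrite morJ_form mor_v4A.
apply: M4A_sepJ => -[p Cp]; have [_ prim _ shape] := Cp.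
rewrite -[LHS]/(morJ (quotMor p) _) -[RHS]/(morJ (quotMor p) _).
rewrite morJ_form mor_v4A (form_x_v4A prim shape true i12 i13 i23).
exact/esym/(mor_tr_axisP (quotMor p)).
Qed.

Lemma tr_of_t4A (A : formAlg R) (s : coef A) :
  cscale t 1 = cscale 12^-1 1 - cscale (16 / 3) s ->
  s = cscale (64^-1 - 3 / 16 * t) 1.
Proof.
move=> H; have -> : s = cscale (3 / 16) (cscale 12^-1 1 -
  (cscale 12^-1 1 - cscale (16 / 3) s)) by lin.
by rewrite -H; lin.
Qed.

Lemma tr_Mt i j k : i != j -> i != k -> j != k ->
  trP (axisP genMt) i (axisP genMt j ∙ axisP genMt k) =
  cscale (64^-1 - 3 / 16 * t) 1.
Proof.
set P := axisP genMt.
have tr0 : trP P i1 (P i2 ∙ P i3) = cscale (64^-1 - 3 / 16 * t) 1.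
  have : morJ (quotMor (principalPair (t4A R - iota (M4A R) t))) (t4A R) =
      cscale t 1.
    rewrite -iota_cscale; apply/qJ_eq.
    by exists 1; rewrite ?mulr1.
  rewrite [X in morJ _ X]t4A_tr => H'.
  have := mor_tr_axisP toMt hgen 12^-1 (16 / 3) i1 i2 i3.
  have -> : morJ toMt (cscale 12^-1 1 - cscale (16 / 3)
     (trP (axisP hgen) i1 (axisP hgen i2 ∙ axisP hgen i3))) = cscale t 1.
    by rewrite compMorJ.
  exact: tr_of_t4A.
exact: (trP_perm half_axial_Mt i12 i13 i23 tr0).
Qed.

End Specialisation.

(** * Transfer of the inequality from a model to M(t) *)

Section Generation.
Variables (R : realType) (q : R) (A B : formAlg R) (f : formMor (hatA R) A).
Local Notation x := (fun i b => morI f (@hgen R i b)).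
Hypothesis surjI : forall v : car A, exists u, morI f u = v.
Variables (P' e' : 'I_3 -> car B).
Hypotheses (hA : half_axial (axisP x) (axisE x)) (hB : half_axial P' e').
Hypothesis trqA : forall i j k, i != j -> i != k -> j != k ->
  trP (axisP x) i (axisP x j ∙ axisP x k) = cscale q 1.
Hypothesis trqB : forall i j k, i != j -> i != k -> j != k ->
  trP P' i (P' j ∙ P' k) = cscale q 1.
Local Notation corrAB := (corr (axisP x) (axisE x) P' e').

Lemma corr_magma m : exists u', corrAB (morI f (<< m >> : hatM R)) u'.
Proof.
elim/magma_ind: m => [[i b]|m1 m2 [u1 h1] [u2 h2]]; last first.
  exists (u1 ∙ u2); rewrite -hmulUU (morI_mul f).
  exact: (corr_mul hA hB trqA trqB).
rewrite -[X in corrAB X]/(x i b).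
have cP := corr_P (axisE x) e' (corrP_P (axisP x) P' i).
have cE := corr_e (axisP x) (axisE x) P' e' i.
case: b.
- have -> : x i true = 2^-1 %*: axisP x i + 2^-1 %*: axisE x i.
    by rewrite axisPE axisEE; lin.
  exists (2^-1 %*: P' i + 2^-1 %*: e' i).
  by apply: corr_D; apply: corr_Z.
have -> : x i false = 2^-1 %*: axisP x i + (- 2^-1) %*: axisE x i.
  by rewrite axisPE axisEE; lin.
exists (2^-1 %*: P' i + (- 2^-1) %*: e' i).
by apply: corr_D; apply: corr_Z.
Qed.

(** Each indeterminate is sent to a form value of elements that have partners in B, and [corr_form]
    makes such values real. *)
Lemma hatR_real (s : hatR R) : exists r, morJ f s = iota A r.
Proof.
elim/hatR_ind: s => [r|m1 m2|s1 s2 [r1 h1] [r2 h2]|s1 s2 [r1 h1] [r2 h2]].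
- by exists r; rewrite -[hiota R]/(iota (hatA R)) morJ_iota.
- have [u1 h1] := corr_magma m1; have [u2 h2] := corr_magma m2.
  have [r [hr _]] := corr_form hA hB trqA trqB h1 h2.
  by exists r; rewrite -hformUU (morJ_form f).
- by exists (r1 + r2); rewrite (morJD f) h1 h2 rmorphD.
by exists (r1 * r2); rewrite (morJM f) h1 h2 rmorphM.
Qed.

Lemma corr_exists v : exists v', corrAB v v'.
Proof.
have [u <-] := surjI v; elim/hatM_ind: u => [|s m u [u' hu]].
  by exists 0; rewrite morI0; apply: corr_0.
have [r hr] := hatR_real s; have [m' hm] := corr_magma m.
exists (r %*: m' + u'); rewrite (morI_linear f) hr.
exact: corr_L.
Qed.

(** Both terms of Norton's difference are form values of related elements, hence the same real
    numbers in A and in B. *)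
Lemma norton_corr : injective (iota B) ->
  (forall u v u' v', corrAB u u' -> corrAB v v' ->
    real_nonneg (⟨u' ∙ u', v' ∙ v'⟩ - ⟨u' ∙ v', u' ∙ v'⟩)) -> norton A.
Proof.
move=> iota_inj nB u v.
have [u' uu] := corr_exists u; have [v' vv] := corr_exists v.
have cM := corr_mul hA hB trqA trqB; have cF := corr_form hA hB trqA trqB.
have [r [hr hr']] := cF _ _ _ _ (cM _ _ _ _ uu uu) (cM _ _ _ _ vv vv).
have [s [hs hs']] := cF _ _ _ _ (cM _ _ _ _ uu vv) (cM _ _ _ _ uu vv).
have [z z_ge0 /esym/eqP] := nB _ _ _ _ uu vv.
rewrite hr' hs' -rmorphB => /eqP/iota_inj zE.
by exists z; rewrite // hr hs -rmorphB zE.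
Qed.

End Generation.

(** * The matrix model *)

(* Atoms are compared up to conversion, in contrast to [atom_index]. *)
Ltac mx_index x vs :=
  lazymatch vs with
  | cons ?y ?tl =>
    match constr:(tt) with
    | _ => let e := constr:(ltac:(unify x y; exact tt)) in constr:(0%N)
    | _ => let n := mx_index x tl in constr:(S n)
    end
  end.

Ltac mx_add x vs :=
  match constr:(tt) with
  | _ => let n := mx_index x vs in vs
  | _ => constr:(cons x vs)
  end.

Ltac mx_atoms t vs :=
  lazymatch t with
  | @GRing.add _ ?a ?b => let vs1 := mx_atoms a vs in mx_atoms b vs1
  | @GRing.opp _ ?a => mx_atoms a vs
  | @GRing.zero _ => vs
  | @GRing.scale _ _ _ ?a => mx_atoms a vs
  | _ => mx_add t vs
  end.

Ltac mx_reify T t vs :=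
  lazymatch t with
  | @GRing.add _ ?a ?b =>
    let ea := mx_reify T a vs in let eb := mx_reify T b vs in
    constr:(@LAdd T ea eb)
  | @GRing.opp _ ?a => let ea := mx_reify T a vs in constr:(@LOpp T ea)
  | @GRing.zero _ => constr:(@LZero T)
  | @GRing.scale _ _ ?r ?a => let ea := mx_reify T a vs in constr:(@LScale T r ea)
  | _ => let n := mx_index t vs in constr:(@LAtom T n)
  end.

Ltac mxlin :=
  lazymatch goal with
  | |- @eq ?T0 ?x ?y =>
    let T := eval hnf in T0 in
    lazymatch T with
    | matrix ?K ?m ?n =>
      let V := T in
      let vs0 := mx_atoms x (@nil V) in
      let vs := mx_atoms y vs0 in
      let ex := mx_reify K x vs in
      let ey := mx_reify K y vs in
      refine (@leval_eq _ _ (@GRing.scale _ _) (@scalerDr _ _)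
         (fun r s v => @scalerDl _ _ v r s) (@scalerA _ _) (@scale1r _ _) vs ex ey _ _);
      [reflexivity | lin_close]
    end
  end.

Section MatrixLaws.
Variable S : numFieldType.
Implicit Types X Y Z : 'M[S]_3.

Lemma mmDl X Y Z : (X + Y) *m Z = X *m Z + Y *m Z.
Proof. exact: mulmxDl. Qed.
Lemma mmDr X Y Z : Z *m (X + Y) = Z *m X + Z *m Y.
Proof. exact: mulmxDr. Qed.
Lemma mmNl X Z : (- X) *m Z = - (X *m Z).
Proof. exact: mulNmx. Qed.
Lemma mmNr X Z : Z *m (- X) = - (Z *m X).
Proof. exact: mulmxN. Qed.
Lemma mmZl s X Z : (s *: X) *m Z = s *: (X *m Z).
Proof. exact/esym/scalemxAl. Qed.
Lemma mmZr s X Z : Z *m (s *: X) = s *: (Z *m X).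
Proof. exact/esym/scalemxAr. Qed.
Lemma mm1l Z : 1%:M *m Z = Z.
Proof. exact: mul1mx. Qed.
Lemma mm1r Z : Z *m 1%:M = Z.
Proof. exact: mulmx1. Qed.
Lemma mmA X Y Z : X *m (Y *m Z) = X *m Y *m Z.
Proof. exact: mulmxA. Qed.
Lemma mm0l Z : 0 *m Z = 0 :> 'M[S]_3.
Proof. exact: mul0mx. Qed.
Lemma mm0r Z : Z *m 0 = 0 :> 'M[S]_3.
Proof. exact: mulmx0. Qed.
Definition mmE := (mmDl, mmDr, mmNl, mmNr, mmZl, mmZr, mm1l, mm1r, mm0l, mm0r).

Lemma trD X Y : \tr (X + Y) = \tr X + \tr Y.
Proof. exact: mxtraceD. Qed.
Lemma trN X : \tr (- X) = - \tr X.
Proof. exact: raddfN. Qed.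
Lemma trZ s X : \tr (s *: X) = s * \tr X.
Proof. exact: mxtraceZ. Qed.
Lemma tr0 : \tr (0 : 'M[S]_3) = 0.
Proof. exact: mxtrace0. Qed.
Lemma trC X Y : \tr (X *m Y) = \tr (Y *m X).
Proof. exact: mxtrace_mulC. Qed.
Lemma trsum (F : 'I_3 -> 'M[S]_3) : \tr (\sum_i F i) = \sum_i \tr (F i).
Proof. exact: raddf_sum. Qed.
Lemma mmsuml (F : 'I_3 -> 'M[S]_3) X : (\sum_i F i) *m X = \sum_i F i *m X.
Proof. exact: mulmx_suml. Qed.
Lemma mmsumr (F : 'I_3 -> 'M[S]_3) X : X *m (\sum_i F i) = \sum_i X *m F i.
Proof. exact: mulmx_sumr. Qed.
Definition trE := (trD, trN, trZ, tr0, trsum).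
End MatrixLaws.

Section Model.
Variables (R : realType) (S : numFieldType) (io : {rmorphism R -> S}).
Variable p : 'I_3 -> 'M[S]_3.

(* (X, x) stands for X + \sum_i x_i e_i. *)
Definition mdl : Type := ('M[S]_3 * 'rV[S]_3)%type.
HB.instance Definition _ := GRing.Lmodule.on mdl.

Definition wsum (x y : 'rV[S]_3) : 'M[S]_3 := \sum_i (x 0 i * y 0 i) *: p i.

Lemma wsumC x y : wsum x y = wsum y x.
Proof. by apply: eq_bigr => i _; rewrite mulrC. Qed.

Lemma wsumL (s : S) (x y z : 'rV[S]_3) :
  wsum (s *: x + y) z = s *: wsum x z + wsum y z.
Proof.
rewrite /wsum scaler_sumr -big_split; apply: eq_bigr => i _ /=.
by rewrite !mxE mulrDl scalerDl scalerA mulrA.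
Qed.

(** The Jordan product of matrices, extended by X ∙ e_i = tr(X p_i) e_i, e_i ∙ e_i = p_i and e_i ∙
    e_j = 0. The field S is complex for the inequality and real for its failure. *)
Definition mdlmul (u v : mdl) : mdl :=
  (2^-1 *: (u.1 *m v.1 + v.1 *m u.1) + wsum u.2 v.2,
   \row_i (\tr (u.1 *m p i) * v.2 0 i + \tr (v.1 *m p i) * u.2 0 i)).

(** The factor 2 gives <P_i, P_i> = 2, hence <a, a> = 1 for the axes (P_i + e_i) / 2 and (P_i - e_i)
    / 2. *)
Definition mdlform (u v : mdl) : S :=
  2 * (\tr (u.1 *m v.1) + \sum_i u.2 0 i * v.2 0 i).

Fact mdlmulC u v : mdlmul u v = mdlmul v u.
Proof.
congr (_ *: _ + _, _); [exact: addrC | exact: wsumC |].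
by apply/rowP => i; rewrite !mxE addrC.
Qed.

Fact mdlmul_linear (s : S) (u v w : mdl) :
  mdlmul (s *: u + v) w = s *: mdlmul u w + mdlmul v w.
Proof.
congr (_, _) => /=.
  by rewrite wsumL !mmE; mxlin.
by apply/rowP => i; rewrite !mxE !mmE !trE; ring.
Qed.

Fact mdlform_linearl (s : S) (u v w : mdl) :
  mdlform (s *: u + v) w = s * mdlform u w + mdlform v w.
Proof.
rewrite /mdlform /= !mmE !trE.
rewrite (eq_bigr (fun i => s * (u.2 0 i * w.2 0 i) + v.2 0 i * w.2 0 i)).
  by rewrite big_split /= -mulr_sumr; ring.
by move=> i _; rewrite !mxE; ring.
Qed.

Fact mdlformC u v : mdlform u v = mdlform v u.
Proof.
rewrite /mdlform mxtrace_mulC; congr (_ * (_ + _)).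
by apply: eq_bigr => i _; rewrite mulrC.
Qed.

Fact mdlform_linearr (s : S) (u v w : mdl) :
  mdlform w (s *: u + v) = s * mdlform w u + mdlform w v.
Proof. by rewrite mdlformC mdlform_linearl !(mdlformC w). Qed.

Definition mdlAlg : formAlg R := FormAlg (coef := S) (car := mdl) io mdlmulC mdlmul_linear
  mdlform_linearl mdlform_linearr.

Lemma mdlform_assoc (u v w : car mdlAlg) : ⟨u, v ∙ w⟩ = ⟨u ∙ v, w⟩.
Proof.
rewrite /= /mdlform /=; congr (_ * _).
rewrite !mmE /wsum mmsuml mmsumr !trE.
rewrite (eq_bigr (fun i => v.2 0 i * w.2 0 i * \tr (u.1 *m p i))); last first.
  by move=> i _; rewrite mmZr trZ.
rewrite [X in _ = _ + X + _](eq_bigr (fun i => u.2 0 i * v.2 0 i * \tr (w.1 *m p i)));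
  last by move=> i _; rewrite mmZl trZ trC.
have -> : \tr (u.1 *m (w.1 *m v.1)) = \tr (v.1 *m u.1 *m w.1).
  by rewrite [RHS]trC [in RHS]mmA [RHS]trC.
rewrite mmA -!addrA; congr (_ + _); rewrite -!big_split /=.
by apply: eq_bigr => i _; rewrite !mxE; ring.
Qed.

Hypotheses (p_sandwich : forall i X, p i *m X *m p i = \tr (X *m p i) *: p i)
  (tr_p : forall i, \tr (p i) = 1)
  (tr_pp : forall i j, i != j -> \tr (p i *m p j) = 16^-1).

Definition mdlP i : car mdlAlg := (p i, 0).
Definition mdlE i : car mdlAlg := (0, delta_mx 0 i).
Definition mdlgen i (b : bool) : car mdlAlg :=
  (2^-1 *: p i, (if b then 2^-1 else - 2^-1) *: delta_mx 0 i).

Lemma p_idem i : p i *m p i = p i.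
Proof.
have := p_sandwich i 1%:M; rewrite mmE => ->.
by rewrite mm1l tr_p scale1r.
Qed.

Lemma ioV n : io n%:R^-1 = n%:R^-1.
Proof. by rewrite fmorphV rmorph_nat. Qed.

Lemma ioZ r (u : car mdlAlg) : r %*: u = (io r *: u.1, io r *: u.2).
Proof. by []. Qed.

Lemma pair_eta (u : car mdlAlg) : u = (u.1, u.2).
Proof. by case: u. Qed.

Lemma wsum0l y : wsum 0 y = 0.
Proof. by rewrite /wsum big1 // => i _; rewrite mxE mul0r scale0r. Qed.
Lemma wsum0r y : wsum y 0 = 0.
Proof. by rewrite wsumC wsum0l. Qed.

Lemma mulXX X Y : ((X, 0) : car mdlAlg) ∙ ((Y, 0) : car mdlAlg) =
  (2^-1 *: (X *m Y + Y *m X), 0).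
Proof.
congr (_, _); rewrite /= ?wsum0l ?addr0 //.
by apply/rowP => i; rewrite !mxE !mulr0 addr0.
Qed.

Lemma mulXe X y : ((X, 0) : car mdlAlg) ∙ ((0, y) : car mdlAlg) =
  (0, \row_i (\tr (X *m p i) * y 0 i)).
Proof.
congr (_, _); rewrite /= ?wsum0l ?mmE ?addr0 ?scaler0 //.
by apply/rowP => i; rewrite !mxE mulr0 addr0.
Qed.

Lemma mulee x y : ((0, x) : car mdlAlg) ∙ ((0, y) : car mdlAlg) =
  (wsum x y, 0).
Proof.
congr (_, _); rewrite /= ?mmE ?addr0 ?scaler0 ?add0r //.
by apply/rowP => i; rewrite !mxE !mm0l tr0 !mul0r addr0.
Qed.

Lemma trP_mdl i (u : car mdlAlg) : trP mdlP i u = \tr (u.1 *m p i).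
Proof.
rewrite /trP /cscale /= /mdlform /= ioV mulrA mulVf ?pnatr_eq0 // mul1r.
by rewrite big1 ?addr0 // => j _; rewrite mxE mulr0.
Qed.

Lemma algP_mdl u : algP mdlP u -> u.2 = 0.
Proof.
move=> /(_ [set u : car mdlAlg | u.2 = 0]); apply; split.
  split; first split=> //=.
    by move=> s v w /= -> ->; rewrite scaler0 addr0.
  move=> v w /= v2 w2; apply/rowP => i.
  by rewrite !mxE v2 w2 !mxE !mulr0 addr0.
by move=> _ [i _ <-].
Qed.

Definition refl_mx i : 'M[S]_3 := 1%:M - 2 *: p i.

Lemma reflP_mdl i X : reflP mdlP i (X, 0) = (refl_mx i *m X *m refl_mx i, 0).
Proof.
rewrite /reflP trP_mdl mulXX !ioZ; congr (_, _) => /=; last first.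
  by rewrite !scaler0 oppr0 !addr0.
rewrite rmorph_nat /refl_mx !mmE p_sandwich; mxlin.
Qed.

Lemma refl_mxK i : refl_mx i *m refl_mx i = 1%:M.
Proof. by rewrite /refl_mx !mmE p_idem; mxlin. Qed.

(** Elements of [algP] have second component 0, so the clauses about them are matrix identities that
    follow from p_i X p_i = tr(X p_i) p_i. The last one says that conjugation by the involution 1 -
    2 p_i is multiplicative. *)
Lemma half_axial_mdl : half_axial mdlP mdlE.
Proof.
split.
- exact: mdlformC.
- exact: mdlform_assoc.
- by move=> i; rewrite [LHS]mulXX p_idem; congr (_, _); mxlin.
- move=> i; rewrite [LHS]mulee; congr (_, _).
  rewrite /wsum (bigD1 i) //= big1 => [|j ji].
    by rewrite !mxE !eqxx mulr1 scale1r addr0.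
  by rewrite !mxE (negbTE ji) andbF mul0r scale0r.
- move=> i j ij; rewrite [LHS]mulee; congr (_, _).
  rewrite /wsum big1 // => k _; rewrite !mxE /=.
  have [->|ki] := eqVneq k i; last by rewrite mul0r scale0r.
  by rewrite (negbTE ij) mulr0 scale0r.
- move=> i; rewrite /= /mdlform /= p_idem tr_p rmorph_nat big1 ?addr0 ?mulr1 //.
  by move=> j _; rewrite !mxE mul0r.
- move=> i j ij; rewrite /= /mdlform /= tr_pp // ioV big1 => [|k _].
    by field.
  by rewrite !mxE mul0r.
- move=> i x /algP_mdl x2; rewrite [x]pair_eta x2 [LHS]mulXe trP_mdl /=.
  congr (_, _); first by rewrite scaler0.
  apply/rowP => j; rewrite !mxE /=.
  by have [->|ji] := eqVneq j i; rewrite ?mulr0.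
- move=> i x /algP_mdl x2; rewrite /= /mdlform x2 /= mm0r tr0 big1 ?addr0 ?mulr0 //.
  by move=> j _; rewrite mxE mul0r.
- move=> i x /algP_mdl x2; rewrite [x]pair_eta x2 trP_mdl !mulXX /= ioZ.
  congr (_, _) => /=; last by rewrite !scaler0 !addr0 scaler0.
  rewrite ioV !mmE !mmA p_idem -!mmA p_idem !mmA p_sandwich; mxlin.
move=> i x y /algP_mdl x2 /algP_mdl y2.
rewrite [x]pair_eta [y]pair_eta x2 y2 !mulXX !reflP_mdl mulXX.
congr (_, _).
have E X Y : refl_mx i *m X *m refl_mx i *m (refl_mx i *m Y *m refl_mx i) =
    refl_mx i *m (X *m Y) *m refl_mx i.
  by rewrite -!mmA [refl_mx i *m (refl_mx i *m _)]mmA refl_mxK mm1l.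
by rewrite !E -mmDl -mmDr -mmZl -mmZr.
Qed.

Lemma axisP_mdl : axisP mdlgen = mdlP.
Proof.
apply: funext => i; rewrite axisPE; congr (_, _) => /=; first by mxlin.
by rewrite -scalerDl addrN scale0r.
Qed.

Lemma axisE_mdl : axisE mdlgen = mdlE.
Proof.
apply: funext => i; rewrite axisEE; congr (_, _) => /=; first by mxlin.
by rewrite -scaleNr -scalerDl opprK -[RHS]scale1r; congr (_ *: _); field.
Qed.

End Model.

Lemma sum3E (S : nmodType) (F : 'I_3 -> S) :
  \sum_i F i = F ord0 + F (@Ordinal 3 1 isT) + F (@Ordinal 3 2 isT).
Proof.
rewrite !big_ord_recr big_ord0 /= add0r.
by congr (F _ + F _ + F _); apply: val_inj.
Qed.

(** * Norton's inequality for Hermitian matrices *)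

Section NortonModel.
Variables (R : realType) (S : numFieldType) (io : {rmorphism R -> S}).
Variable p : 'I_3 -> 'M[S]_3.
Hypotheses (tr_p : forall i, \tr (p i) = 1)
  (tr_pp : forall i j, i != j -> \tr (p i *m p j) = 16^-1)
  (p_idem : forall i, p i *m p i = p i).
Local Notation V := (car (mdlAlg io p)).
Local Notation wsum := (wsum p).

Lemma tr_mul_wsum X x y :
  \tr (X *m wsum x y) = \sum_i x 0 i * y 0 i * \tr (X *m p i).
Proof.
by rewrite mmsumr trsum; apply: eq_bigr => i _; rewrite mmZr trZ.
Qed.

Lemma tr_wsum_p x y i : \tr (wsum x y *m p i) =
  16^-1 * \sum_j x 0 j * y 0 j + 15 / 16 * (x 0 i * y 0 i).
Proof.
rewrite trC tr_mul_wsum (bigD1 i) //= [in RHS](bigD1 i) //=.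
rewrite p_idem tr_p mulrDr mulr_sumr.
rewrite (eq_bigr (fun j => 16^-1 * (x 0 j * y 0 j))) => [|j ji]; first by field.
by rewrite tr_pp 1?eq_sym // mulrC.
Qed.

Definition wnorton (u v : V) i : 'M[S]_3 := v.2 0 i *: u.1 - u.2 0 i *: v.1.

Lemma norton_mdl (u v : V) :
  ⟨u ∙ u, v ∙ v⟩ - ⟨u ∙ v, u ∙ v⟩ =
  \tr (u.1 *m u.1 *m v.1 *m v.1) - \tr (u.1 *m v.1 *m u.1 *m v.1) +
  2 * \sum_i (\tr (wnorton u v i *m wnorton u v i *m p i)
              - \tr (wnorton u v i *m p i) ^+ 2) +
  16^-1 * \sum_i \sum_j (u.2 0 i * v.2 0 j - u.2 0 j * v.2 0 i) ^+ 2.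
Proof.
case: u v => [X x] [Y y]; rewrite /= /mdlform /=.
have -> : 2^-1 *: (X *m X + X *m X) = X *m X by mxlin.
have -> : 2^-1 *: (Y *m Y + Y *m Y) = Y *m Y by mxlin.
have trW a b (M : 'M[S]_3) : \tr (wsum a b *m M) = \tr (M *m wsum a b) by exact: trC.
rewrite !mmE !trE ![\tr (wsum _ _ *m (_ *m _))]trW.
have wE i : \tr (wnorton (X, x) (Y, y) i *m wnorton (X, x) (Y, y) i *m p i)
    - \tr (wnorton (X, x) (Y, y) i *m p i) ^+ 2 =
    y 0 i ^+ 2 * \tr (X *m X *m p i) + x 0 i ^+ 2 * \tr (Y *m Y *m p i)
    - x 0 i * y 0 i * (\tr (X *m Y *m p i) + \tr (Y *m X *m p i))
    - (y 0 i * \tr (X *m p i) - x 0 i * \tr (Y *m p i)) ^+ 2.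
  by rewrite /wnorton /= !mmE !trE; ring.
rewrite (eq_bigr _ (fun i _ => wE i)) !tr_mul_wsum {wE}.
(* Cyclic invariance leaves two traces of degree four, tr(XXYY) and tr(XYXY). *)
have -> : \tr (Y *m X *m (Y *m X)) = \tr (X *m Y *m X *m Y).
  by rewrite -mmA trC !mmA.
have -> : \tr (X *m Y *m (X *m Y)) = \tr (X *m Y *m X *m Y) by rewrite mmA.
have -> : \tr (X *m X *m (Y *m Y)) = \tr (X *m X *m Y *m Y) by rewrite mmA.
have -> : \tr (X *m Y *m (Y *m X)) = \tr (X *m X *m Y *m Y).
  by rewrite mmA trC !mmA.
have -> : \tr (Y *m X *m (X *m Y)) = \tr (X *m X *m Y *m Y).
  by rewrite trC -[RHS]trC !mmA [RHS]trC !mmA [RHS]trC !mmA.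
rewrite !sum3E !tr_wsum_p !sum3E !mxE.
by field.
Qed.
End NortonModel.

(** * Rank one matrices and their Gram matrix *)

Section RankOne.
Variables (S : numFieldType) (x : 'I_3 -> 'cV[S]_3) (y : 'I_3 -> 'rV[S]_3).

(** The trace of a product of the matrices x_i y_i is a cyclic product of these entries, so that all
    trace conditions become conditions on [gram]. *)
Definition gram i j : S := (y i *m x j) 0 0.
Definition rk1 i : 'M[S]_3 := x i *m y i.

Lemma tr_rk1 X i : \tr (X *m rk1 i) = (y i *m X *m x i) 0 0.
Proof. by rewrite /rk1 mulmxA mxtrace_mulC mulmxA trace_mx11. Qed.

Lemma rk1_sandwich i X : rk1 i *m X *m rk1 i = \tr (X *m rk1 i) *: rk1 i.
Proof.
rewrite tr_rk1 /rk1 !mulmxA -[x i *m y i *m X]mulmxA -[x i *m _ *m x i]mulmxA.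
by rewrite {1}[y i *m X *m x i]mx11_scalar mul_mx_scalar -scalemxAl.
Qed.

Lemma rk1_mul i j : rk1 i *m rk1 j = gram i j *: (x i *m y j).
Proof.
rewrite /rk1 mulmxA -[x i *m y i *m x j]mulmxA [y i *m x j]mx11_scalar.
by rewrite mul_mx_scalar -scalemxAl.
Qed.

Lemma tr_xy i j : \tr (x i *m y j) = gram j i.
Proof. by rewrite mxtrace_mulC trace_mx11. Qed.

Lemma tr_rk1_1 i : \tr (rk1 i) = gram i i.
Proof. exact: tr_xy. Qed.

Lemma tr_rk1_2 i j : \tr (rk1 i *m rk1 j) = gram i j * gram j i.
Proof. by rewrite rk1_mul linearZ /= tr_xy. Qed.

Lemma tr_rk1_3 i j k :
  \tr (rk1 i *m rk1 j *m rk1 k) = gram i j * gram j k * gram k i.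
Proof.
rewrite rk1_mul -scalemxAl linearZ /= /rk1 mulmxA -[x i *m y j *m x k]mulmxA.
rewrite [y j *m x k]mx11_scalar mul_mx_scalar -scalemxAl linearZ /= tr_xy.
by rewrite mulrA.
Qed.

End RankOne.

Section Hermitian.
Variables (R : realType) (C : numClosedFieldType) (io : {rmorphism R -> C}).
Variable p : 'I_3 -> 'M[C]_3.
Hypotheses (tr_p : forall i, \tr (p i) = 1)
  (tr_pp : forall i j, i != j -> \tr (p i *m p j) = 16^-1)
  (p_idem : forall i, p i *m p i = p i).
Hypothesis io_real : forall r, (io r)^* = io r.
Local Notation V := (car (mdlAlg io p)).

Definition adjmx m n (X : 'M[C]_(m, n)) : 'M[C]_(n, m) := map_mx Num.conj X^T.

Lemma adjmxM m n l (X : 'M[C]_(m, n)) (Y : 'M[C]_(n, l)) :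
  adjmx (X *m Y) = adjmx Y *m adjmx X.
Proof. by rewrite /adjmx trmx_mul map_mxM. Qed.
Lemma adjmxD m n (X Y : 'M[C]_(m, n)) : adjmx (X + Y) = adjmx X + adjmx Y.
Proof. by rewrite /adjmx linearD map_mxD. Qed.
Lemma adjmxN m n (X : 'M[C]_(m, n)) : adjmx (- X) = - adjmx X.
Proof. by rewrite /adjmx linearN map_mxN. Qed.
Lemma adjmxZ m n s (X : 'M[C]_(m, n)) : adjmx (s *: X) = s^* *: adjmx X.
Proof. by rewrite /adjmx linearZ map_mxZ. Qed.
Lemma adjmx0 m n : adjmx 0 = 0 :> 'M[C]_(m, n).
Proof. by rewrite /adjmx linear0 map_mx0. Qed.
Lemma tr_adjmx n (X : 'M[C]_n) : \tr (adjmx X) = (\tr X)^*.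
Proof. by rewrite /mxtrace rmorph_sum; apply: eq_bigr => i _; rewrite !mxE. Qed.

Lemma tr_mul_adj_ge0 (X : 'M[C]_3) : 0 <= \tr (X *m adjmx X).
Proof.
rewrite /mxtrace sumr_ge0 // => i _; rewrite !mxE sumr_ge0 // => j _.
by rewrite !mxE mul_conjC_ge0.
Qed.

Hypothesis p_herm : forall i, adjmx (p i) = p i.

Definition herm (u : V) :=
  adjmx u.1 = u.1 /\ forall i, (u.2 0 i)^* = u.2 0 i.

Lemma norton_herm (u v : V) : herm u -> herm v ->
  0 <= ⟨u ∙ u, v ∙ v⟩ - ⟨u ∙ v, u ∙ v⟩.
Proof.
move=> [hu1 hu2] [hv1 hv2]; rewrite norton_mdl //.
apply: addr_ge0; first apply: addr_ge0.
(* The commutator of two Hermitian matrices is skew-Hermitian, so -tr(K K) is the squared Frobenius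
   norm of K. *)
- set K := u.1 *m v.1 - v.1 *m u.1.
  have -> : \tr (u.1 *m u.1 *m v.1 *m v.1) - \tr (u.1 *m v.1 *m u.1 *m v.1) =
      2^-1 * \tr (K *m adjmx K).
    rewrite /K adjmxD adjmxN !adjmxM hu1 hv1 !mmE !trE.
    have -> : \tr (u.1 *m v.1 *m (v.1 *m u.1)) = \tr (u.1 *m u.1 *m v.1 *m v.1).
      by rewrite mmA trC !mmA.
    have -> : \tr (v.1 *m u.1 *m (u.1 *m v.1)) = \tr (u.1 *m u.1 *m v.1 *m v.1).
      by rewrite trC -[RHS]trC !mmA [RHS]trC !mmA [RHS]trC !mmA.
    have -> : \tr (v.1 *m u.1 *m (v.1 *m u.1)) = \tr (u.1 *m v.1 *m u.1 *m v.1).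
      by rewrite -mmA trC !mmA.
    by rewrite [u.1 *m v.1 *m (u.1 *m v.1)]mmA; field.
  by rewrite mulr_ge0 ?invr_ge0 ?ler0n // tr_mul_adj_ge0.
- rewrite mulr_ge0 ?ler0n // sumr_ge0 // => i _.
  (* A Cauchy-Schwarz inequality: with c = tr(w p_i), the difference is the squared Frobenius norm
     of w p_i - c p_i. *)
  have key w : adjmx w = w -> 0 <= \tr (w *m w *m p i) - \tr (w *m p i) ^+ 2.
    move=> hw; set c := \tr (w *m p i).
    have hc : c^* = c by rewrite /c -tr_adjmx adjmxM hw p_herm trC.
    have -> : \tr (w *m w *m p i) - c ^+ 2 =
        \tr ((w *m p i - c *: p i) *m adjmx (w *m p i - c *: p i)).
      rewrite adjmxD adjmxN adjmxZ adjmxM hw p_herm hc !mmE !trE.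
      have -> : \tr (w *m p i *m (p i *m w)) = \tr (w *m w *m p i).
        by rewrite -(mmA w) (mmA (p i)) p_idem mmA trC mmA.
      have -> : \tr (w *m p i *m p i) = c by rewrite -mmA p_idem.
      have -> : \tr (p i *m (p i *m w)) = c by rewrite mmA p_idem trC.
      by rewrite p_idem tr_p; ring.
    exact: tr_mul_adj_ge0.
  apply: key.
  by rewrite /wnorton adjmxD adjmxN !adjmxZ hu1 hv1 hu2 hv2.
rewrite mulr_ge0 ?invr_ge0 ?ler0n // sumr_ge0 // => i _.
rewrite sumr_ge0 // => j _; set z := _ - _.
have -> : z ^+ 2 = z * z^*.
  by rewrite expr2 /z rmorphB !rmorphM /= !hu2 !hv2.
exact: mul_conjC_ge0.
Qed.

Lemma herm_L r (u v : V) : herm u -> herm v -> herm (r %*: u + v).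
Proof.
move=> [hu1 hu2] [hv1 hv2]; split=> [|i] /=.
  by rewrite adjmxD adjmxZ io_real hu1 hv1.
by rewrite !mxE rmorphD rmorphM /= io_real hu2 hv2.
Qed.

Lemma herm_mulP i (u : V) : herm u -> u.2 = 0 -> herm (mdlP io p i ∙ u).
Proof.
move=> [hu1 hu2] u2; rewrite [u]pair_eta u2 [_ ∙ _]mulXX; split=> [|j] /=.
  rewrite adjmxZ adjmxD !adjmxM hu1 p_herm addrC.
  by congr (_ *: _); rewrite -[2]/(2%:R) fmorphV rmorph_nat.
by rewrite mxE rmorph0.
Qed.

End Hermitian.

Section CorrHerm.
Variables (R : realType) (C : numClosedFieldType) (io : {rmorphism R -> C}).
Variable p : 'I_3 -> 'M[C]_3.
Hypotheses (io_real : forall r, (io r)^* = io r)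
  (p_herm : forall i, adjmx (p i) = p i).
Variables (A : formAlg R) (P e : 'I_3 -> car A).

(** The relation is generated by real combinations and Jordan products of the Hermitian p_i, so M(t)
    is compared with Hermitian elements of the complex model only. *)
Lemma corrP_herm u u' : corrP P (mdlP io p) u u' -> herm u' /\ u'.2 = 0.
Proof.
have hP i : herm (mdlP io p i).
  by split=> [|j] /=; [exact: p_herm | rewrite mxE rmorph0].
have hM i (v : car (mdlAlg io p)) : herm v /\ v.2 = 0 ->
    herm (mdlP io p i ∙ v) /\ (mdlP io p i ∙ v).2 = 0.
  move=> [hv v2]; split; first exact: herm_mulP.
  by rewrite [v]pair_eta v2 [_ ∙ _]mulXX.
elim=> [i|i j _|i j k _ _ _|r x x' y y' _ [hx x2] _ [hy y2]].
- by [].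
- exact: hM.
- by apply: (hM); apply: hM.
by split; [apply: herm_L | rewrite /= x2 y2 scaler0 addr0].
Qed.

Lemma corr_herm u u' : corr P e (mdlP io p) (mdlE io p) u u' -> herm u'.
Proof.
elim=> [x x' /corrP_herm[]//|i|r x x' y y' _ hx _ hy]; last exact: herm_L.
split=> [|j] /=; first exact: adjmx0.
by rewrite !mxE rmorph_nat.
Qed.

End CorrHerm.

(* The two cyclic products of off-diagonal entries are w / 64 and w' / 64, so
   that q = (w + w') / 128 is tr(p_1 p_2 p_3 + p_3 p_2 p_1) / 2. *)
Definition frame_gram (S : numFieldType) (w w' : S) (i j : 'I_3) : S := nth 0
  (nth [::] [:: [:: 1; 4^-1; 4^-1]; [:: 4^-1; 1; w / 4];
                [:: 4^-1; w' / 4; 1]] i) j.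

Section Frame.
Variables (S : numFieldType) (s w w' z c : S).

(* A triangular factorisation of [frame_gram], with s = sqrt 15. *)
Definition frame_x (i : 'I_3) : 'cV[S]_3 := \col_k nth 0
  (nth [::] [:: [:: 1; 0; 0]; [:: 4^-1; s / 4; 0];
                [:: 4^-1; (4 * w - 1) * s / 60; z]] i) k.
Definition frame_y (i : 'I_3) : 'rV[S]_3 := \row_k nth 0
  (nth [::] [:: [:: 1; 0; 0]; [:: 4^-1; s / 4; 0];
                [:: 4^-1; (4 * w' - 1) * s / 60; z]] i) k.

Hypotheses (s2 : s ^+ 2 = 15) (ww' : w * w' = 1) (wc : w + w' = 2 * c)
  (z2 : z ^+ 2 = (26 + c) / 30).

Lemma gram_frame i j : gram frame_x frame_y i j = frame_gram w w' i j.
Proof.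
have c_w : c = (w + w') / 2 by rewrite wc; field.
rewrite /gram mxE sum3E !mxE /frame_gram.
case: i j => [[|[|[|//]]] ?] [[|[|[|//]]] ?] /=.
- by ring.
- by field.
- by field.
- by field.
- by field: s2.
- by field: s2.
- by field.
- by field: s2.
(* The entry (3,3) determines z: it is 1/16 + (17 - 8 c) / 240 + z^2 and has to be 1. *)
have -> : 4^-1 / 4 + (4 * w' - 1) * s / 60 * ((4 * w - 1) * s / 60) + z * z =
    16^-1 + s ^+ 2 * (16 * (w * w') - 4 * (w + w') + 1) / 3600 + z ^+ 2.
  by field.
by rewrite s2 ww' wc z2; field.
Qed.

End Frame.

Section FrameModel.
Variables (S : numFieldType) (w w' c : S).
Hypotheses (ww' : w * w' = 1) (wc : w + w' = 2 * c).
Variables (x : 'I_3 -> 'cV[S]_3) (y : 'I_3 -> 'rV[S]_3).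
Hypothesis xy_gram : forall i j, gram x y i j = frame_gram w w' i j.
Local Notation p := (rk1 x y).

Lemma frame_tr i : \tr (p i) = 1.
Proof.
rewrite tr_rk1_1 xy_gram /frame_gram.
by case: i => [[|[|[|//]]] ?].
Qed.

Lemma frame_tr2 i j : i != j -> \tr (p i *m p j) = 16^-1.
Proof.
rewrite tr_rk1_2 !xy_gram /frame_gram.
case: i j => [[|[|[|//]]] ?] [[|[|[|//]]] ?] //= _; try by field.
  by field: ww'.
by field: ww'.
Qed.

Lemma half_axial_frame (R : realType) (io : {rmorphism R -> S}) :
  half_axial (mdlP io p) (mdlE io p).
Proof. exact: half_axial_mdl (@rk1_sandwich _ _ _) frame_tr frame_tr2. Qed.

Lemma frame_tr3 (R : realType) (io : {rmorphism R -> S}) (q : R) i j k :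
  64 * io q = c -> i != j -> i != k -> j != k ->
  trP (mdlP io p) i (mdlP io p j ∙ mdlP io p k) = cscale q 1.
Proof.
move=> qc; have hA := half_axial_frame io.
pose i2 : 'I_3 := @Ordinal 3 1 isT; pose i3 : 'I_3 := @Ordinal 3 2 isT.
apply: (trP_perm (i1 := ord0) (i2 := i2) (i3 := i3) hA) => //.
rewrite trP_mdl mulXX /cscale /= mulr1 !mmE !trE !tr_rk1_3 !xy_gram.
rewrite /frame_gram /=.
have -> : io q = c / 64 by rewrite -qc; field.
have -> : c = (w + w') / 2 by rewrite wc; field.
by field.
Qed.

End FrameModel.

(** Under these conditions y_i is the adjoint of x_i, so x_i y_i is Hermitian. *)
Lemma frame_herm (C : numClosedFieldType) (s w w' z : C) i :
  s^* = s -> w^* = w' -> z^* = z ->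
  adjmx (rk1 (frame_x s w z) (frame_y s w' z) i) =
  rk1 (frame_x s w z) (frame_y s w' z) i.
Proof.
move=> hs hw hz; have hw' : w'^* = w by rewrite -hw conjCK.
have adj_x : adjmx (frame_x s w z i) = frame_y s w' z i.
  apply/rowP => k; rewrite !mxE.
  case: i k => [[|[|[|//]]] ?] [[|[|[|//]]] ?] /=;
    by rewrite ?(rmorph0, rmorph1) ?(rmorphM, rmorphB) /= ?(rmorphM, rmorph1)
      ?fmorphV ?hs ?hw ?hz ?rmorph_nat.
have adj_y : adjmx (frame_y s w' z i) = frame_x s w z i.
  apply/colP => k; rewrite !mxE.
  case: i k {adj_x} => [[|[|[|//]]] ?] [[|[|[|//]]] ?] /=;
    by rewrite ?(rmorph0, rmorph1) ?(rmorphM, rmorphB) /= ?(rmorphM, rmorph1)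
      ?fmorphV ?hs ?hw' ?hz ?rmorph_nat.
by rewrite /rk1 adjmxM adj_x adj_y.
Qed.

(** * The inequality for t in the range *)

Section Forward.
Variables (R : realType) (t : R).
Local Open Scope complex_scope.

Lemma norton_of_range : 0 <= t <= 6^-1 -> norton (Mt t).
Proof.
(* Here c = 1 - 12 t, and 0 <= t <= 1/6 means |c| <= 1. Then w = c + i sqrt(1 - c^2) lies on the
   unit circle, and its conjugate w' is also its inverse. *)
move=> /andP[t0 t6]; pose q : R := 64^-1 - 3 / 16 * t; pose c := 64 * q.
have c1 : c ^+ 2 <= 1.
  rewrite -subr_ge0; have -> : 1 - c ^+ 2 = (1 - c) * (1 + c) by ring.
  by apply: mulr_ge0; rewrite /c /q; lra.
pose si := Num.sqrt (1 - c ^+ 2); have si2 : si ^+ 2 = 1 - c ^+ 2.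
  by rewrite sqr_sqrtr // subr_ge0.
pose s15 : R := Num.sqrt 15; have s15_2 : s15 ^+ 2 = 15 by rewrite sqr_sqrtr.
pose zr : R := Num.sqrt ((26 + c) / 30).
have zr2 : zr ^+ 2 = (26 + c) / 30.
  by rewrite sqr_sqrtr // divr_ge0 //; rewrite /c /q; lra.
pose io : {rmorphism R -> R[i]} := real_complex R.
pose w := c +i* si; pose w' := c -i* si.
pose p := rk1 (frame_x s15%:C w zr%:C) (frame_y s15%:C w' zr%:C).
have s2C : s15%:C ^+ 2 = 15 by rewrite -rmorphXn s15_2 rmorph_nat.
have wwC : w * w' = 1.
  rewrite /w /w'.
  by simpc; rewrite -!expr2 si2 [c * si]mulrC addNr addrC subrK.
have wcC : w + w' = 2 * c%:C.
  rewrite /w /w'.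
  by simpc; rewrite mulrDl mul1r.
have z2C : zr%:C ^+ 2 = (26 + c%:C) / 30.
  rewrite -rmorphXn zr2 rmorphM rmorphD /= fmorphV !rmorph_nat //.
have hg := gram_frame s2C wwC wcC z2C.
have hB : half_axial (mdlP io p) (mdlE io p) := half_axial_frame wwC hg io.
have trqB i j k : i != j -> i != k -> j != k ->
    trP (mdlP io p) i (mdlP io p j ∙ mdlP io p k) = cscale q 1.
  by apply: (frame_tr3 wwC wcC hg); rewrite /c rmorphM rmorph_nat.
apply: (norton_corr (@toMt_surjI R t) (half_axial_Mt t) hB (tr_Mt t) trqB).
  exact: fmorph_inj.
have io_real r : (io r)^*%R = io r by rewrite /io /=; apply/conj_Creal/complex_realP; exists r.
have p_herm i : adjmx (p i) = p i.
  by apply: frame_herm; [exact: (io_real s15) | by [] | exact: (io_real zr)].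
move=> u v u' v' uu vv.
have N0 := norton_herm (frame_tr hg) (frame_tr2 wwC hg)
  (p_idem (@rk1_sandwich _ _ _) (frame_tr hg)) p_herm
  (corr_herm io_real p_herm uu) (corr_herm io_real p_herm vv).
set N := (X in real_nonneg X).
have {}N0 : 0 <= N by exact: N0.
(* A complex number that is nonnegative in the order of R[i] equals its real part. *)
exists (complex.Re N); last by rewrite [RHS]RRe_real // ger0_real.
by move: N0; rewrite lecE => /andP[].
Qed.
End Forward.

(** * Evaluation of the universal algebra *)

Section MonomialEvaluation.
Variables (I : choiceType) (S : comNzRingType) (v : I -> S).

Definition cmeval (m : {cmonom I}) : S := \prod_(k <- finsupp m) v k ^+ m k.

Lemma cmevalE (m : {cmonom I}) (d : {fset I}) :
  (finsupp m `<=` d)%fset -> cmeval m = \prod_(k <- d) v k ^+ m k.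
Proof.
move=> md; rewrite /cmeval (big_fset_incl _ md) //= => k _.
by rewrite -cmE_eq0 => /eqP->.
Qed.

Lemma cmeval_morphism : mmorphism cmeval.
Proof.
split=> [m1 m2|]; last by rewrite /cmeval mdom1 big_seq_fset0.
rewrite {1}/cmeval mdomD.
rewrite (cmevalE (fsubsetUl _ (finsupp m2))).
rewrite (cmevalE (fsubsetUr (finsupp m1) _)) -big_split.
by apply: eq_bigr => k _; rewrite cmM exprD.
Qed.
HB.instance Definition _ := isMultiplicative.Build _ _ cmeval cmeval_morphism.

Lemma cmevalU i : cmeval (ucm i) = v i.
Proof. by rewrite /cmeval mdomU big_seq_fset1 cmUU. Qed.

End MonomialEvaluation.

Section MorphismOnBasis.
Variables (R : realType) (H A : formAlg R) (T : Type) (b : T -> car H).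
Variables (fJ : {rmorphism coef H -> coef A}) (f : car H -> car A).
Hypotheses (b_ind : forall Q : car H -> Prop, Q 0 ->
    (forall s m u, Q u -> Q (s *: b m + u)) -> forall u, Q u)
  (f_lin : forall s u v, f (s *: u + v) = fJ s *: f u + f v)
  (f_mul : forall m n, f (b m ∙ b n) = f (b m) ∙ f (b n))
  (f_form : forall m n, fJ ⟨b m, b n⟩ = ⟨f (b m), f (b n)⟩).

Lemma basis_mor0 : f 0 = 0.
Proof.
have := f_lin (- 1) 0 0.
by rewrite scaler0 addr0 rmorphN1 scaleN1r addNr.
Qed.

Lemma basis_mor_mul u v : f (u ∙ v) = f u ∙ f v.
Proof.
elim/b_ind: u => [|s m u IH]; first by rewrite amul0l basis_mor0 amul0l.
rewrite amul_linear !f_lin IH amul_linear; congr (_ *: _ + _).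
elim/b_ind: v {u s IH} => [|s n v IH]; first by rewrite amul0r basis_mor0 amul0r.
rewrite ![b m ∙ _]amulC ![f (b m) ∙ _]amulC amul_linear !f_lin amul_linear.
by rewrite ![_ ∙ b m]amulC ![_ ∙ f (b m)]amulC f_mul IH.
Qed.

Lemma basis_mor_form u v : fJ ⟨u, v⟩ = ⟨f u, f v⟩.
Proof.
elim/b_ind: u => [|s m u IH]; first by rewrite form0l basis_mor0 form0l rmorph0.
rewrite form_linearl f_lin rmorphD rmorphM IH form_linearl.
congr (_ * _ + _).
elim/b_ind: v {u s IH} => [|s n v IH]; first by rewrite form0r basis_mor0 form0r rmorph0.
by rewrite !form_linearr f_lin rmorphD rmorphM IH f_form form_linearr.
Qed.

End MorphismOnBasis.

Section Evaluation.
Variables (R : realType) (S : comNzRingType) (io : {rmorphism R -> S}).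
Variables (W : lmodType S) (mul : W -> W -> W) (frm : W -> W -> S).
Hypotheses (mulC : forall u v, mul u v = mul v u)
  (mulL : forall s u v w, mul (s *: u + v) w = s *: mul u w + mul v w)
  (frmLl : forall s u v w, frm (s *: u + v) w = s * frm u w + frm v w)
  (frmLr : forall s u v w, frm w (s *: u + v) = s * frm w u + frm w v).
Let A : formAlg R := FormAlg (coef := S) (car := W) io mulC mulL frmLl frmLr.
Hypothesis formA : forall u v w : car A, ⟨u, v ∙ w⟩ = ⟨u ∙ v, w⟩.
Variable x : 'I_3 -> bool -> car A.

Fixpoint evtree (s : tree) : car A :=
  match s with
  | Leaf g => x g.1 g.2
  | Node s1 s2 => evtree s1 ∙ evtree s2
  end.

Lemma evtree_comm s1 s2 : tree_comm s1 s2 -> evtree s1 = evtree s2.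
Proof.
elim=> {s1 s2} // [s1 s2 s3 _ -> _ ->|s1 s1' s2 s2' _ /= -> _ ->|s1 s2] //.
exact: amulC.
Qed.

Definition evmag (m : magma) : car A := evtree (repr m).

Lemma evmag_pi s : evmag (\pi_magma s) = evtree s.
Proof.
apply: evtree_comm; apply/asboolP.
by rewrite -/(tree_rel _ _) -eqmodE reprK.
Qed.

Lemma evmag_gen i b : evmag (mgen (i, b)) = x i b.
Proof. exact: evmag_pi. Qed.

Lemma evmag_prod m1 m2 : evmag (mprod m1 m2) = evmag m1 ∙ evmag m2.
Proof. exact: evmag_pi. Qed.

Definition evpair (c : pair_class) : S :=
  let: (m1, m2) := repr c in ⟨evmag m1, evmag m2⟩.

(** The generating step of [pair_sim] is associativity of the form, which holds in A; hence the
    value is independent of the chosen representative. *)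
Lemma evpair_pi m1 m2 : evpair (\pi_pair_class (m1, m2)) = ⟨evmag m1, evmag m2⟩.
Proof.
have sim p1 p2 : pair_sim p1 p2 ->
    ⟨evmag p1.1, evmag p1.2⟩ = ⟨evmag p2.1, evmag p2.2⟩.
  elim=> [m n l|//|q1 q2 _ -> //|q1 q2 q3 _ -> _ -> //].
  by cbn [fst snd]; rewrite !evmag_prod formA.
have : pair_sim (repr (\pi_pair_class (m1, m2))) (m1, m2).
  by apply/asboolP; rewrite -/(pair_rel _ _) -eqmodE reprK.
by move/sim; rewrite /evpair; case: (repr _).
Qed.

Definition evJ : {rmorphism hatR R -> S} :=
  mmap io (cmeval evpair) : {rmorphism {malg R[{cmonom pair_class}]} -> S}.

Lemma evJ_iota r : evJ (hiota R r) = io r.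
Proof. by rewrite hiotaE /evJ /= mmapC. Qed.

Lemma evJ_lam m1 m2 : evJ (lam R m1 m2) = ⟨evmag m1, evmag m2⟩.
Proof.
rewrite /lam /evJ /= mmapU -[X in X * _]/(io 1) rmorph1 mul1r cmevalU; exact: evpair_pi.
Qed.

Definition evI (u : hatM R) : car A := \sum_(m <- msupp u) evJ u@_m *: evmag m.

Lemma evIE (u : hatM R) (d : {fset magma}) : (msupp u `<=` d)%fset ->
  evI u = \sum_(m <- d) evJ u@_m *: evmag m.
Proof.
move=> ud; rewrite /evI (big_fset_incl _ ud) //= => m _ /mcoeff_outdom ->.
by rewrite rmorph0 scale0r.
Qed.

Lemma evI_linear (s : hatR R) (u v : hatM R) :
  evI (s *: u + v) = evJ s *: evI u + evI v.
Proof.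
pose d := (msupp (s *: u + v) `|` (msupp u `|` msupp v))%fset.
have du : (msupp u `<=` d)%fset by rewrite /d fsetUCA fsubsetUl.
have dv : (msupp v `<=` d)%fset by rewrite /d fsetUA fsubsetUr.
rewrite (evIE (fsubsetUl _ _ : (_ `<=` d)%fset)) (evIE du) (evIE dv).
rewrite scaler_sumr -big_split; apply: eq_bigr => m _ /=.
by rewrite mcoeffD mcoeffZ rmorphD rmorphM scalerDl scalerA.
Qed.

Lemma evIU m : evI (<< m >> : hatM R) = evmag m.
Proof.
by rewrite /evI msuppU oner_eq0 big_seq_fset1 mcoeffUU rmorph1 scale1r.
Qed.

Let hb (m : magma) : car (hatA R) := (<< m >> : hatM R).

Lemma evI_mul (u v : car (hatA R)) : evI (u ∙ v) = evI u ∙ evI v.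
Proof.
apply: (@basis_mor_mul R (hatA R) A magma hb evJ evI) => [|s w z|m n].
- exact: hatM_ind.
- exact: evI_linear.
rewrite -[hb m ∙ hb n]/(hmul _ _) hmulUU !evIU; exact: evmag_prod.
Qed.

Lemma evJ_form (u v : car (hatA R)) : evJ ⟨u, v⟩ = ⟨evI u, evI v⟩.
Proof.
apply: (@basis_mor_form R (hatA R) A magma hb evJ evI) => [|s w z|m n].
- exact: hatM_ind.
- exact: evI_linear.
rewrite -[⟨hb m, hb n⟩]/(hform _ _) hformUU !evIU; exact: evJ_lam.
Qed.

(** The universal property of [hatA]: six marked elements of an algebra with associative form
    determine a morphism. *)
Definition evMor : formMor (hatA R) A :=
  @FormMor R (hatA R) A evJ evI evJ_iota evI_linear evI_mul evJ_form.

End Evaluation.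

(** * The 4A relations from the half-axial identities *)

Section SubmodTheory.
Variables (R : realType) (A : formAlg R).

Lemma smallest_submodP (X : set (car A)) : submod (smallest (@submod R A) X).
Proof.
split=> [B [[]]//|s u v Xu Xv B CB]; have [[B0 BL] XB] := CB.
by apply: BL; [apply: Xu | apply: Xv].
Qed.

Lemma sub_smallest_submod (X : set (car A)) : X `<=` smallest (@submod R A) X.
Proof. exact: sub_gen_smallest. Qed.

Lemma submod_D (B : set (car A)) u v : submod B -> B u -> B v -> B (u + v).
Proof. by case=> _ BL Bu Bv; rewrite -[u]scale1r; apply: BL. Qed.

Lemma submod_Z (B : set (car A)) s u : submod B -> B u -> B (s *: u).
Proof. by case=> B0 BL Bu; rewrite -[_ *: _]addr0; apply: BL. Qed.

Lemma submod_N (B : set (car A)) u : submod B -> B u -> B (- u).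
Proof. by move=> hB Bu; rewrite -scaleN1r; apply: submod_Z. Qed.

Lemma span_subalg (X : set (car A)) :
  (forall u v, X u -> X v -> smallest (@submod R A) X (u ∙ v)) ->
  subalg (smallest (@submod R A) X).
Proof.
move=> XM; have [S0 SL] := smallest_submodP X; split=> //.
have step u v : X u -> smallest (@submod R A) X v ->
    smallest (@submod R A) X (u ∙ v).
  move=> Xu /(_ [set v | smallest (@submod R A) X (u ∙ v)]); apply; split.
    split=> [|s w z hw hz] /=; first by rewrite amul0r.
    by rewrite !amulE; apply: SL.
  by move=> w Xw; apply: XM.
move=> u v Xu Xv.
move: Xu => /(_ [set u | smallest (@submod R A) X (u ∙ v)]); apply; split.
  split=> [|s w z hw hz] /=; first by rewrite amul0l.
  by rewrite !amulE; apply: SL.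
by move=> w Xw; apply: step.
Qed.

End SubmodTheory.

Section FromHalfAxial.
Variables (R : realType) (A : formAlg R) (x : 'I_3 -> bool -> car A).
Local Notation P := (axisP x).
Local Notation e := (axisE x).
Hypothesis hA : half_axial P e.
Implicit Types (i j : 'I_3) (b d : bool).

Definition sgb b : R := if b then 1 else -1.

Lemma x_half i b : x i b = 2^-1 %*: (P i + sgb b %*: e i).
Proof. by rewrite axisPE axisEE /sgb; case: b; lin. Qed.

Lemma P_e i : P i ∙ e i = e i. Proof. exact: (mulP_e hA). Qed.

Lemma P_e_other i j : i != j -> P i ∙ e j = 16^-1 %*: e j.
Proof.
move=> ij; rewrite (ha_mule hA) ?(trP_PP hA) 1?eq_sym // ?iotaZ //.
exact: algP_P.
Qed.

Lemma PP_e i j : i != j -> (P i ∙ P j) ∙ e i = 16^-1 %*: e i.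
Proof.
move=> ij; rewrite (ha_mule hA) ?(trP_mulP hA) ?(trP_PP hA) // ?iotaZ //.
by apply: algP_M; apply: algP_P.
Qed.

(** The formula of [mulP_other] solved for v. *)
Definition v4 i j : car A :=
  locked ((2 / 3) %*: (P i + P j) - (16 / 3) %*: (P i ∙ P j)).

Lemma v4E i j :
  v4 i j = (2 / 3) %*: (P i + P j) - (16 / 3) %*: (P i ∙ P j).
Proof. by rewrite /v4 -lock. Qed.

Lemma v4C i j : v4 i j = v4 j i.
Proof. by rewrite !v4E [P j ∙ _]amulC [P j + _]addrC. Qed.

Lemma PP_PP i j : i != j -> (P i ∙ P j) ∙ (P i ∙ P j) =
  32^-1 %*: (P i ∙ P j) + 64^-1 %*: (P i + P j).
Proof.
move=> ij; have JQ : algP P (P i ∙ P j) by apply: algP_M; apply: algP_P.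
rewrite (mulPP_mul hA ij JQ) (reflP_PP hA ij) (mul_PPP hA ij).
have ji : j != i by rewrite eq_sym.
rewrite !amulE [P j ∙ (P i ∙ P j)](_ : _ = 2^-1 %*: (P i ∙ P j) + 32^-1 %*: P j); last first.
  by rewrite [P i ∙ P j]amulC (mul_PPP hA ji).
rewrite [P j ∙ P i]amulC /reflP !trPE (trP_mulP hA) (trP_PP hA ij) !amulE (mul_PPP hA ij).
by rewrite !cscaleA !carZDl !carZNl !carZDl !iotaZ; lin.
Qed.

Lemma half_mul i j b d : i != j -> x i b ∙ x j d =
  64^-1 %*: (3 %*: x i b + 3 %*: x j d + x i (~~ b) + x j (~~ d)
             - 3 %*: v4 i j).
Proof.
move=> ij; have ji : j != i by rewrite eq_sym.
rewrite !x_half !amulE (P_e_other ij) [e i ∙ P j]amulC (P_e_other ji).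
rewrite (ha_ee0 hA ij) !v4E /sgb.
by case: b; case: d => /=; lin.
Qed.

Lemma half_mul_v i j b : i != j -> x i b ∙ v4 i j =
  16^-1 %*: (5 %*: x i b - x i (~~ b) - 2 %*: x j true - 2 %*: x j false
             + 3 %*: v4 i j).
Proof.
move=> ij; have ji : j != i by rewrite eq_sym.
rewrite !x_half v4E !amulE (ha_PP hA) (mul_PPP hA ij) [e i ∙ P i]amulC P_e.
rewrite [e i ∙ P j]amulC (P_e_other ji) [e i ∙ (P i ∙ P j)]amulC (PP_e ij).
by rewrite /sgb; case: b => /=; lin.
Qed.

Lemma v4_idem i j : i != j -> v4 i j ∙ v4 i j = v4 i j.
Proof.
move=> ij; have ji : j != i by rewrite eq_sym.
rewrite v4E !amulE (PP_PP ij) !(ha_PP hA) [(P i ∙ P j) ∙ P i]amulC.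
rewrite (mul_PPP hA ij) [(P i ∙ P j) ∙ P j]amulC [P j ∙ P i]amulC.
have -> : P j ∙ (P i ∙ P j) = 2^-1 %*: (P i ∙ P j) + 32^-1 %*: P j.
  by rewrite [P i ∙ P j]amulC (mul_PPP hA ji).
lin.
Qed.

Lemma x_half_opp i b : x i b ∙ x i (~~ b) = 0.
Proof.
rewrite !x_half !amulE (ha_PP hA) (ha_ee hA) [e i ∙ P i]amulC P_e /sgb.
by case: b => /=; lin.
Qed.

Lemma x_half_idem i b : x i b ∙ x i b = x i b.
Proof.
rewrite !x_half !amulE (ha_PP hA) (ha_ee hA) [e i ∙ P i]amulC P_e /sgb.
by case: b => /=; lin.
Qed.

Lemma form_P_e i j : ⟨P i, e j⟩ = 0.
Proof. by apply: (ha_forme hA); apply: algP_P. Qed.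

Lemma form_e_P i j : ⟨e i, P j⟩ = 0.
Proof. by rewrite (ha_formC hA) form_P_e. Qed.

Lemma x_half_form i b : ⟨x i b, x i b⟩ = 1.
Proof.
rewrite !x_half !formE (ha_formP hA) form_P_e form_e_P (form_ee hA).
by rewrite !iota_cscale /sgb; case: b => /=; lin.
Qed.

Lemma x_half_form_opp i b : ⟨x i b, x i (~~ b)⟩ = 0.
Proof.
rewrite !x_half !formE (ha_formP hA) form_P_e form_e_P (form_ee hA).
by rewrite !iota_cscale /sgb; case: b => /=; lin.
Qed.

Lemma form_half i j b d : i != j -> ⟨x i b, x j d⟩ = iota A 32^-1.
Proof.
move=> ij.
rewrite !x_half !formE (ha_formPP hA ij) form_P_e form_e_P (form_ee0 hA ij).
by rewrite !iota_cscale; lin.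
Qed.

Lemma form_P_PP i j : i != j -> ⟨P i, P i ∙ P j⟩ = iota A 8^-1.
Proof. by move=> ij; rewrite (ha_formA hA) (ha_PP hA) (ha_formPP hA). Qed.

Lemma form_half_v i j b : i != j -> ⟨x i b, v4 i j⟩ = iota A (3 / 8).
Proof.
move=> ij; have hQ : ⟨e i, P i ∙ P j⟩ = 0.
  by rewrite (ha_formC hA); apply: (ha_forme hA); apply: algP_M; apply: algP_P.
rewrite x_half v4E !formE (ha_formP hA) !form_e_P (ha_formPP hA ij) hQ.
by rewrite (form_P_PP ij) !iota_cscale; lin.
Qed.

Lemma form_v4 i j : i != j -> ⟨v4 i j, v4 i j⟩ = iota A 2.
Proof.
move=> ij; have ji : j != i by rewrite eq_sym.
have f1 : ⟨v4 i j, P i⟩ = iota A (3 / 4).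
  have -> : P i = x i true + x i false by rewrite axisPE.
  rewrite (ha_formC hA) formDl !(form_half_v _ ij) !iota_cscale; lin.
have f2 : ⟨v4 i j, P j⟩ = iota A (3 / 4).
  have -> : P j = x j true + x j false by rewrite axisPE.
  rewrite (ha_formC hA) v4C formDl !(form_half_v _ ji) !iota_cscale; lin.
have f3 : ⟨v4 i j, P i ∙ P j⟩ = iota A (- 3 / 16).
  rewrite (ha_formA hA) v4E !amulE (ha_PP hA) [P j ∙ P i]amulC.
  rewrite [(P i ∙ P j) ∙ P i]amulC (mul_PPP hA ij) !formE (ha_formPP hA ij).
  rewrite ![⟨P i ∙ P j, P j⟩](ha_formC hA) [P i ∙ P j]amulC (form_P_PP ji).
  by rewrite !iota_cscale; lin.
by rewrite {2}v4E !(formDr, formNr, formRr) f1 f2 f3 !iota_cscale; lin.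
Qed.

(** The product a_i ∙ a_j yields y = a_-i + a_-j - 3 v. In 64 a_i ∙ y the elements a_-i and v occur
    as 13 a_-i - 39 v, in the same ratio as in y, so subtracting 13 y removes both and leaves 14
    a_-j besides multiples of a_i and a_j. *)
Lemma subalg_x_false (B : set (car A)) i j : i != j -> subalg B ->
  B (x i true) -> B (x j true) -> B (x j false).
Proof.
move=> ij [hB BM] Bi Bj.
pose y := 64 %*: (x i true ∙ x j true) - 3 %*: x i true - 3 %*: x j true.
have yE : y = x i false + x j false - 3 %*: v4 i j.
  by rewrite /y half_mul //=; lin.
have BZ r u : B u -> B (r %*: u) by apply: submod_Z.
have By : B y.
  rewrite /y; do 2![apply: submod_D => //; last by apply: submod_N => //; apply: (BZ)].
  by apply: (BZ); apply: BM.
have zE : 64 %*: (x i true ∙ y) = 13 %*: x i false + 27 %*: x j false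
    - 39 %*: v4 i j - 57 %*: x i true + 25 %*: x j true.
  by rewrite yE !amulE (x_half_opp i true) half_mul // half_mul_v //=; lin.
have -> : x j false = 14^-1 %*: (64 %*: (x i true ∙ y) + - (13 %*: y)
    + 57 %*: x i true + - (25 %*: x j true)).
  by rewrite zE yE; lin.
apply: (BZ); apply: submod_D => //; last by apply: submod_N => //; apply: (BZ).
apply: submod_D => //; last exact: BZ.
apply: submod_D => //; last by apply: submod_N => //; apply: (BZ).
by apply: (BZ); apply: BM.
Qed.

Lemma half_subalg i j : i != j ->
  smallest (@subalg R A) [set x i true; x j true] =
  smallest (@submod R A) [set x i true; x i false; x j true; x j false; v4 i j].
Proof.
move=> ij; have ji : j != i by rewrite eq_sym.
set X := [set x i true; x j true]; set Y := [set _; _; _; _; _].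
have xY k b : k = i \/ k = j -> Y (x k b).
  by case=> ->; case: b; rewrite /Y /=; tauto.
have vY : Y (v4 i j) by rewrite /Y /=; tauto.
have hY := smallest_submodP Y; have sY := @sub_smallest_submod R A Y.
have YZ r u : smallest (@submod R A) Y u -> smallest (@submod R A) Y (r %*: u).
  exact: submod_Z.
have YD u w : smallest (@submod R A) Y u -> smallest (@submod R A) Y w ->
  smallest (@submod R A) Y (u + w) by exact: submod_D.
have YN u : smallest (@submod R A) Y u -> smallest (@submod R A) Y (- u).
  exact: submod_N.
apply/seteqP; split.
  apply: smallest_sub; last first.
    by move=> _ [->|->]; apply: sY; apply: xY; [left | right].
  apply: span_subalg.
  have xx k b l d : k = i \/ k = j -> l = i \/ l = j ->
      smallest (@submod R A) Y (x k b ∙ x l d).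
    move=> hk hl; have [kl|kl] := eqVneq k l.
      have [->|bd] := eqVneq b d.
        by rewrite kl x_half_idem; apply: sY; apply: xY.
      have -> : d = ~~ b by case: b d bd => [] [].
      by rewrite kl x_half_opp; apply: hY.1.
    rewrite half_mul //.
    have vkl : v4 k l = v4 i j.
      by case: hk hl kl => -> [] ->; rewrite ?eqxx // v4C.
    rewrite vkl; apply: (YZ).
    by do ![apply: (YD) | apply: (YN) | apply: (YZ)]; apply: (sY) => //; apply: (xY).
  have xv k b : k = i \/ k = j -> smallest (@submod R A) Y (x k b ∙ v4 i j).
    move=> hk; pose l := if k == i then j else i.
    have kl : k != l by rewrite /l; case: hk => ->; rewrite ?eqxx // (negbTE ji).
    have hl : l = i \/ l = j by rewrite /l; case: ifP; tauto.
    have -> : v4 i j = v4 k l.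
      by case: hk hl kl => -> [] ->; rewrite ?eqxx // v4C.
    have vkl : v4 k l = v4 i j.
      by case: hk hl kl => -> [] ->; rewrite ?eqxx // v4C.
    rewrite half_mul_v // vkl; apply: (YZ).
    by do ![apply: (YD) | apply: (YN) | apply: (YZ)]; apply: (sY) => //; apply: (xY).
  have cases u : Y u -> u = v4 i j \/ exists k b, (k = i \/ k = j) /\ u = x k b.
    case=> [[[[->|->]|->]|->]|->]; [right|right|right|right|by left].
    - by exists i, true; split; [left|].
    - by exists i, false; split; [left|].
    - by exists j, true; split; [right|].
    by exists j, false; split; [right|].
  move=> u w /cases[->|[k [b [hk ->]]]] /cases[->|[l [d [hl ->]]]].
  - by rewrite v4_idem //; apply: sY.
  - by rewrite amulC; apply: xv.
  - exact: xv.
  exact: xx.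
have hX := smallest_subalgP X; have sX := @sub_smallest_subalg R A X.
have Xi : smallest (@subalg R A) X (x i true) by apply: sX; left.
have Xj : smallest (@subalg R A) X (x j true) by apply: sX; right.
have Xjf := subalg_x_false ij hX Xi Xj; have Xif := subalg_x_false ji hX Xj Xi.
apply: smallest_sub; first exact: hX.1.
move=> _ [[[[->|->]|->]|->]|->] //.
have -> : v4 i j = 3^-1 %*: (3 %*: x i true + 3 %*: x j true + x i false
    + x j false - 64 %*: (x i true ∙ x j true)).
  by rewrite half_mul //=; lin.
have [hXm XM] := hX.
have XZ r u : smallest (@subalg R A) X u -> smallest (@subalg R A) X (r %*: u).
  exact: submod_Z.
apply: (XZ); apply: (submod_D hXm); last by apply: (submod_N hXm); apply: (XZ); apply: XM.
by do !apply: (submod_D hXm) => //; apply: XZ.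
Qed.

Lemma propertyP_half : propertyP x.
Proof.
move=> i b j d; case: eqVneq => [<-|ij].
  have [->|bd] := eqVneq b d.
    exists (fun l => if l is E1 then x i d else 0).
      by case; rewrite /eigenspace /= ?amul0r ?rscaler0 // x_half_idem rscale1.
    by rewrite !big_cons big_nil; split; lin.
  have -> : d = ~~ b by case: b d bd => [] [].
  exists (fun l => if l is E0 then x i (~~ b) else 0).
    by case; rewrite /eigenspace /= ?amul0r ?rscaler0 // x_half_opp rscale0.
  by rewrite !big_cons big_nil; split; lin.
have ji : j != i by rewrite eq_sym.
(* The axis [x j d] is half of P_j plus or minus half of e_j. The P_j-part is decomposed as in
   [peirce_other] and has no 1/32-part, whereas e_j is a 1/32-eigenvector, which the involution
   negates. *)
pose yh := (P i ∙ P j) - 16^-1 %*: P i.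
exists (fun l => match l with
  | E1 => 32^-1 %*: x i b | E32 => (sgb d / 2) %*: e j | E4 => yh
  | E0 => 2^-1 %*: P j - yh - 32^-1 %*: x i b end).
  case; rewrite /eigenspace /=.
  - by rewrite !amulE x_half_idem; lin.
  - rewrite !amulE x_half_idem x_half /yh !amulE (ha_PP hA) (mul_PPP hA ij).
    rewrite [e i ∙ P j]amulC (P_e_other ji) [e i ∙ (P i ∙ P j)]amulC (PP_e ij).
    by rewrite [e i ∙ P i]amulC P_e; lin.
  - rewrite x_half /yh !amulE (ha_PP hA) (mul_PPP hA ij).
    rewrite [e i ∙ (P i ∙ P j)]amulC (PP_e ij) [e i ∙ P i]amulC P_e; lin.
  by rewrite x_half !amulE (P_e_other ij) (ha_ee0 hA ij); lin.
rewrite !big_cons big_nil /sgb !x_half.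
by case: d; split; rewrite /sgb /=; lin.
Qed.

Lemma shape4A_half : shape4A x.
Proof.
exists v4 => i j ij; have ji : j != i by rewrite eq_sym.
split; first exact: v4C.
split; first exact: half_subalg.
- by split; [apply: v4_idem | apply: form_v4].
- move=> b d; split; [exact: half_mul | exact: half_mul_v | |].
    by rewrite v4C half_mul_v.
  by split; [apply: form_half | apply: form_half_v | rewrite v4C form_half_v].
split; [exact: (x_half_opp i true) | exact: (x_half_opp j true) | |].
  exact: (x_half_form_opp i true).
exact: (x_half_form_opp j true).
Qed.

End FromHalfAxial.

(** * Axes of the matrix model *)

Section EquationalAxis.
Variables (R : realType) (A : formAlg R).
Implicit Types (a u v w : car A).

(** For a primitive axis with <a, a> = 1 and a Frobenius form, this is u without its 1-part. *)
Definition perp a u := locked (u - ⟨u, a⟩ *: a).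
Lemma perpE a u : perp a u = u - ⟨u, a⟩ *: a.
Proof. by rewrite /perp -lock. Qed.
Lemma perp_sum a u : u = ⟨u, a⟩ *: a + perp a u.
Proof. by rewrite perpE addrC subrK. Qed.

(* [eigensum a (fusion l m) w] as equations, which injective morphisms
   reflect. *)
Definition fusion_eq a l m w : Prop :=
  match fusion l m with
  | [::] => w = 0
  | [:: k] => eigenspace a k w
  | [:: _; _] => a ∙ perp a w = 0
  | _ => a ∙ (a ∙ perp a w) = 4^-1 %*: (a ∙ perp a w)
  end.

(* [axis_eq_poly]: on the complement of [a], multiplication by [a] is
   annihilated by X (X - 1/4) (X - 1/32). *)
Record axis_eq a : Prop := AxisEq {
  axis_eq_idem : a ∙ a = a;
  axis_eq_poly : forall u, let w := a ∙ perp a u in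
    a ∙ (a ∙ w) = (9 / 32) %*: (a ∙ w) - 128^-1 %*: w;
  axis_eq_prim : forall u, a ∙ u = u -> perp a u = 0;
  axis_eq_fusion : forall l m u v, eigenspace a l u -> eigenspace a m v ->
    fusion_eq a l m (u ∙ v)
}.

(** Primitivity makes u a multiple of a, so u ∙ v is a multiple of v, and zero when l is [E0]. *)
Lemma fusion_eq_E1 a l u v : (forall u, a ∙ u = u -> perp a u = 0) ->
  eigenspace a E1 u -> eigenspace a l v -> fusion_eq a E1 l (u ∙ v).
Proof.
move=> prim; rewrite {1}/eigenspace /= rscale1 => /prim.
rewrite perpE => /subr0_eq -> hv; rewrite amulZl [a ∙ v]hv.
rewrite -rscaleZ; case: l hv => hv; rewrite /fusion_eq /eigenspace /=.
- by rewrite amulRr amulZr [a ∙ v]hv -rscaleZ.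
- by rewrite rscale0.
- by rewrite amulRr amulZr [a ∙ v]hv -rscaleZ.
by rewrite amulRr amulZr [a ∙ v]hv -rscaleZ.
Qed.

Lemma eigen_sum0 a f : eigenfamily a f -> \sum_(l <- allM) f l = 0 ->
  forall l, f l = 0.
Proof.
rewrite !big_cons big_nil => hf; have := (hf E1, hf E0, hf E4, hf E32).
rewrite /eigenspace /= => -[[[h1 h0] h4] h32] S0.
have S1 := congr1 (amul a) S0; rewrite !amulE h1 h0 h4 h32 in S1.
have S2 := congr1 (amul a) S1; rewrite !amulE h1 h0 h4 h32 in S2.
have S3 := congr1 (amul a) S2; rewrite !amulE h1 h0 h4 h32 in S3.
(* With the coefficients of the Lagrange polynomial of one of the nodes 1, 0, 1/4, 1/32, the
   combination of S0, S1, S2 and S3 isolates the corresponding component. *)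
have comb c0 c1 c2 c3 (v : car A) :
    v = c0 %*: (f E1 + (f E0 + (f E4 + (f E32 + 0)))) +
    c1 %*: (1 %*: f E1 + (0 %*: f E0 + (4^-1 %*: f E4 + (32^-1 %*: f E32 + 0)))) +
    c2 %*: (1 %*: (1 %*: f E1) + (0 %*: (0 %*: f E0) +
      (4^-1 %*: (4^-1 %*: f E4) + (32^-1 %*: (32^-1 %*: f E32) + 0)))) +
    c3 %*: (1 %*: (1 %*: (1 %*: f E1)) + (0 %*: (0 %*: (0 %*: f E0)) +
      (4^-1 %*: (4^-1 %*: (4^-1 %*: f E4)) +
       (32^-1 %*: (32^-1 %*: (32^-1 %*: f E32)) + 0)))) -> v = 0.
  by move=> ->; rewrite S0 S1 S2 S3; lin.
case.
- by apply: (comb 0 (93^-1) (- 36 / 93) (128 / 93)); lin.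
- by apply: (comb 1 (-37) (164) (- 128)); lin.
- by apply: (comb 0 (- 16 / 21) (528 / 21) (- 512 / 21)); lin.
by apply: (comb 0 (32 * 32 * 8 / 217) (- (32 * 32 * 40) / 217) (32 * 32 * 32 / 217)); lin.
Qed.

Lemma axis_of_eq a : axis_eq a -> axis a /\ primitive a.
Proof.
move=> [idem poly prim fus].
have ha s : a ∙ (s *: a) = s *: a by rewrite amulZr idem.
split; last first.
  apply/seteqP; split=> [u|_ [s _ <-]]; rewrite /eigenspace /= rscale1 //.
  by move=> /prim; rewrite perpE => /subr0_eq ->; exists ⟨u, a⟩.
split=> //.
  split; last by move=> f; exact: eigen_sum0.
  apply/seteqP; split=> // u _; pose w := a ∙ perp a u.
  have hw : a ∙ (a ∙ w) = (9 / 32) %*: (a ∙ w) - 128^-1 %*: w := poly u.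
  (* Lagrange projections: w has no 0-part, a ∙ w - w / 32 is 7/128 times the 1/4-part of
     [perp a u], and a ∙ w - w / 4 is -7/1024 times its 1/32-part. *)
  pose f4 := (128 / 7) %*: (a ∙ w - 32^-1 %*: w).
  pose f32 := (- (32 * 32) / 7) %*: (a ∙ w - 4^-1 %*: w).
  exists (fun l => match l with
    | E1 => ⟨u, a⟩ *: a | E4 => f4 | E32 => f32
    | E0 => perp a u - f4 - f32 end).
    case; rewrite /eigenspace /=.
    - by rewrite ha rscale1.
    - by rewrite /f4 /f32 !amulE -/w hw; lin.
    - by rewrite /f4 !amulE hw; lin.
    by rewrite /f32 !amulE hw; lin.
  by rewrite !big_cons big_nil {1}[u](perp_sum a); lin.
move=> l m u v hu hv; have := fus l m u v hu hv; rewrite /fusion_eq.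
set w := u ∙ v.
have one k : eigenspace a k w -> eigensum a [:: k] w.
  move=> hw; exists (fun k' => match k', k with
    | E1, E1 | E0, E0 | E4, E4 | E32, E32 => w | _, _ => 0 end); last by rewrite big_seq1; case: k {hw}.
  by case; case: k hw => //=; rewrite /eigenspace /= ?amul0r ?rscaler0.
have two : a ∙ perp a w = 0 -> eigensum a [:: E1; E0] w.
  move=> hw; exists (fun k => match k with E1 => ⟨w, a⟩ *: a
    | E0 => perp a w | _ => 0 end).
    by case; rewrite /eigenspace /= ?ha ?rscale1 ?hw ?rscale0 ?amul0r ?rscaler0.
  by rewrite !big_cons big_nil {1}[w](perp_sum a); lin.
have three : a ∙ (a ∙ perp a w) = 4^-1 %*: (a ∙ perp a w) ->
    eigensum a [:: E1; E0; E4] w.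
  move=> hw; exists (fun k => match k with E1 => ⟨w, a⟩ *: a
    | E0 => perp a w - 4 %*: (a ∙ perp a w) | E4 => 4 %*: (a ∙ perp a w)
    | _ => 0 end).
    case; rewrite /eigenspace /= ?ha ?rscale1 ?amul0r ?rscaler0 //.
      by rewrite !amulE hw; lin.
    by rewrite !amulE hw; lin.
  by rewrite !big_cons big_nil {1}[w](perp_sum a); lin.
have none : w = 0 -> eigensum a [::] w.
  move=> w0; exists (fun=> 0); last by rewrite big_nil.
  by case; rewrite /eigenspace /= amul0r rscaler0.
by case: l {hu fus}; case: m {hv} => //=; [apply: one|..]; try exact: one;
  try exact: two; try exact: three; exact: none.
Qed.

End EquationalAxis.

Lemma axis_eq_inj (R : realType) (A B : formAlg R) (G : formMor A B) a :
  injective (morI G) -> axis_eq (morI G a) -> axis_eq a.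
Proof.
move=> inj [idem poly prim fus].
have mp u : morI G (perp a u) = perp (morI G a) (morI G u).
  by rewrite !perpE !morE.
have me l u : eigenspace a l u <-> eigenspace (morI G a) l (morI G u).
  by rewrite /eigenspace /=; split=> [h|h]; [rewrite -!morE h|apply: inj; rewrite !morE].
split.
- by apply: inj; rewrite !morE.
- by move=> u w; apply: inj; rewrite !morE mp; exact: poly.
- by move=> u hu; apply: inj; rewrite mp morI0; apply: prim; rewrite -morI_mul hu.
move=> l m u v /me hu /me hv; have := fus l m _ _ hu hv.
rewrite /fusion_eq; case: (fusion l m) => [|k [|k' [|k'' r]]] h.
- by apply: inj; rewrite !morE.
- by apply/me; rewrite !morE.
- by apply: inj; rewrite !(morI_mul, mp) morI0.
by apply: inj; rewrite !(morI_mul, mp, morIR).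
Qed.

Lemma mx_use (S : numFieldType) r (X Y Z W : 'M[S]_3) :
  X = Y -> Z - W = r *: (X - Y) -> Z = W.
Proof. by move=> ->; rewrite subrr scaler0 => /subr0_eq. Qed.

(** * Eigenvectors and fusion of the axes in the matrix model *)

Section ModelAxis.
Variables (R : realType) (S : numFieldType) (io : {rmorphism R -> S}).
Variable p : 'I_3 -> 'M[S]_3.
Hypotheses (p_sandwich : forall i X, p i *m X *m p i = \tr (X *m p i) *: p i)
  (tr_p : forall i, \tr (p i) = 1)
  (tr_pp : forall i j, i != j -> \tr (p i *m p j) = 16^-1).
Local Notation V := (car (mdlAlg io p)).
Variables (i : 'I_3) (b : bool).
Local Notation P := (p i).
Local Notation a := (mdlgen io p i b).

Definition sg : S := if b then 2^-1 else - 2^-1.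

Lemma sg2 : sg * sg = 4^-1.
Proof. by rewrite /sg; case: b; field. Qed.

Let PP : P *m P = P := p_idem p_sandwich tr_p i.

Lemma genmul1 (u : V) : (a ∙ u).1 =
  4^-1 *: (P *m u.1 + u.1 *m P) + (sg * u.2 0 i) *: P.
Proof.
rewrite /= -/sg; congr (_ + _); first by rewrite !mmE; mxlin.
rewrite /wsum (bigD1 i) //= big1 ?addr0 => [|j ji].
  by rewrite !mxE !eqxx mulr1.
by rewrite !mxE (negbTE ji) andbF mulr0 mul0r scale0r.
Qed.

Lemma genmul2 (u : V) :
  (a ∙ u).2 0 i = 2^-1 * u.2 0 i + sg * \tr (u.1 *m P).
Proof.
rewrite /= -/sg !mxE !eqxx mulr1 mmZl trZ PP tr_p.
by rewrite mulr1 [\tr _ * sg]mulrC.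
Qed.

Lemma genmul2j (u : V) j : j != i -> (a ∙ u).2 0 j = 32^-1 * u.2 0 j.
Proof.
move=> ji; rewrite /= -/sg !mxE (negbTE ji) andbF !mulr0 addr0.
by rewrite mmZl trZ tr_pp 1?eq_sym //; field.
Qed.

Lemma mdl_eq (u v : V) : u.1 = v.1 -> (forall j, u.2 0 j = v.2 0 j) -> u = v.
Proof.
by case: u v => [X x] [Y y] /= -> xy; congr (_, _); apply/rowP.
Qed.

Lemma trPX X : \tr (P *m X) = \tr (X *m P). Proof. exact: trC. Qed.

Section Eigen.
Variables (u : V) (l : S).
Let X := u.1.
Let c := \tr (X *m P).
Let k := u.2 0 i.
Hypothesis hu : a ∙ u = l *: u.

(** The matrix component of the eigenvalue equation. Its trace against P is [eigA], its products
    with P are [eigL] and [eigR], and the other coordinates give [eigB] and [eigC]; these are linear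
    equations in c, k, P X and X P. *)
Lemma eig1 : 4^-1 *: (P *m X + X *m P) + (sg * k) *: P = l *: X.
Proof. by rewrite -genmul1 hu. Qed.

Lemma eigA : 2^-1 * c + sg * k = l * c.
Proof.
have := congr1 (fun M => \tr (M *m P)) eig1.
rewrite !mmE !trE p_sandwich trZ tr_p -mmA PP tr_p -/c => <-; by field.
Qed.

Lemma eigB : 2^-1 * k + sg * c = l * k.
Proof. by rewrite -genmul2 hu mxE. Qed.

Lemma eigC j : j != i -> 32^-1 * u.2 0 j = l * u.2 0 j.
Proof. by move=> ji; rewrite -genmul2j // hu mxE. Qed.

Lemma eigL : 4^-1 *: (P *m X + c *: P) + (sg * k) *: P = l *: (P *m X).
Proof.
have := congr1 (fun M => P *m M) eig1; rewrite /= !mmE !mmA PP p_sandwich -/c.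
by move=> <-; mxlin.
Qed.

Lemma eigR : 4^-1 *: (X *m P + c *: P) + (sg * k) *: P = l *: (X *m P).
Proof.
have := congr1 (fun M => M *m P) eig1; rewrite /= !mmE p_sandwich -/c.
by rewrite -mmA !PP => <-; mxlin.
Qed.

End Eigen.

Definition lamS l : S :=
  match l with E1 => 1 | E0 => 0 | E4 => 4^-1 | E32 => 32^-1 end.

Lemma evZ l (u : V) : evalue R l %*: u = lamS l *: u.
Proof.
by case: l; rewrite /rscale /= ?rmorph1 ?rmorph0 ?fmorphV ?rmorph_nat.
Qed.

Lemma eigE l u : eigenspace a l u <-> a ∙ u = lamS l *: u.
Proof. by rewrite /eigenspace -evZ. Qed.

Lemma sc_use (r x y z w : S) : x = y -> z - w = r * (x - y) -> z = w.
Proof. by move=> ->; rewrite subrr mulr0 => /subr0_eq. Qed.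

Lemma eig_E1 u : eigenspace a E1 u ->
  [/\ u.1 = \tr (u.1 *m P) *: P, u.2 0 i = 2 * sg * \tr (u.1 *m P)
    & forall j, j != i -> u.2 0 j = 0].
Proof.
move=> /eigE; rewrite /lamS => hu.
have hL := eigL hu; have hR := eigR hu; have h1 := eig1 hu.
have kE : u.2 0 i = 2 * sg * \tr (u.1 *m P).
  by apply: (sc_use (r := - 2) (eigB hu)); field.
have skE : sg * u.2 0 i = 2^-1 * \tr (u.1 *m P).
  by rewrite kE; transitivity (2 * (sg * sg) * \tr (u.1 *m P)); [ring | rewrite sg2; field].
rewrite skE in hL hR h1.
have PX : P *m u.1 = \tr (u.1 *m P) *: P.
  by apply: (mx_use (r := - (4 / 3)) hL); mxlin.
have XP : u.1 *m P = \tr (u.1 *m P) *: P.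
  by apply: (mx_use (r := - (4 / 3)) hR); mxlin.
split=> // [|j ji]; first last.
  by apply: (sc_use (r := - (32 / 31)) (eigC hu ji)); field.
set c := \tr (u.1 *m P) in PX XP h1 *.
by apply: (mx_use (r := - 1) h1); rewrite PX XP; mxlin.
Qed.

Lemma eig_E0 u : eigenspace a E0 u ->
  [/\ P *m u.1 = \tr (u.1 *m P) *: P, u.1 *m P = \tr (u.1 *m P) *: P,
    u.2 0 i = - 2 * sg * \tr (u.1 *m P) & forall j, j != i -> u.2 0 j = 0].
Proof.
move=> /eigE; rewrite /lamS => hu.
have hL := eigL hu; have hR := eigR hu.
have skE : sg * u.2 0 i = - 2^-1 * \tr (u.1 *m P).
  by apply: (sc_use (r := 1) (eigA hu)); field.
have kE : u.2 0 i = - 2 * sg * \tr (u.1 *m P).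
  transitivity (4 * (sg * sg) * u.2 0 i); first by rewrite sg2; field.
  by transitivity (4 * sg * (sg * u.2 0 i)); [ring | rewrite skE; field].
rewrite skE in hL hR.
split=> // [||j ji].
- by apply: (mx_use (r := 4) hL); mxlin.
- by apply: (mx_use (r := 4) hR); mxlin.
by apply: (sc_use (r := 32) (eigC hu ji)); field.
Qed.

Lemma eig_E4 u : eigenspace a E4 u ->
  [/\ u.1 = P *m u.1 + u.1 *m P, \tr (u.1 *m P) = 0 & forall j, u.2 0 j = 0].
Proof.
move=> /eigE; rewrite /lamS => hu.
have h1 := eig1 hu; have hA := eigA hu; have hB := eigB hu.
have cE : \tr (u.1 *m P) = 0.
  have hB' : 4 * (sg * sg) * \tr (u.1 *m P) = - sg * u.2 0 i.
    by apply: (sc_use (r := 4 * sg) hB); field.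
  rewrite sg2 in hB'.
  have hA' : sg * u.2 0 i = - 4^-1 * \tr (u.1 *m P).
    by apply: (sc_use (r := 1) hA); field.
  rewrite mulNr hA' in hB'.
  by apply: (sc_use (r := 4 / 3) hB'); field.
have kE : u.2 0 i = 0.
  by rewrite cE in hB; apply: (sc_use (r := 4) hB); field.
split=> // [|j].
  by rewrite kE in h1; apply: (mx_use (r := - 4) h1); mxlin.
have [->//|ji] := eqVneq j i.
by apply: (sc_use (r := - (32 / 7)) (eigC hu ji)); field.
Qed.

Lemma eig_E32 u : eigenspace a E32 u -> u.1 = 0 /\ u.2 0 i = 0.
Proof.
move=> /eigE; rewrite /lamS => hu.
have h1 := eig1 hu; have hA := eigA hu; have hB := eigB hu.
have hL := eigL hu; have hR := eigR hu.
have cE : \tr (u.1 *m P) = 0.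
  have hB' : 32 / 15 * (sg * sg) * \tr (u.1 *m P) = - sg * u.2 0 i.
    by apply: (sc_use (r := 32 / 15 * sg) hB); field.
  rewrite sg2 in hB'.
  have hA' : sg * u.2 0 i = - (15 / 32) * \tr (u.1 *m P).
    by apply: (sc_use (r := 1) hA); field.
  rewrite mulNr hA' in hB'.
  by apply: (sc_use (r := 480 / 31) hB'); field.
have kE : u.2 0 i = 0.
  by rewrite cE in hB; apply: (sc_use (r := 32 / 15) hB); field.
rewrite cE kE in hL hR; rewrite kE in h1; split=> //.
have PX : P *m u.1 = 0 by apply: (mx_use (r := 32 / 7) hL); mxlin.
have XP : u.1 *m P = 0 by apply: (mx_use (r := 32 / 7) hR); mxlin.
by rewrite PX XP in h1; apply: (mx_use (r := - 32) h1); mxlin.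
Qed.

Lemma form_gen (u : V) : ⟨u, a⟩ = \tr (u.1 *m P) + 2 * sg * u.2 0 i.
Proof.
rewrite /= /mdlform /= -/sg (bigD1 i) //= big1 => [|j ji].
  by rewrite !mxE !eqxx mulr1 mmZr trZ; field.
by rewrite !mxE (negbTE ji) andbF !mulr0.
Qed.

Lemma perp_mul (u : V) :
  [/\ (a ∙ perp a u).1 =
        4^-1 *: (P *m u.1 + u.1 *m P) - (2^-1 * \tr (u.1 *m P)) *: P,
      (a ∙ perp a u).2 0 i = 0
    & forall j, j != i -> (a ∙ perp a u).2 0 j = 32^-1 * u.2 0 j].
Proof.
rewrite perpE form_gen; set c := \tr (u.1 *m P); set k := u.2 0 i.
have kE : (u - (c + 2 * sg * k) *: a).2 0 i = 2^-1 * k - sg * c.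
  rewrite /= -/sg !mxE !eqxx mulr1 -/k.
  transitivity (k - sg * c - 2 * (sg * sg) * k); first by ring.
  by rewrite sg2; field.
split=> [||j ji].
- rewrite genmul1 kE /= !mmE PP -/c.
  have -> : sg * (2^-1 * k - sg * c) = 2^-1 * (sg * k) - 4^-1 * c.
    by rewrite mulrBr [sg * (sg * c)]mulrA sg2; ring.
  by mxlin.
- rewrite genmul2 kE /= !mmE PP !trE tr_p -/c.
  transitivity (4^-1 * k - sg * sg * k); first by field.
  by rewrite sg2; field.
by rewrite genmul2j //= -/sg !mxE (negbTE ji) andbF !mulr0 subr0.
Qed.

Lemma L_half (w : V) : P *m w.1 + w.1 *m P = w.1 -> \tr (w.1 *m P) = 0 ->
  w.2 0 i = 0 -> [/\ (a ∙ w).1 = 4^-1 *: w.1, (a ∙ w).2 0 i = 0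
    & forall j, j != i -> (a ∙ w).2 0 j = 32^-1 * w.2 0 j].
Proof.
move=> hw cw kw; split=> [||j ji]; last exact: genmul2j.
  by rewrite genmul1 hw kw; mxlin.
by rewrite genmul2 cw kw !mulr0 addr0.
Qed.

(** One multiplication by a sends [perp a u] into the sum of the matrices w with P w + w P = w and
    tr(w P) = 0, where a is 1/4, and the span of the e_j with j != i, where a is 1/32. This yields
    [axis_eq_poly] and the fusion of 1/32 with itself. *)
Lemma half_perp (u : V) (w := a ∙ perp a u) :
  P *m w.1 + w.1 *m P = w.1 /\ \tr (w.1 *m P) = 0.
Proof.
have [w1 _ _] := perp_mul u; rewrite /w {}w1 {w}.
set c := \tr (u.1 *m P).
have h : \tr (P *m u.1 *m P) = c by rewrite p_sandwich trZ tr_p mulr1.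
have h' : \tr (u.1 *m P *m P) = c by rewrite -mmA PP.
split; last by rewrite !mmE PP !trE h h' tr_p; field.
rewrite !mmE !mmA PP !p_sandwich -/c -[u.1 *m P *m P]mmA PP.
by mxlin.
Qed.

Lemma fusion_eq_sym (A : formAlg R) (x : car A) l m w :
  fusion_eq x l m w -> fusion_eq x m l w.
Proof. by case: l; case: m. Qed.

Lemma tr_sym_P X Y : P *m X = \tr (X *m P) *: P -> X *m P = \tr (X *m P) *: P ->
  \tr ((X *m Y + Y *m X) *m P) = 2 * (\tr (X *m P) * \tr (Y *m P)).
Proof.
move=> PX XP; rewrite !mmE !trE.
have -> : \tr (X *m Y *m P) = \tr (X *m P) * \tr (Y *m P).
  by rewrite trC mmA PX mmZl trZ trPX.
have -> : \tr (Y *m X *m P) = \tr (X *m P) * \tr (Y *m P).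
  by rewrite -mmA [in LHS]XP mmZr trZ.
by ring.
Qed.

Lemma fusion_00 u v : eigenspace a E0 u -> eigenspace a E0 v ->
  eigenspace a E0 (u ∙ v).
Proof.
move=> /eig_E0[PX XP uk uj] /eig_E0[PY YP vk vj]; apply/eigE; rewrite scale0r.
set c := \tr (u.1 *m P) in PX XP uk *; set d := \tr (v.1 *m P) in PY YP vk *.
have w1 : (u ∙ v).1 = 2^-1 *: (u.1 *m v.1 + v.1 *m u.1) + (c * d) *: P.
  rewrite /=; congr (_ + _); rewrite /wsum (bigD1 i) //= big1 ?addr0 => [|j ji].
    rewrite uk vk; congr (_ *: _).
    by transitivity (4 * (sg * sg) * (c * d)); [ring | rewrite sg2; field].
  by rewrite uj // mul0r scale0r.
have w2 : (u ∙ v).2 0 i = - 4 * sg * (c * d).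
  by rewrite /= mxE uk vk -/c -/d; ring.
have w2j j : j != i -> (u ∙ v).2 0 j = 0.
  by move=> ji; rewrite /= mxE uj // vj // !mulr0 addr0.
have PW : P *m (u ∙ v).1 = (2 * (c * d)) *: P.
  rewrite w1 !mmE !mmA PX PY PP !mmZl PX PY; mxlin.
have WP : (u ∙ v).1 *m P = (2 * (c * d)) *: P.
  rewrite w1 !mmE -!mmA XP YP PP !mmZr XP YP; mxlin.
apply: mdl_eq => [|j]; rewrite ?[RHS]mxE.
  rewrite genmul1 PW WP w2; have -> : sg * (- 4 * sg * (c * d)) = - (c * d).
    by transitivity (- 4 * (sg * sg) * (c * d)); [ring | rewrite sg2; field].
  by rewrite /=; mxlin.
have [->|ji] := eqVneq j i; last by rewrite genmul2j // w2j // mulr0.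
by rewrite genmul2 w2 WP trZ tr_p; field.
Qed.

(** In the block form given by P and 1 - P, the matrix of a 0-eigenvector is block diagonal and that
    of a 1/4-eigenvector is off-diagonal, so their product is off-diagonal. *)
Lemma fusion_04 u v : eigenspace a E0 u -> eigenspace a E4 v ->
  eigenspace a E4 (u ∙ v).
Proof.
move=> /eig_E0[PX XP uk uj] /eig_E4[vE d0 v2]; apply/eigE.
set c := \tr (u.1 *m P) in PX XP uk *.
have w1 : (u ∙ v).1 = 2^-1 *: (u.1 *m v.1 + v.1 *m u.1).
  rewrite /=; have -> : v.2 = 0 by apply/rowP => j; rewrite v2 mxE.
  by rewrite wsum0r addr0.
have w2 j : (u ∙ v).2 0 j = 0.
  rewrite /= mxE v2 mulr0 add0r; have [->|ji] := eqVneq j i.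
    by rewrite d0 mul0r.
  by rewrite uj // mulr0.
have half : P *m (u ∙ v).1 + (u ∙ v).1 *m P = (u ∙ v).1.
  rewrite w1; set X := u.1 in PX XP *; set Y := v.1 in vE *.
  have XY : X *m Y = c *: (P *m Y) + X *m Y *m P.
    by rewrite {1}vE mmDr !mmA XP mmZl.
  have YX : Y *m X = P *m Y *m X + c *: (Y *m P).
    by rewrite {1}vE mmDl -[Y *m P *m X]mmA PX mmZr.
  have e1 : P *m (X *m Y) = c *: (P *m Y) by rewrite mmA PX mmZl.
  have e2 : Y *m X *m P = c *: (Y *m P) by rewrite -mmA XP mmZr.
  rewrite !mmE e1 e2 [in RHS]XY [in RHS]YX mmA.
  by mxlin.
apply: mdl_eq => [|j]; last first.
  rewrite [RHS]mxE w2 mulr0; have [->|ji] := eqVneq j i; last by rewrite genmul2j // w2 mulr0.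
  rewrite genmul2 w2 mulr0 add0r -half mmDl p_sandwich -mmA PP trD trZ tr_p.
  rewrite mulr1; have -> : \tr ((u ∙ v).1 *m P) = 0; last by rewrite addr0 mulr0.
  rewrite w1 mmZl trZ -[u.1]/(u.1) tr_sym_P // ?d0 ?mulr0 //.
by rewrite genmul1 half w2 mulr0 scale0r addr0.
Qed.

(** The product of two off-diagonal matrices is block diagonal: P w = P w P = w P, which is tr(w P)
    P. *)
Lemma fusion_44 u v : eigenspace a E4 u -> eigenspace a E4 v ->
  a ∙ perp a (u ∙ v) = 0.
Proof.
move=> /eig_E4[uE c0 u2] /eig_E4[vE d0 v2].
have [h1 h2 h3] := perp_mul (u ∙ v).
have w1 : (u ∙ v).1 = 2^-1 *: (u.1 *m v.1 + v.1 *m u.1).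
  rewrite /=; have -> : v.2 = 0 by apply/rowP => j; rewrite v2 mxE.
  by rewrite wsum0r addr0.
have w2 j : (u ∙ v).2 0 j = 0 by rewrite /= mxE u2 v2 !mulr0 addr0.
apply: mdl_eq => [|j]; last first.
  have [->|ji] := eqVneq j i; first by rewrite h2 mxE.
  by rewrite h3 // w2 mulr0 mxE.
have PXP : P *m u.1 *m P = 0 by rewrite p_sandwich c0 scale0r.
have PYP : P *m v.1 *m P = 0 by rewrite p_sandwich d0 scale0r.
have l1 X Y : P *m X *m P = 0 -> Y = P *m Y + Y *m P ->
    P *m X *m Y = P *m X *m Y *m P.
  by move=> X0 YE; rewrite {1}YE mmDr !mmA X0 mm0l add0r.
have l2 X Y : P *m Y *m P = 0 -> X = P *m X + X *m P ->
    X *m Y *m P = P *m X *m Y *m P.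
  move=> Y0 XE; rewrite {1}XE !mmDl -[X *m P *m Y *m P]mmA -[X *m P *m _]mmA.
  by rewrite [P *m (Y *m P)]mmA Y0 mm0r addr0.
rewrite h1; set c := \tr _; set w := (u ∙ v).1 in w1 c *.
have PW : P *m w = P *m w *m P.
  by rewrite w1 !mmE !mmA -(l1 _ _ PXP vE) -(l1 _ _ PYP uE).
have WP : w *m P = P *m w *m P.
  by rewrite w1 !mmE !mmA -(l2 _ _ PYP uE) -(l2 _ _ PXP vE).
transitivity (0 : 'M[S]_3); last by [].
by rewrite PW WP p_sandwich -/c; mxlin.
Qed.

Lemma fusion_32 l u v : eigenspace a E32 u -> l = E0 \/ l = E4 ->
  eigenspace a l v -> eigenspace a E32 (u ∙ v).
Proof.
move=> /eig_E32[u1 ui] hl hv.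
have vj j : j != i -> v.2 0 j = 0.
  move=> ji; case: hl hv => ->; first by case/eig_E0 => _ _ _; apply.
  by case/eig_E4.
have w1 : (u ∙ v).1 = 0.
  rewrite /= u1 !mmE addr0 scaler0 add0r /wsum big1 // => j _.
  have [->|ji] := eqVneq j i; first by rewrite ui mul0r scale0r.
  by rewrite vj // mulr0 scale0r.
have w2 : (u ∙ v).2 0 i = 0.
  by rewrite /= mxE u1 mm0l tr0 mul0r ui mulr0 addr0.
apply/eigE; apply: mdl_eq => [|j].
  rewrite -[RHS]/(lamS E32 *: (u ∙ v).1) genmul1 w1 w2 !mmE mulr0.
  by mxlin.
have [->|ji] := eqVneq j i; last by rewrite genmul2j // [RHS]mxE.
by rewrite genmul2 w1 w2 mm0l tr0 [RHS]mxE w2 !mulr0 addr0.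
Qed.

Lemma fusion_3232 u v : eigenspace a E32 u -> eigenspace a E32 v ->
  a ∙ (a ∙ perp a (u ∙ v)) = 4^-1 %*: (a ∙ perp a (u ∙ v)).
Proof.
move=> /eig_E32[u1 ui] /eig_E32[v1 vi].
have w2 j : (u ∙ v).2 0 j = 0 by rewrite /= mxE u1 v1 mm0l tr0 !mul0r addr0.
have [h1 h2 h3] := perp_mul (u ∙ v); have [g1 g2] := half_perp (u ∙ v).
have [f1 f2 f3] := L_half g1 g2 h2.
rewrite [RHS](evZ E4); apply: mdl_eq => [|j]; first exact: f1.
rewrite [RHS]mxE; have [->|ji] := eqVneq j i; first by rewrite f2 h2 mulr0.
by rewrite f3 // h3 // w2 !mulr0.
Qed.

Lemma prim_mdl u : a ∙ u = u -> perp a u = 0.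
Proof.
move=> hu; have /eig_E1[u1 ui uj] : eigenspace a E1 u.
  by apply/eigE; rewrite scale1r.
set c := \tr (u.1 *m P) in u1 ui; rewrite perpE form_gen -/c.
have -> : c + 2 * sg * u.2 0 i = 2 * c.
  rewrite ui; transitivity (c + 4 * (sg * sg) * c); first by ring.
  by rewrite sg2; field.
apply/subr0_eq; rewrite subr0; apply/eqP; rewrite subr_eq0; apply/eqP.
apply: mdl_eq => [|j]; first by rewrite u1 /=; mxlin.
rewrite /= -/sg !mxE /=; have [->|ji] := eqVneq j i.
  by rewrite ui mulr1; ring.
by rewrite uj // !mulr0.
Qed.

Lemma axis_eq_mdl : axis_eq a.
Proof.
have hA : half_axial (axisP (mdlgen io p)) (axisE (mdlgen io p)).
  by rewrite axisP_mdl axisE_mdl; apply: half_axial_mdl.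
split.
- exact: x_half_idem hA i b.
- move=> u w; have [h1 h2 h3] := perp_mul u; have [g1 g2] := half_perp u.
  have [f1 f2 f3] := L_half g1 g2 h2; rewrite -/w in f1 f2 f3 g1 g2 h1 h2 h3.
  have [k1 k2 k3] : [/\ (a ∙ (a ∙ w)).1 = 16^-1 *: w.1, (a ∙ (a ∙ w)).2 0 i = 0
      & forall j, j != i -> (a ∙ (a ∙ w)).2 0 j = 32^-1 * (32^-1 * w.2 0 j)].
    split=> [||j ji]; last by rewrite genmul2j // f3.
      rewrite genmul1 f1 f2 mmZr mmZl -scalerDr g1; mxlin.
    by rewrite genmul2 f1 f2 mmZl trZ g2 !mulr0 addr0.
  have io1 : io (9 / 32) = 9 / 32 by rewrite rmorphM fmorphV !rmorph_nat.
  have io2 : io 128^-1 = 128^-1 by rewrite fmorphV !rmorph_nat.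
  apply: mdl_eq => [|j].
    rewrite -[RHS]/(io (9 / 32) *: (a ∙ w).1 - io 128^-1 *: w.1).
    by rewrite k1 f1 io1 io2; mxlin.
  have -> : ((9 / 32) %*: (a ∙ w) - 128^-1 %*: w).2 0 j =
      io (9 / 32) * (a ∙ w).2 0 j - io 128^-1 * w.2 0 j.
    by rewrite [LHS]mxE [X in X + _]mxE [X in _ + X]mxE [X in _ - X]mxE.
  rewrite io1 io2; have [->|ji] := eqVneq j i.
    by rewrite k2 f2 h2 !mulr0 subr0.
  by rewrite k3 // f3 //; field.
- exact: prim_mdl.
move=> l m u v hu hv.
have one l' w z : eigenspace a E1 w -> eigenspace a l' z ->
    fusion_eq a E1 l' (w ∙ z) := fusion_eq_E1 prim_mdl.
case: l hu => hu; first exact: one.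
- case: m hv => hv.
  + by rewrite amulC; apply: fusion_eq_sym; apply: one.
  + exact: fusion_00.
  + exact: fusion_04.
  by rewrite amulC; apply: (fusion_32 hv (or_introl erefl)).
- case: m hv => hv.
  + by rewrite amulC; apply: fusion_eq_sym; apply: one.
  + by rewrite amulC; apply: fusion_04.
  + exact: fusion_44.
  by rewrite amulC; apply: (fusion_32 hv (or_intror erefl)).
case: m hv => hv.
- by rewrite amulC; apply: fusion_eq_sym; apply: one.
- exact: (fusion_32 hu (or_introl erefl)).
- exact: (fusion_32 hu (or_intror erefl)).
exact: fusion_3232.
Qed.

End ModelAxis.

(** * Failure of Norton's inequality outside the range *)

Section Kernel.
Variables (R : realType) (A B : formAlg R) (F : formMor A B).

Definition kerI : set (car A) := [set u | morI F u = 0].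
Definition kerJ : set (coef A) := [set s | morJ F s = 0].

Fact kerI_submod : submod kerI.
Proof.
split; first exact: morI0.
by move=> s u v; rewrite /kerI /= morI_linear => -> ->; rewrite scaler0 addr0.
Qed.
Fact kerI_mul u v : kerI u -> kerI (u ∙ v).
Proof. by rewrite /kerI /= morI_mul => ->; rewrite amul0l. Qed.
Fact kerJ_0 : kerJ 0. Proof. exact: rmorph0. Qed.
Fact kerJ_lin s r r' : kerJ r -> kerJ r' -> kerJ (s * r + r').
Proof. by rewrite /kerJ /= morJD morJM => -> ->; rewrite mulr0 addr0. Qed.
Fact kerJ_scale s v : kerJ s -> kerI (s *: v).
Proof. by rewrite /kerJ /kerI /= morIZ => ->; rewrite scale0r. Qed.
Fact kerJ_forml u v : kerI u -> kerJ ⟨u, v⟩.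
Proof. by rewrite /kerJ /kerI /= morJ_form => ->; rewrite form0l. Qed.
Fact kerJ_formr u v : kerI v -> kerJ ⟨u, v⟩.
Proof. by rewrite /kerJ /kerI /= morJ_form => ->; rewrite form0r. Qed.

(** The image of [F] presented as a quotient of A, since C_4A consists of ideal pairs. For A =
    [hatA] generation by the marked elements is then automatic. *)
Definition kerPair : idealPair A := IdealPair kerI_submod kerI_mul
  kerJ_0 kerJ_lin kerJ_scale kerJ_forml kerJ_formr.

Lemma qI_ker u v : qI kerPair u = qI kerPair v <-> morI F u = morI F v.
Proof.
rewrite qI_eq /= /kerI /= morID morIN.
by split=> [/subr0_eq|->]; rewrite ?subrr.
Qed.

Lemma qJ_ker r s : qJ kerPair r = qJ kerPair s <-> morJ F r = morJ F s.
Proof.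
rewrite qJ_eq /= /kerJ /= morJB.
by split=> [/subr0_eq|->]; rewrite ?subrr.
Qed.

Definition kerfunI (x : car (quotAlg kerPair)) : car B :=
  morI F (repr (x : qcar kerPair)).
Definition kerfunJ (r : coef (quotAlg kerPair)) : coef B :=
  morJ F (repr (r : qcoef kerPair)).

Lemma kerfunIE u : kerfunI (qI kerPair u) = morI F u.
Proof. by apply/qI_ker; rewrite qI_repr. Qed.

Lemma kerfunJE s : kerfunJ (qJ kerPair s) = morJ F s.
Proof. by apply/qJ_ker; rewrite qJ_repr. Qed.

Lemma kerJ_ex (r : coef (quotAlg kerPair)) : exists s, r = qJ kerPair s.
Proof. by exists (repr (r : qcoef kerPair)); rewrite qJ_repr. Qed.

Lemma kerI_ex (x : car (quotAlg kerPair)) : exists u, x = qI kerPair u.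
Proof. by exists (repr (x : qcar kerPair)); rewrite qI_repr. Qed.

Fact kerfunJ_zmod : zmod_morphism kerfunJ.
Proof.
move=> r s; have [[r' ->] [s' ->]] := (kerJ_ex r, kerJ_ex s).
rewrite -[qJ _ r' - qJ _ s'](rmorphB (qJ kerPair : {rmorphism _ -> _})).
by rewrite !kerfunJE morJB.
Qed.

Fact kerfunJ_monoid : monoid_morphism kerfunJ.
Proof.
split=> [|r s].
  rewrite -[1 in LHS](rmorph1 (qJ kerPair : {rmorphism _ -> _})).
  by rewrite kerfunJE morJ1.
have [[r' ->] [s' ->]] := (kerJ_ex r, kerJ_ex s).
rewrite -[qJ _ r' * qJ _ s'](rmorphM (qJ kerPair : {rmorphism _ -> _})).
by rewrite !kerfunJE morJM.
Qed.

HB.instance Definition _ := GRing.isZmodMorphism.Build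
  (coef (quotAlg kerPair)) (coef B) kerfunJ kerfunJ_zmod.
HB.instance Definition _ := GRing.isMonoidMorphism.Build
  (coef (quotAlg kerPair)) (coef B) kerfunJ kerfunJ_monoid.

Let quot := quotMor kerPair.

Fact kerMor_iota r : kerfunJ (iota (quotAlg kerPair) r) = iota B r.
Proof. by rewrite -(morJ_iota quot) kerfunJE morJ_iota. Qed.

Fact kerMor_linear s u v :
  kerfunI (s *: u + v) = kerfunJ s *: kerfunI u + kerfunI v.
Proof.
have [[s' ->] [[u' ->] [v' ->]]] := (kerJ_ex s, (kerI_ex u, kerI_ex v)).
by rewrite -(morI_linear quot) !kerfunIE kerfunJE morI_linear.
Qed.

Fact kerMor_mul u v : kerfunI (u ∙ v) = kerfunI u ∙ kerfunI v.
Proof.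
have [[u' ->] [v' ->]] := (kerI_ex u, kerI_ex v).
by rewrite -(morI_mul quot) !kerfunIE morI_mul.
Qed.

Fact kerMor_form u v : kerfunJ ⟨u, v⟩ = ⟨kerfunI u, kerfunI v⟩.
Proof.
have [[u' ->] [v' ->]] := (kerI_ex u, kerI_ex v).
by rewrite -(morJ_form quot) kerfunJE !kerfunIE morJ_form.
Qed.

Definition kerMor : formMor (quotAlg kerPair) B :=
  @FormMor R (quotAlg kerPair) B (kerfunJ : {rmorphism _ -> _}) kerfunI
    kerMor_iota kerMor_linear kerMor_mul kerMor_form.

Lemma kerMor_injI : injective (morI kerMor).
Proof.
move=> u v; have [[u' ->] [v' ->]] := (kerI_ex u, kerI_ex v).
by rewrite /= !kerfunIE => /qI_ker.
Qed.

Lemma kerMor_injJ : injective (morJ kerMor).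
Proof.
move=> u v; have [[u' ->] [v' ->]] := (kerJ_ex u, kerJ_ex v).
by rewrite /= !kerfunJE => /qJ_ker.
Qed.

Lemma kerMorI u : morI kerMor (qI kerPair u) = morI F u.
Proof. exact: kerfunIE. Qed.

End Kernel.

Section Member.
Variables (R : realType) (A B : formAlg R).

Lemma gen_hatA (f : formMor (hatA R) A) :
  (forall v : car A, exists u, morI f u = v) ->
  (forall s : coef A, exists s', morJ f s' = s) ->
  smallest (@subalg R A) (axes (fun i b => morI f (@hgen R i b))) = setT.
Proof.
move=> surjI surjJ; apply/seteqP; split=> // v _; have [u <-] := surjI v.
set X := axes _; have [[X0 XL] XM] := smallest_subalgP X.
have Xm m : smallest (@subalg R A) X (morI f (<< m >> : hatM R)).
  elim/magma_ind: m => [[i b]|m1 m2 h1 h2].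
    by apply: sub_smallest_subalg; exists i => //; exists b.
  by rewrite -hmulUU (morI_mul f); apply: XM.
elim/hatM_ind: u => [|s m u IH]; first by rewrite morI0.
by rewrite (morI_linear f); apply: XL.
Qed.

Lemma half_axial_inj (G : formMor A B) (P e : 'I_3 -> car A) :
  injective (morI G) -> injective (morJ G) ->
  half_axial (morI G \o P) (morI G \o e) -> half_axial P e.
Proof.
move=> injI injJ hB.
(* Transfer along the identity, with G as the only morphism of the family. *)
pose idm : formMor A A := @FormMor R A A (idfun : {rmorphism _ -> _}) id
  (fun=> erefl) (fun _ _ _ => erefl) (fun _ _ => erefl) (fun _ _ => erefl).
apply: (@half_axial_transfer _ _ _ idm _ _ unit (fun=> B) (fun=> G) _ _ P e).
- by move=> s; exists s.
- by move=> s; exists s.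
- by move=> r s /(_ tt)/injJ.
- by move=> r s /(_ tt)/injI.
by [].
Qed.

End Member.

Section KernelMember.
Variables (R : realType) (p : 'I_3 -> 'M[R]_3).
Hypotheses (p_sandwich : forall i X, p i *m X *m p i = \tr (X *m p i) *: p i)
  (tr_p : forall i, \tr (p i) = 1)
  (tr_pp : forall i j, i != j -> \tr (p i *m p j) = 16^-1).
Let io : {rmorphism R -> R} := idfun.
Let B := mdlAlg io p.

Definition modelMor : formMor (hatA R) B :=
  evMor (@mdlform_assoc R R io p) (mdlgen io p).

Lemma modelMor_gen i b : morI modelMor (@hgen R i b) = mdlgen io p i b.
Proof. exact: etrans (evIU _ _) (evmag_gen _ _ _). Qed.

(** The quotient embeds in the model, and this embedding reflects both the equational form of being
    an axis and the half-axial identities; property P and the shape follow from the latter. *)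
Lemma kerPair_C4A : C4A (kerPair modelMor).
Proof.
set pr := kerPair modelMor; pose G := kerMor modelMor.
have injI : injective (morI G) := @kerMor_injI _ _ _ _.
have injJ : injective (morJ G) := @kerMor_injJ _ _ _ _.
have Gx i b : morI G (qgen pr i b) = mdlgen io p i b.
  by rewrite kerMorI modelMor_gen.
have hA : half_axial (axisP (qgen pr)) (axisE (qgen pr)).
  apply: (half_axial_inj injI injJ).
  rewrite (mor_axisP G (qgen pr)) (mor_axisE G (qgen pr)).
  have -> : (fun i b => morI G (qgen pr i b)) = mdlgen io p.
    by apply: funext => i; apply: funext => b.
  rewrite axisP_mdl axisE_mdl; exact: half_axial_mdl.
split.
- move=> kT; have : kerJ modelMor 1 by rewrite -[kerJ _]/(idJ pr) kT.
  by rewrite /kerJ /= => /eqP; rewrite (morJ1 modelMor) oner_eq0.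
- split.
  + apply: (gen_hatA (f := quotMor pr)).
      by move=> v; exists (repr (v : qcar pr)); rewrite [LHS]qI_repr.
    by move=> s; exists (repr (s : qcoef pr)); rewrite [LHS]qJ_repr.
  + move=> _ [i _ [b _ <-]]; apply: axis_of_eq; apply: (axis_eq_inj injI).
    by rewrite Gx; apply: axis_eq_mdl.
  split.
  + exists (qgen pr ord0 true), (qgen pr ord0 true).
    rewrite (x_half_form hA) => /(congr1 (morJ G)).
    by rewrite (morJ1 G) rmorph0 => /eqP; rewrite oner_eq0.
  + exact: (ha_formA hA).
  by move=> _ [i _ [b _ <-]]; apply: (x_half_form hA).
- exact: propertyP_half.
exact: shape4A_half.
Qed.

End KernelMember.

(** * Passage of the inequality from M(t) to a member of C_4A *)

Section NortonMember.
Variables (R : realType) (t : R) (H B : formAlg R) (F : formMor H B).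
Variables (p : idealPair H) (h : coef H).
Hypotheses (p_ker : idJ p `<=` kerJ F) (F_h : morJ F h = iota B t).
Local Notation M := (quotAlg p).
Local Notation pt := (principalPair (morJ (quotMor p) h - iota M t)).

Definition norton_diff (A : formAlg R) (u v : car A) : coef A :=
  ⟨u ∙ u, v ∙ v⟩ - ⟨u ∙ v, u ∙ v⟩.

Lemma mor_norton (A C : formAlg R) (f : formMor A C) u v :
  morJ f (norton_diff u v) = norton_diff (morI f u) (morI f v).
Proof. by rewrite /norton_diff morJB !morJ_form !morI_mul. Qed.

(** [morJ F] vanishes on [idJ p] and on h - t, so it factors through the coefficient ring of the
    quotient by [pt], and a real value found there is also the value under [F]. *)
Lemma norton_specialise : norton (quotAlg pt) -> forall u v : car H,
  real_nonneg (norton_diff (morI F u) (morI F v)).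
Proof.
pose toM := quotMor p; pose toT := quotMor pt.
move=> nM u v; have [r r_ge0 hr] := nM (morI toT (morI toM u)) (morI toT (morI toM v)).
exists r => //; rewrite -mor_norton -(morJ_iota F).
have {}hr : morJ toT (morJ toM (norton_diff u v)) =
    morJ toT (morJ toM (iota H r)).
  by rewrite !mor_norton !morJ_iota; exact: hr.
have /qJ_eq[s _ hs] := hr.
pose s' : coef H := repr (s : qcoef p).
have sE : s = morJ toM s' by rewrite /s' [RHS]qJ_repr.
have : morJ toM (norton_diff u v - iota H r) =
    morJ toM ((h - iota H t) * s').
  by rewrite morJB -hs morJM -sE morJB morJ_iota.
move=> /qJ_eq/p_ker; rewrite /kerJ /=.
move: (norton_diff u v) => d; rewrite morJB morJM 2!morJB F_h.
by rewrite (morJ_iota F t) subrr mul0r subr0 => /subr0_eq.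
Qed.

End NortonMember.

(** * Violation of the inequality in the real model *)

Section Members.
Variable R : realType.
Variables (w w' : R).
Hypothesis ww' : w * w' = 1.

(** With standard basis columns any Gram matrix is attained. The factorisation [frame_x], [frame_y]
    would need a square root of (26 + c) / 30, which is negative for large t. *)
Definition std_x (i : 'I_3) : 'cV[R]_3 := \col_k (k == i)%:R.
Definition std_y (i : 'I_3) : 'rV[R]_3 := \row_k frame_gram w w' i k.

Lemma gram_std i j : gram std_x std_y i j = frame_gram w w' i j.
Proof.
rewrite /gram mxE (bigD1 j) //= big1 => [|k kj].
  by rewrite !mxE eqxx mulr1 addr0.
by rewrite !mxE (negbTE kj) mulr0.
Qed.

Local Notation p := (rk1 std_x std_y).
Local Notation E i j := (std_x i *m std_y j).
Let io : {rmorphism R -> R} := idfun.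
Let i2 : 'I_3 := @Ordinal 3 1 isT.
Let i3 : 'I_3 := @Ordinal 3 2 isT.

Lemma mul_EE i j k l : E i j *m E k l = frame_gram w w' j k *: E i l.
Proof.
rewrite mulmxA -[E i j *m std_x k]mulmxA [std_y j *m std_x k]mx11_scalar.
by rewrite -[X in X%:M]/(gram _ _ _ _) gram_std mul_mx_scalar -scalemxAl.
Qed.

(* With r = w / 4 or w' / 4 only one of the two matrix units survives in
   [probe_mdl]. *)
Definition probe (A : formAlg R) (P : 'I_3 -> car A) (r : R) : car A :=
  P ord0 ∙ (P i3 ∙ P i2) + P i2 ∙ (P i3 ∙ P ord0) - P i3 ∙ (P ord0 ∙ P i2)
  - r %*: (P ord0 ∙ P i2).

Lemma mor_probe (A B : formAlg R) (F : formMor A B) (P : 'I_3 -> car A) r :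
  morI F (probe P r) = probe (morI F \o P) r.
Proof. by rewrite /probe !morE. Qed.

(** The first three terms of [probe] form the Jordan triple product (p_1 p_3 p_2 + p_2 p_3 p_1) / 2,
    in which the two matrix units get the different weights w' / 32 and w / 32, while P_1 ∙ P_2
    gives both the weight 1/8. *)
Lemma probe_mdl (r : R) : probe (mdlP io p) r =
  ((w' / 32 - r / 8) *: E ord0 i2 + (w / 32 - r / 8) *: E i2 ord0, 0).
Proof.
rewrite /probe !mulXX ioZ; apply: injective_projections => /=; last first.
  by rewrite addr0 scaler0 !subr0.
rewrite /rk1 !mmE !mul_EE !mmE !mul_EE /frame_gram /=.
by mxlin.
Qed.

Lemma norton_neg (H : formAlg R) (g : 'I_3 -> bool -> car H)
    (F : formMor H (mdlAlg io p)) :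
  w != w' -> (forall i b, morI F (g i b) = mdlgen io p i b) ->
  ~ real_nonneg (norton_diff (morI F (probe (axisP g) (w / 4)))
                             (morI F (probe (axisP g) (w' / 4)))).
Proof.
move=> w_neq Fg.
have FP : morI F \o axisP g = mdlP io p.
  rewrite -axisP_mdl; apply: funext => i /=.
  by rewrite !axisPE morID !Fg.
rewrite !mor_probe FP !probe_mdl /norton_diff; set al := (w' - w) / 32.
have -> : (w' / 32 - w / 4 / 8) *: E ord0 i2 + (w / 32 - w / 4 / 8) *: E i2 ord0
    = al *: E ord0 i2 by rewrite /al; mxlin.
have -> : (w' / 32 - w' / 4 / 8) *: E ord0 i2 + (w / 32 - w' / 4 / 8) *: E i2 ord0
    = - al *: E i2 ord0 by rewrite /al; mxlin.
rewrite norton_mdl; last 3 first.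
- exact: (frame_tr gram_std).
- exact: (frame_tr2 ww' gram_std).
- by apply: p_idem; [exact: rk1_sandwich | exact: (frame_tr gram_std)].
rewrite [X in _ + 2 * X]big1 => [|i _]; last first.
  by rewrite /wnorton /= !mxE !scale0r subr0 !mm0l !tr0 expr0n subr0.
rewrite [X in 16^-1 * X]big1 => [|i _]; last first.
  by rewrite big1 // => j _; rewrite !mxE mul0r subr0 expr0n.
rewrite /= !mmE !mul_EE !mmE !mul_EE !mmE !mul_EE !trE !tr_xy !gram_std /frame_gram /=.
case=> r r_ge0 /=.
have al2 : 0 < al ^+ 2.
  by rewrite exprn_even_gt0 //= /al mulf_neq0 ?invr_eq0 ?pnatr_eq0 // subr_eq0 eq_sym.
move=> hr; move: r_ge0; rewrite -[r]hr.
(* Two Gram entries 1/4 enter tr(E_12 E_12 E_21 E_21) and only entries 1 enter tr(E_12 E_21 E_12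
   E_21), whence 1/16 - 1 = -15/16. *)
set X := (X in 0 <= X); have -> : X = - (15 / 16 * (al ^+ 2 * al ^+ 2)).
  by rewrite /X; field.
rewrite oppr_ge0 leNgt => /negP; apply.
by rewrite mulr_gt0 ?(mulr_gt0 al2) //; lra.
Qed.

End Members.

Lemma range_of_norton (R : realType) (t : R) : norton (Mt t) -> 0 <= t <= 6^-1.
Proof.
move=> nt; apply/negPn/negP => t_out.
(* Here c = 1 - 12 t, and c^2 - 1 = 144 t (t - 1/6) is positive outside the range, so w and w' are
   distinct real numbers with product 1. *)
pose q : R := 64^-1 - 3 / 16 * t; pose c := 64 * q.
have c1 : 0 < c ^+ 2 - 1.
  have -> : c ^+ 2 - 1 = 24 * 6 * (t * (t - 6^-1)) by rewrite /c /q; field.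
  move: t_out; rewrite negb_and -!ltNge => /orP[t0|t6].
    by nra.
  by nra.
pose d := Num.sqrt (c ^+ 2 - 1).
have d_gt0 : 0 < d by rewrite sqrtr_gt0.
have d2 : d ^+ 2 = c ^+ 2 - 1 by rewrite sqr_sqrtr // ltW.
pose w := c + d; pose w' := c - d.
have ww' : w * w' = 1.
  have -> : w * w' = c ^+ 2 - d ^+ 2 by rewrite /w /w'; ring.
  by rewrite d2; ring.
have wc : w + w' = 2 * c by rewrite /w /w'; ring.
have w_neq : w != w' by rewrite /w /w'; apply/eqP; lra.
have xy_gram := gram_std w w'.
pose p := rk1 (std_x R) (std_y w w').
have sand : forall i X, p i *m X *m p i = \tr (X *m p i) *: p i by exact: rk1_sandwich.
have tr1 : forall i, \tr (p i) = 1 by exact: (frame_tr xy_gram).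
have tr2 : forall i j, i != j -> \tr (p i *m p j) = 16^-1.
  exact: (frame_tr2 ww' xy_gram).
pose io : {rmorphism R -> R} := idfun.
have C_ker := kerPair_C4A sand tr1 tr2.
have p_ker : idJ (cap4A R) `<=` kerJ (modelMor p) by move=> s cs; exact: (cs _ C_ker).
pose h : coef (hatA R) := cscale 12^-1 1 - cscale (16 / 3)
    (trP (axisP (@hgen R)) (inord 0) (axisP (@hgen R) (inord 1) ∙ axisP (@hgen R) (inord 2))).
have F_h : morJ (modelMor p) h = iota (mdlAlg io p) t.
  rewrite /h (mor_tr_axisP (modelMor p)).
  have -> : (fun i b => morI (modelMor p) (@hgen R i b)) = mdlgen io p.
    by apply: funext => i; apply: funext => b; exact: modelMor_gen.
  rewrite axisP_mdl /=.
  rewrite (frame_tr3 ww' wc xy_gram (q := q)) -?val_eqE /= ?inordK //.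
  by rewrite /cscale /= /q; field.
(* The generator of the ideal is rewritten as the image of h - t, with h in the universal ring,
   where it can be evaluated in the model. *)
have nt' : norton (quotAlg (principalPair (morJ (quotMor (cap4A R)) h - iota (M4A R) t))).
  by rewrite /h -(t4A_tr R).
have := norton_specialise p_ker F_h nt'.
move=> /(_ (probe (axisP (@hgen R)) (w / 4)) (probe (axisP (@hgen R)) (w' / 4))).
apply: (norton_neg ww' w_neq); exact: modelMor_gen.
Qed.

Theorem proposition6p6 (R : realType) (t : R) :
  norton (Mt t) <-> 0 <= t <= 6^-1.
Proof. by split; [exact: range_of_norton | exact: norton_of_range]. Qed.
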